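(* Let $d\in\mathbb{N}$, $\alpha>0$, $\beta>d/2$, and let $\Phi_{d,\alpha,\beta}$ be the measure on $\mathbb{R}^d\setminus\overline{\mathbb{B}}^d$ with Lebesgue density $f_{d,\alpha,\beta}$. Fix $k\in\{1,\dots,d\}$. For $x=(x_1,\dots,x_k)\in(\mathbb{R}^d)^k$ let $A_x=\operatorname{aff}(x_1,\dots,x_k)$, let $p(A_x)$ be the orthogonal projection of the origin onto $A_x$, and $\operatorname{dist}(A_x)=\|p(A_x)\|$. Put $$\mathcal{S}_{k,d}=\{x=(x_1,\dots,x_k)\in(\mathbb{R}^d)^k:\ A_x\cap\overline{\mathbb{B}}^d=\varnothing,\ \dim A_x=k-1\}$$ and let $T=(T_1,T_2):\mathcal{S}_{k,d}\to(\mathbb{R}^{k-1})^k\times(\mathbb{R}^{d-k+1}\setminus\overline{\mathbb{B}}^{d-k+1})$ be given by $$T_1(x)=\left(\frac{I_{A_x}(x_1)}{\sqrt{\operatorname{dist}^2(A_x)-1}},\ldots,\frac{I_{A_x}(x_k)}{\sqrt{\operatorname{dist}^2(A_x)-1}}\right),\qquad T_2(x)=I_{A_x^\perp}(p(A_x)).$$ Denote by $\mu|_B$ the restriction of a measure $\mu$ to a set $B$. Then: (a) One has the product decomposition $$\Big(\bigotimes_{i=1}^k\Phi_{d,\alpha,\beta}\Big)\Big|_{\mathcal{S}_{k,d}}\circ T^{-1}=\phi_{k-1}\otimes\Big(\Big(\bigotimes_{i=1}^k\Phi_{d,\alpha,\beta}\Big)\Big|_{\mathcal{S}_{k,d}}\circ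 T_2^{-1}\Big),$$ where $\phi_{k-1}$ is the probability measure on $(\mathbb{R}^{k-1})^k$ whose Lebesgue density is a constant multiple of $$V_{k-1}^{d-k+1}(\operatorname{conv}(z_1,\dots,z_k))\prod_{i=1}^k\tilde f_{k-1,\beta}(z_i),\qquad z_1,\dots,z_k\in\mathbb{R}^{k-1}.$$ (b) The Lebesgue density of the measure $\big(\bigotimes_{i=1}^k\Phi_{d,\alpha,\beta}\big)\big|_{\mathcal{S}_{k,d}}\circ T_2^{-1}$ on $\mathbb{R}^{d-k+1}\setminus\overline{\mathbb{B}}^{d-k+1}$ is $f_{d-k+1,\alpha^k,\,k\beta-\frac{(d+1)(k-1)}{2}}$.
   Context: $\overline{\mathbb{B}}^n$ is the closed unit ball in $\mathbb{R}^n$. For $n\in\mathbb{N}$, $\alpha>0$, $\beta>n/2$, $$f_{n,\alpha,\beta}(x)=\frac{\alpha\,\tilde c_{n,\beta}}{(\|x\|^2-1)^\beta},\quad\|x\|>1,\qquad\tilde c_{n,\beta}=\frac{\Gamma(\beta)}{\pi^{n/2}\Gamma(\beta-\frac n2)}.$$ The beta' density on $\mathbb{R}^{k-1}$ is $\tilde f_{k-1,\beta}(z)=\tilde c_{k-1,\beta}(1+\|z\|^2)^{-\beta}$. $V_{k-1}(\operatorname{conv}(z_1,\dots,z_k))$ is the $(k-1)$-dimensional volume of the simplex $\operatorname{conv}(z_1,\dots,z_k)$, and $V_{k-1}^{d-k+1}$ is its $(d-k+1)$-st power. For an affine subspace $E\subset\mathbb{R}^d$, $p(E)$ is the point of $E$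 closest to the origin, $\pi_E$ is the orthogonal projection onto $E$, and $E^\perp$ is the linear orthogonal complement of the direction space of $E$. For every affine subspace $E\subset\mathbb{R}^d$ of the relevant dimension $\ell$ (that is, $\ell=k-1$ for $I_{A_x}$ and $\ell=d-k+1$ for $I_{A_x^\perp}$) an isometry $I_E:E\to\mathbb{R}^\ell$ with $I_E(p(E))=0$ is fixed, such that $(x,E)\mapsto I_E(\pi_E(x))$ is Borel measurable from $\mathbb{R}^d\times A(d,\ell)$ to $\mathbb{R}^\ell$, where $A(d,\ell)$ is the space of $\ell$-dimensional affine subspaces of $\mathbb{R}^d$ with its standard Borel $\sigma$-algebra. For a measure $\mu$ and a measurable map $T$, $\mu\circ T^{-1}$ is the image measure. *)

(* Defs.v *)
From HB Require Import structures.
From mathcomp Require Import all_boot all_order all_algebra.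
From mathcomp Require Import all_classical all_reals all_analysis.

Set Implicit Arguments.
Unset Strict Implicit.
Unset Printing Implicit Defensive.

Import Order.TTheory GRing.Theory Num.Theory.
Import numFieldNormedType.Exports.

Local Open Scope classical_set_scope.
Local Open Scope ring_scope.

(* The library norm `|x| on 'rV[R]_n is the sup norm, hence [enorm]. *)
Definition edot (R : realType) (n : nat) (u v : 'rV[R]_n) : R :=
  \sum_i u 0 i * v 0 i.

Definition enorm (R : realType) (n : nat) (u : 'rV[R]_n) : R :=
  Num.sqrt (edot u u).

Definition closed_unit_ball (R : realType) (n : nat) : set 'rV[R]_n :=
  [set x | enorm x <= 1].
Arguments closed_unit_ball : clear implicits.

(* Borel sigma-algebra; the sup-norm topology is the Euclidean one. *)
Definition borel_mx_display : measure_display. Proof. exact: default_measure_display. Qed.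

Section borel_mx.
Context (R : realType) (m n : nat).

Let borel_mx : set (set 'M[R]_(m, n)) := <<s [set U | open U] >>.

Let borel_mx0 : borel_mx set0.
Proof. exact: sigma_algebra0. Qed.

Let borel_mxC A : borel_mx A -> borel_mx (~` A).
Proof. exact: sigma_algebraC. Qed.

Let borel_mx_bigcup (F : (set 'M[R]_(m, n))^nat) :
  (forall i, borel_mx (F i)) -> borel_mx (\bigcup_i F i).
Proof. exact: sigma_algebra_bigcup. Qed.

HB.instance Definition _ := @isMeasurable.Build borel_mx_display
  'M[R]_(m, n) borel_mx borel_mx0 borel_mxC borel_mx_bigcup.

End borel_mx.

(* As in [product_measure1], measures are handled as bare set functions;
   only their values on measurable sets are meaningful. *)
Section power_measure.
Context (R : realType) (disp : measure_display) (T : measurableType disp).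
Variable mu : set T -> \bar R.

Fixpoint power_measure (n : nat) : set (n.-tuple T) -> \bar R :=
  match n with
  | 0%N => dirac [tuple]
  | n'.+1 => pushforward (mu \x @power_measure n')%E
               (fun q : T * n'.-tuple T => cons_tuple q.1 q.2)
  end.

End power_measure.
Arguments power_measure {R disp T} mu n _.

Definition lebesgue_rV (R : realType) (n : nat) : set 'rV[R]_n -> \bar R :=
  pushforward (power_measure (@lebesgue_measure R) n)
    (fun t : n.-tuple (measurableTypeR R) => \row_i (tnth t i : R)).
Arguments lebesgue_rV : clear implicits.

Definition restrict_measure (R : realType) (T : Type) (mu : set T -> \bar R)
    (B : set T) : set T -> \bar R :=
  fun A => mu (A `&` B).

Definition Gamma (R : realType) (s : R) : R :=
  Rintegral (@lebesgue_measure R) `]0, +oo[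
    (fun t => t `^ (s - 1) * expR (- t)).

Definition ctilde (R : realType) (n : nat) (beta : R) : R :=
  Gamma beta / (pi `^ (n%:R / 2) * Gamma (beta - n%:R / 2)).

(* Only meant for [1 < enorm x]. *)
Definition fdens (R : realType) (n : nat) (alpha beta : R) (x : 'rV[R]_n) : R :=
  alpha * ctilde n beta / (enorm x ^+ 2 - 1) `^ beta.

(* The measure on the complement of the closed unit ball with density [fdens],
   seen as a measure on the whole space which vanishes on the ball. *)
Definition Phi (R : realType) (n : nat) (alpha beta : R) :
    set 'rV[R]_n -> \bar R :=
  fun A => (\int[lebesgue_rV R n]_(x in A `\` closed_unit_ball R n)
              (fdens alpha beta x)%:E)%E.

Arguments Phi {R} n alpha beta _.

Definition ftilde (R : realType) (n : nat) (beta : R) (z : 'rV[R]_n) : R :=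
  ctilde n beta * (1 + enorm z ^+ 2) `^ (- beta).

Definition aff (R : realType) (n k : nat) (x : k.-tuple 'rV[R]_n) :
    set 'rV[R]_n :=
  [set y | exists c : 'I_k -> R,
    \sum_i c i = 1 /\ y = \sum_i c i *: tnth x i].

Definition conv_hull (R : realType) (n k : nat) (x : k.-tuple 'rV[R]_n) :
    set 'rV[R]_n :=
  [set y | exists c : 'I_k -> R,
    [/\ forall i, 0 <= c i, \sum_i c i = 1 & y = \sum_i c i *: tnth x i]].

Definition volume (R : realType) (n : nat) (A : set 'rV[R]_n) : R :=
  fine (lebesgue_rV R n A).

Definition simplex_density (R : realType) (d k : nat) (beta : R)
    (z : k.-tuple 'rV[R]_(k.-1)) : R :=
  volume (conv_hull z) ^+ (d - k).+1 * \prod_(i < k) ftilde beta (tnth z i).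

(* The affine subspace through [q.1] directed by the rows of [q.2]. *)
Definition flat_of (R : realType) (d l : nat)
    (q : 'rV[R]_d * 'M[R]_(l, d)) : set 'rV[R]_d :=
  [set y | (y - q.1 <= q.2)%MS].

Definition affG (R : realType) (d l : nat) : set (set 'rV[R]_d) :=
  [set E | exists q : 'rV[R]_d * 'M[R]_(l, d), row_free q.2 /\ E = flat_of q].
Arguments affG : clear implicits.

(* The standard topology of the affine Grassmannian: the quotient topology for the map sending
   a point and a linearly independent family to the flat they define (the
   families with [row_free] form an open set). *)
Definition open_affG (R : realType) (d l : nat) : set (set (set 'rV[R]_d)) :=
  [set U | U `<=` affG R d l /\
    open [set q : 'rV[R]_d * 'M[R]_(l, d) | row_free q.2 /\ U (flat_of q)]].
Arguments open_affG : clear implicits.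

(* The carrier is [set 'rV[R]_d]; its sigma-algebra induces the Borel
   sigma-algebra on its measurable subset [affG R d l]. *)
Definition borel_affG (R : realType) (d l : nat) :=
  g_sigma_algebraType (open_affG R d l).

Definition closest_point (R : realType) (d : nat) (E : set 'rV[R]_d) :
    'rV[R]_d :=
  xget 0 [set y | E y /\ forall z, E z -> enorm y <= enorm z].

Definition oproj (R : realType) (d : nat) (E : set 'rV[R]_d) (x : 'rV[R]_d) :
    'rV[R]_d :=
  xget 0 [set y | E y /\ forall z, E z -> edot (x - y) (z - y) = 0].

Definition aff_perp (R : realType) (d : nat) (E : set 'rV[R]_d) :
    set 'rV[R]_d :=
  [set v | forall y z, E y -> E z -> edot v (y - z) = 0].

Definition dist0 (R : realType) (d : nat) (E : set 'rV[R]_d) : R :=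
  enorm (closest_point E).

(* [I E] is only relevant on [E], for [E] in [affG R d l]; onto-ness follows
   from equality of the dimensions. *)
Definition isometry_family (R : realType) (d l : nat)
    (I : set 'rV[R]_d -> 'rV[R]_d -> 'rV[R]_l) : Prop :=
  [/\ forall E, affG R d l E -> forall x y, E x -> E y ->
        enorm (I E x - I E y) = enorm (x - y),
      forall E, affG R d l E -> I E (closest_point E) = 0 &
      measurable_fun [set q : 'rV[R]_d * borel_affG R d l | affG R d l q.2]
        (fun q => I q.2 (oproj q.2 q.1))].

Definition Skd (R : realType) (d k : nat) : set (k.-tuple 'rV[R]_d) :=
  [set x | aff x `&` closed_unit_ball R d = set0 /\ affG R d k.-1 (aff x)].
Arguments Skd : clear implicits.

(* [T1] and [T2] are only relevant on [Skd]. *)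
Definition T1 (R : realType) (d k : nat)
    (I : forall l, set 'rV[R]_d -> 'rV[R]_d -> 'rV[R]_l)
    (x : k.-tuple 'rV[R]_d) : k.-tuple 'rV[R]_(k.-1) :=
  [tuple (Num.sqrt (dist0 (aff x) ^+ 2 - 1))^-1 *:
           I k.-1 (aff x) (tnth x i) | i < k].

Definition T2 (R : realType) (d k : nat)
    (I : forall l, set 'rV[R]_d -> 'rV[R]_d -> 'rV[R]_l)
    (x : k.-tuple 'rV[R]_d) : 'rV[R]_((d - k).+1) :=
  I (d - k).+1 (aff_perp (aff x)) (closest_point (aff x)).

Definition T12 (R : realType) (d k : nat)
    (I : forall l, set 'rV[R]_d -> 'rV[R]_d -> 'rV[R]_l)
    (x : k.-tuple 'rV[R]_d) :
    k.-tuple 'rV[R]_(k.-1) * 'rV[R]_((d - k).+1) :=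
  (T1 I x, T2 I x).

(* Main.v *)
Require Import Defs.
From HB Require Import structures.
From mathcomp Require Import all_boot all_order all_algebra.
From mathcomp Require Import all_classical all_reals all_analysis.
From mathcomp Require Import perm measurable_realfun ring lra.

Set Implicit Arguments.
Unset Strict Implicit.
Unset Printing Implicit Defensive.

Import Order.TTheory GRing.Theory Num.Theory.
Import numFieldNormedType.Exports.

Local Open Scope classical_set_scope.
Local Open Scope ring_scope.

(* The [n+1] points [x_i] of [R^(n+m)] are parametrised by the flat they span,
   given by a direction [M] and the foot [y] of the perpendicular from the
   origin, and by their coordinates [z_i] in that flat.  The Blaschke-Petkantschin
   formula says that Lebesgue measure disintegrates as
   [|det (1, z)|^m dz dy mu(dM)].  As [|x_i|^2 = |z_i|^2 + |y|^2], the integrand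
   only depends on [z] and [y], so that only the total mass of [mu] matters, and
   the homothety [z = sqrt (|y|^2 - 1) z'] separates the variables.  The total
   mass of [mu] is found without computing it: the same formula for the beta'
   probability densities [ctilde (1 + |x|^2)^(- beta)], separated by
   [z = sqrt (|y|^2 + 1) z'], involves the same constants. *)

(** * Powers of Lebesgue measure as Lebesgue measure on matrices *)

(** The fixed isometries are arbitrary up to measurability, so coordinates in a flat cannot be
    computed. In a chart, where flats are graphs over [n] of the coordinates, polarisation still
    forces them to be affine with a prescribed Gram matrix, and the Jacobian only sees the absolute
    determinant, which is the root of a Gram determinant. One chart contains almost every
    configuration, and this suffices for integrals. It does not suffice for measurability: the sets
    of configurations must be Borel, and this may be lost by a change on a null set. Hence a finite
    cover by charts with permuted coordinates. As for the constants, neither the integral of the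
    simplex kernel nor the total mass is known beforehand to be finite; the normalisation identity
    has a positive real on one side and their product with a positive real on the other, which
    excludes [0] and [+oo]. The two homotheties extract the same power, of [|y|^2 + 1] and of
    [|y|^2 - 1] respectively. So the exponent in the law of [T2] is that of a beta' density in
    dimension [m], and this is where its constant [ctilde m] comes from. *)

Section pushforward_embedding.
Context d d' (T : measurableType d) (T' : measurableType d') (R : realType).

Definition pushforward_embedding (mu : set T -> \bar R) (f : T -> T') (g : T' -> T)
    of measurable_fun setT f & measurable_fun setT g & cancel f g :=
  pushforward mu f.

Variable mu : {sigma_finite_measure set T -> \bar R}.
Variables (f : T -> T') (g : T' -> T).
Hypotheses (mf : measurable_fun setT f) (mg : measurable_fun setT g).
Hypothesis gK : cancel f g.

Let pushed := pushforward_embedding mu mf mg gK.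

Let pushed0 : pushed set0 = 0%E.
Proof. by rewrite /pushed /pushforward_embedding /pushforward preimage_set0 measure0. Qed.

Let pushed_ge0 A : (0 <= pushed A)%E.
Proof. exact: measure_ge0. Qed.

Let pushed_additive : semi_sigma_additive pushed.
Proof.
move=> F mF tF mUF; rewrite /pushed /pushforward_embedding /pushforward preimage_bigcup.
apply: measure_semi_sigma_additive.
- by move=> n; rewrite -[X in measurable X]setTI; exact: mf.
- apply/trivIsetP => i j _ _ ij; rewrite -preimage_setI.
  by move/trivIsetP : tF => /(_ _ _ Logic.I Logic.I ij) ->; rewrite preimage_set0.
- by rewrite -preimage_bigcup -[X in measurable X]setTI; exact: mf.
Qed.

HB.instance Definition _ := isMeasure.Build _ _ _ (pushforward_embedding mu mf mg gK)
  pushed0 pushed_ge0 pushed_additive.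

Let pushed_sigma_finite : sigma_finite setT pushed.
Proof.
have [F TF Foo] := sigma_finiteT mu.
exists (fun i => g @^-1` F i).
  by apply/esym; rewrite -preimage_bigcup -TF preimage_setT.
move=> i; have [mF Fi] := Foo i; split.
  by rewrite -[X in measurable X]setTI; exact: mg.
rewrite /pushed /pushforward_embedding /pushforward -comp_preimage.
by rewrite (_ : g \o f = id) //; exact/funext.
Qed.

HB.instance Definition _ := Measure_isSigmaFinite.Build _ _ _
  (pushforward_embedding mu mf mg gK) pushed_sigma_finite.

End pushforward_embedding.

(* The canonical sigma-finite structure of [m1 \x m2] is shadowed in the library
   by the one for subprobabilities, hence this copy. *)
Section sigma_finite_product.
Local Open Scope ereal_scope.
Context d1 d2 (T1 : measurableType d1) (T2 : measurableType d2) (R : realType).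
Variables (m1 : {sigma_finite_measure set T1 -> \bar R})
  (m2 : {sigma_finite_measure set T2 -> \bar R}).

Definition sigma_finite_product : set (T1 * T2) -> \bar R := m1 \x m2.

HB.instance Definition _ := Measure.copy sigma_finite_product (m1 \x m2).

Let product_sigma_finite : sigma_finite setT sigma_finite_product.
Proof.
have [F TF Foo] := sigma_finiteT m1; have [G TG Goo] := sigma_finiteT m2.
pose H (p : nat * nat) := F p.1 `*` G p.2.
exists (fun i => if unpickle i is Some p then H p else set0).
  apply/seteqP; split => // -[x y] _.
  have [i _ Fx] : (\bigcup_i F i) x by rewrite -TF.
  have [j _ Gy] : (\bigcup_i G i) y by rewrite -TG.
  by exists (pickle (i, j)) => //; rewrite pickleK.
move=> i; case: unpickle => [[k l]|]; last by rewrite measure0.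
have [mF Fk] := Foo k; have [mG Gl] := Goo l.
split; first exact: measurableX.
rewrite [ltLHS]product_measure1E //.
by rewrite lte_mul_pinfty // ge0_fin_numE.
Qed.

HB.instance Definition _ := Measure_isSigmaFinite.Build _ _ _ sigma_finite_product
  product_sigma_finite.

End sigma_finite_product.

Section power_measure_theory.
Context (R : realType) (disp : measure_display) (T : measurableType disp).

Lemma measurable_cons_tuple n :
  measurable_fun setT (fun q : T * n.-tuple T => cons_tuple q.1 q.2).
Proof. exact: (measurable_cons measurable_fst measurable_snd). Qed.

Lemma measurable_uncons_tuple n :
  measurable_fun setT (fun t : n.+1.-tuple T => (thead t, [tuple of behead t])).
Proof.
apply: measurable_fun_pair; last exact: measurable_behead.
exact: measurable_tnth.
Qed.

Lemma cons_tupleK n :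
  cancel (fun q : T * n.-tuple T => cons_tuple q.1 q.2)
         (fun t : n.+1.-tuple T => (thead t, [tuple of behead t])).
Proof. by move=> [x t] /=; congr pair; exact: val_inj. Qed.

Variable mu : {sigma_finite_measure set T -> \bar R}.

(** The product defining the next power needs a sigma-finite measure as its second factor, so the
    structure and the power are built in a single induction; the instances are read off
    afterwards. *)
Lemma power_measure_bundle n :
  exists m : {sigma_finite_measure set (n.-tuple T) -> \bar R}, power_measure mu n = m.
Proof.
elim: n => [|n [m IHn]].
  by exists (dirac [tuple] : {sigma_finite_measure set (0.-tuple T) -> \bar R}).
exists (pushforward_embedding (sigma_finite_product mu m) (@measurable_cons_tuple n)
          (@measurable_uncons_tuple n) (@cons_tupleK n)).
by rewrite /= IHn.
Qed.

Section instances.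
Variable n : nat.

Let power0 : power_measure mu n set0 = 0%E.
Proof. by have [m ->] := power_measure_bundle n; rewrite measure0. Qed.

Let power_ge0 A : (0 <= power_measure mu n A)%E.
Proof. by have [m ->] := power_measure_bundle n. Qed.

Let power_additive : semi_sigma_additive (power_measure mu n).
Proof. by have [m ->] := power_measure_bundle n; exact: measure_semi_sigma_additive. Qed.

HB.instance Definition _ := isMeasure.Build _ _ _ (power_measure mu n)
  power0 power_ge0 power_additive.

Let power_sigma_finite : sigma_finite setT (power_measure mu n).
Proof. by have [m ->] := power_measure_bundle n; exact: sigma_finiteT. Qed.

HB.instance Definition _ := Measure_isSigmaFinite.Build _ _ _ (power_measure mu n)
  power_sigma_finite.

End instances.

Lemma measurable_tuple_box n (A : 'I_n -> set T) : (forall i, measurable (A i)) ->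
  measurable [set t : n.-tuple T | forall i, A i (tnth t i)].
Proof.
move=> mA; rewrite (_ : [set _ | _] = \bigcap_(i in [set: 'I_n]) (@tnth n T ^~ i) @^-1` A i).
  apply: fin_bigcap_measurable => // i _.
  by rewrite -[X in measurable X]setTI; exact: measurable_tnth.
by apply/seteqP; split => t /= h i; [move=> _; exact: h|exact: h].
Qed.

Lemma power_measure_box n (A : 'I_n -> set T) : (forall i, measurable (A i)) ->
  power_measure mu n [set t | forall i, A i (tnth t i)] = (\prod_(i < n) mu (A i))%E.
Proof.
elim: n A => [|n IHn] A mA.
  rewrite big_ord0 /= diracE mem_set //= => -[] //.
rewrite big_ord_recl /= /pushforward.
rewrite (_ : _ @^-1` _ = A ord0 `*` [set t : n.-tuple T | forall i, A (lift ord0 i) (tnth t i)]).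
  rewrite product_measure1E //; last exact: (measurable_tuple_box (A := fun i => A (lift ord0 i))).
  by congr (_ * _)%E; exact: (IHn (fun i => A (lift ord0 i))).
apply/seteqP; split => -[x t] /= h.
  split; first exact: (h ord0).
  by move=> i; have := h (lift ord0 i); rewrite tnthS.
move=> i; case: (unliftP ord0 i) => [j ->|->]; last exact: h.1.
by rewrite tnthS; exact: h.2.
Qed.

Lemma ge0_integral_power_measureS n (f : n.+1.-tuple T -> \bar R) :
  measurable_fun [set: n.+1.-tuple T] f -> (forall t, 0 <= f t)%E ->
  (\int[power_measure mu n.+1]_t f t =
   \int[mu]_x \int[power_measure mu n]_t f (cons_tuple x t))%E.
Proof.
move=> mf f0.
pose g := fun z : T * n.-tuple T => f (cons_tuple z.1 z.2).
have mg : measurable_fun setT g by apply: measurableT_comp => //; exact: measurable_cons_tuple.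
transitivity (\int[(mu \x power_measure mu n)%E]_z g z)%E; last first.
  by rewrite (fubini_tonelli1 g mg) // => z; exact: f0.
have := @ge0_integral_pushforward _ _ _ _ R _ (@measurable_cons_tuple n)
  (mu \x power_measure mu n)%E setT f measurableT mf.
by rewrite preimage_setT; apply => t _; exact: f0.
Qed.

End power_measure_theory.

(** * Borel sets of matrices and their generation by the entries *)

Section borel_matrices.
Context (R : realType) (p q : nat).

Lemma open_measurable_mx (U : set 'M[R]_(p, q)) : open U -> measurable U.
Proof. exact: sub_sigma_algebra. Qed.

Lemma measurable_coord i j : measurable_fun setT (fun X : 'M[R]_(p, q) => X i j).
Proof.
apply: (measurability _ (RGenInftyO.measurableE R)).
move=> _ [_ [x ->] <-]; rewrite setTI; apply: open_measurable_mx.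
by apply: open_comp => [X _|]; [exact: coord_continuous|exact: interval_open].
Qed.

Lemma mx_ball_coord (X Y : 'M[R]_(p, q)) e : 0 < e ->
  ball X e Y <-> forall i j, ball (X i j) e (Y i j).
Proof. by move=> e0; split => [|?]; [case|]. Qed.

(** A countable base of the topology. Balls of the sup norm are products of intervals, so membership
    is a condition on each entry separately. *)
Definition rational_cube (c : 'M[rat]_(p, q) * nat) : set 'M[R]_(p, q) :=
  [set X | forall i j, ball (ratr (c.1 i j) : R) c.2.+1%:R^-1 (X i j)].

Lemma open_rational_cube (U : set 'M[R]_(p, q)) X : open U -> U X ->
  exists c, rational_cube c X /\ rational_cube c `<=` U.
Proof.
move=> oU UX; have /nbhs_ballP[e /= e0 eU] : nbhs X U by exact: open_nbhs_nbhs.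
have e20 : 0 < e / 2 by rewrite divr_gt0.
have [n ne] : exists n, (n.+1%:R^-1 : R) < e / 2.
  exists (Num.Def.truncn (e / 2)^-1); rewrite invf_plt ?posrE //.
  exact: truncnS_gt.
have n0 : 0 < n.+1%:R^-1 :> R by rewrite invr_gt0.
have /choice[f fP] : forall ij : 'I_p * 'I_q, exists r : rat,
    `|ratr r - X ij.1 ij.2| < n.+1%:R^-1.
  move=> [i j] /=.
  have /rat_in_itvoo[r] : X i j - n.+1%:R^-1 < X i j + n.+1%:R^-1.
    by rewrite ltrD2l gtrN.
  by rewrite in_itv /= => h; exists r; rewrite ltr_distl.
exists (\matrix_(i, j) f (i, j), n); split.
  by move=> i j; rewrite !mxE /ball /=; exact: (fP (i, j)).
move=> Y h; apply: eU; apply/mx_ball_coord => // i j.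
have := h i j; rewrite !mxE /ball /= => hY; have := fP (i, j) => /= hX.
rewrite (splitr e) -(subrKA (ratr (f (i, j)))) (le_lt_trans (ler_normD _ _)) //.
by rewrite ltrD // ?(lt_trans _ ne) // distrC.
Qed.

Context d (T : measurableType d).

(** An open set is a countable union of rational cubes, and the preimage of a cube is a finite
    intersection of preimages under the entries. *)
Lemma measurable_mxP (f : T -> 'M[R]_(p, q)) :
  (forall i j, measurable_fun setT (fun x => f x i j)) -> measurable_fun setT f.
Proof.
move=> mf; apply: (measurability [set U : set 'M[R]_(p, q) | open U]) => // _ [U oU <-].
rewrite setTI.
have mcube c : measurable (f @^-1` rational_cube c).
  rewrite (_ : f @^-1` rational_cube c = \bigcap_(ij in [set: 'I_p * 'I_q])
    ((fun x => f x ij.1 ij.2) @^-1` ball (ratr (c.1 ij.1 ij.2) : R) c.2.+1%:R^-1)).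
    apply: fin_bigcap_measurable => // -[i j] _ /=.
    rewrite -[X in measurable X]setTI; apply: mf => //.
    exact: measurable_ball.
  apply/seteqP; split => x h; first by move=> [i j] _; exact: h.
  by move=> i j; exact: (h (i, j)).
rewrite (_ : f @^-1` U =
    \bigcup_c [set x | rational_cube c `<=` U /\ rational_cube c (f x)]).
  apply: countable_bigcupT_measurable => // c.
  have [cU|ncU] := pselect (rational_cube c `<=` U).
    rewrite (_ : [set _ | _] = f @^-1` rational_cube c) //.
    by apply/seteqP; split => x; [case|].
  by rewrite (_ : [set _ | _] = set0) // -subset0 => x [].
apply/seteqP; split => x /=; last by move=> [c _ [cU /cU]].
by move=> /(open_rational_cube oU)[c [cfx cU]]; exists c.
Qed.

End borel_matrices.

Section lebesgue_matrices.
Context (R : realType).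

Lemma measurable_row_of_tuple n :
  measurable_fun setT (fun t : n.-tuple (measurableTypeR R) => \row_i (tnth t i : R)).
Proof.
apply: measurable_mxP => i j.
by under eq_fun do rewrite mxE; exact: measurable_tnth.
Qed.

Lemma measurable_tuple_of_row n :
  measurable_fun setT (fun x : 'rV[R]_n => [tuple (x 0 i : measurableTypeR R) | i < n]).
Proof.
apply/measurable_fun_tnthP => i.
rewrite (_ : _ \o _ = fun x : 'rV[R]_n => x 0 i); first exact: measurable_coord.
by apply/funext => x /=; rewrite tnth_mktuple.
Qed.

Lemma row_of_tupleK n : cancel (fun t : n.-tuple (measurableTypeR R) => \row_i (tnth t i : R))
  (fun x : 'rV[R]_n => [tuple (x 0 i : measurableTypeR R) | i < n]).
Proof. by move=> t; apply: eq_from_tnth => i; rewrite tnth_mktuple mxE. Qed.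

HB.instance Definition _ n := SigmaFiniteMeasure.copy (lebesgue_rV R n)
  (pushforward_embedding (power_measure (@lebesgue_measure R) n)
    (@measurable_row_of_tuple n) (@measurable_tuple_of_row n) (@row_of_tupleK n)).

Definition mx_of_rows p q (t : p.-tuple 'rV[R]_q) : 'M[R]_(p, q) :=
  \matrix_i tnth t i.

Definition rows_of_mx p q (X : 'M[R]_(p, q)) : p.-tuple 'rV[R]_q :=
  [tuple row i X | i < p].

Lemma mx_of_rowsK p q : cancel (@mx_of_rows p q) (@rows_of_mx p q).
Proof. by move=> t; apply: eq_from_tnth => i; rewrite tnth_mktuple rowK. Qed.

Lemma rows_of_mxK p q : cancel (@rows_of_mx p q) (@mx_of_rows p q).
Proof. by move=> X; apply/row_matrixP => i; rewrite rowK tnth_mktuple. Qed.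

Lemma measurable_mx_of_rows p q : measurable_fun setT (@mx_of_rows p q).
Proof.
apply: measurable_mxP => i j; under eq_fun do rewrite mxE.
apply: (measurableT_comp (measurable_coord 0 j)); exact: measurable_tnth.
Qed.

Lemma measurable_rows_of_mx p q : measurable_fun setT (@rows_of_mx p q).
Proof.
apply/(measurable_fun_tnthP (@rows_of_mx p q)) => i.
rewrite (_ : _ \o _ = row i); last by apply/funext => x /=; rewrite tnth_mktuple.
apply: (measurable_mxP (f := fun X : 'M[R]_(p, q) => row i X)) => k j.
by under eq_fun do rewrite mxE; exact: measurable_coord.
Qed.

Definition lebesgue_mx p q : set 'M[R]_(p, q) -> \bar R :=
  pushforward_embedding (power_measure (lebesgue_rV R q) p)
    (@measurable_mx_of_rows p q) (@measurable_rows_of_mx p q) (@mx_of_rowsK p q).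

HB.instance Definition _ p q := SigmaFiniteMeasure.copy (@lebesgue_mx p q)
  (pushforward_embedding (power_measure (lebesgue_rV R q) p)
    (@measurable_mx_of_rows p q) (@measurable_rows_of_mx p q) (@mx_of_rowsK p q)).

Definition mx_box p q (A : 'I_p -> 'I_q -> set R) : set 'M[R]_(p, q) :=
  [set X | forall i j, A i j (X i j)].

Lemma measurable_mx_box p q (A : 'I_p -> 'I_q -> set R) :
  (forall i j, measurable (A i j)) -> measurable (mx_box A).
Proof.
move=> mA; rewrite (_ : mx_box A = \bigcap_(ij in [set: 'I_p * 'I_q])
  (fun X : 'M[R]_(p, q) => X ij.1 ij.2) @^-1` A ij.1 ij.2).
  apply: fin_bigcap_measurable => // ij _.
  by rewrite -[X in measurable X]setTI; exact: measurable_coord.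
by apply/seteqP; split => X h; [move=> [i j] _; exact: h|move=> i j; exact: (h (i, j))].
Qed.

Lemma lebesgue_rV_box n (A : 'I_n -> set R) : (forall i, measurable (A i)) ->
  lebesgue_rV R n [set x | forall i, A i (x 0 i)] = (\prod_i lebesgue_measure (A i))%E.
Proof.
move=> mA; rewrite -(power_measure_box (@lebesgue_measure R) mA).
by congr power_measure; apply/seteqP; split => t /= h i; have := h i; rewrite mxE.
Qed.

Lemma measurable_row_box n (A : 'I_n -> set R) :
  (forall i, measurable (A i)) -> measurable [set x : 'rV[R]_n | forall i, A i (x 0 i)].
Proof.
move=> mA; rewrite (_ : [set _ | _] = mx_box (fun _ : 'I_1 => A)).
  exact: measurable_mx_box.
by apply/seteqP; split => x h i //; move=> j; rewrite ord1.
Qed.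

Lemma lebesgue_mx_box p q (A : 'I_p -> 'I_q -> set R) :
  (forall i j, measurable (A i j)) ->
  lebesgue_mx (mx_box A) = (\prod_i \prod_j lebesgue_measure (A i j))%E.
Proof.
move=> mA; under eq_bigr do rewrite -lebesgue_rV_box //.
rewrite -(power_measure_box (lebesgue_rV R q)); last by move=> i; exact: measurable_row_box.
congr power_measure; apply/seteqP; split => t /= h i j.
  by have := h i j; rewrite mxE.
by rewrite mxE; exact: h.
Qed.

Section uniqueness.
Variables p q : nat.

Let boxes : set (set 'M[R]_(p, q)) :=
  [set B | exists2 A, (forall i j, measurable (A i j)) & B = mx_box A].

Lemma borel_mx_boxes : (measurable : set (set 'M[R]_(p, q))) = <<s boxes >>.
Proof.
apply/seteqP; split; last first.
  apply: smallest_sub; first exact: sigma_algebra_measurable.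
  by move=> _ [A mA ->]; exact: measurable_mx_box.
move=> B mB.
(* The identity from the sigma-algebra of boxes to the Borel one is measurable because each entry
   is: a condition on one entry is a box with all other sides full. *)
have mid : @measurable_fun _ _ (g_sigma_algebraType boxes) 'M[R]_(p, q) setT id.
  apply: measurable_mxP => i j _ Y mY; rewrite setTI.
  apply: sub_sigma_algebra.
  exists (fun k l => if (k == i) && (l == j) then Y else setT).
    by move=> k l; case: ifP.
  apply/seteqP; split => X /=.
    by move=> XY k l; case: ifP => // /andP[/eqP -> /eqP ->].
  by move/(_ i j); rewrite !eqxx.
by have := mid measurableT B mB; rewrite setTI preimage_id.
Qed.

(** Boxes form a generating class stable under intersection, and the space is exhausted by cubes of
    finite measure. *)
Lemma lebesgue_mx_unique (m : {measure set 'M[R]_(p, q) -> \bar R}) :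
  (forall A, (forall i j, measurable (A i j)) ->
    m (mx_box A) = (\prod_i \prod_j lebesgue_measure (A i j))%E) ->
  forall B, measurable B -> lebesgue_mx B = m B.
Proof.
move=> mbox B mB.
pose J k : set R := `[- k%:R, k%:R]%classic.
pose cube k : set 'M[R]_(p, q) := mx_box (fun _ _ => J k).
apply: (measure_unique boxes cube) => //.
- exact: borel_mx_boxes.
- move=> _ _ [A mA ->] [A' mA' ->]; exists (fun i j => A i j `&` A' i j).
    by move=> i j; exact: measurableI.
  apply/seteqP; split => X; first by move=> [h h'] i j; split; [exact: h|exact: h'].
  by move=> h; split => i j; have [] := h i j.
- by move=> k; exists (fun _ _ => J k) => // i j; exact: measurable_itv.
- apply/seteqP; split => // X _.
  exists (Num.Def.truncn (\sum_i \sum_j `|X i j|)).+1 => // i j.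
  rewrite /J /= in_itv /= -ler_norml; apply: le_trans (ltW (truncnS_gt _)).
  rewrite (bigD1 i) //= (bigD1 j) //= -addrA lerDl addr_ge0 //.
    exact: sumr_ge0.
  by apply: sumr_ge0 => *; exact: sumr_ge0.
- by move=> _ [A mA ->]; rewrite mbox //; exact: lebesgue_mx_box.
- move=> k; suff: (lebesgue_mx (cube k) < +oo)%E by [].
  have -> : lebesgue_mx (cube k) =
      (\prod_(i < p) \prod_(j < q) lebesgue_measure (J k))%E.
    by apply: lebesgue_mx_box => i j; exact: measurable_itv.
  rewrite ltey_eq; apply/orP; left.
  apply: (big_ind (fun x => x \is a fin_num)) => [//|x y|i _]; first exact: fin_numM.
  apply: (big_ind (fun x => x \is a fin_num)) => [//|x y|j _]; first exact: fin_numM.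
  by rewrite lebesgue_measure_itv /=; case: ifP.
Qed.

End uniqueness.

End lebesgue_matrices.

(** * Changes of variables that rearrange, split or join entries *)

Section transfer.
Context (R : realType).

(** Transposition, permutation of columns, cutting into blocks and translation are all reduced by
    this lemma to the comparison of two products of lengths. *)
Lemma ge0_integral_lebesgue_mx_transfer d (T : measurableType d)
    (mu : {measure set T -> \bar R}) p q (phi : T -> 'M[R]_(p, q)) :
  measurable_fun setT phi ->
  (forall A, (forall i j, measurable (A i j)) ->
    mu (phi @^-1` mx_box A) = (\prod_i \prod_j lebesgue_measure (A i j))%E) ->
  forall f : 'M[R]_(p, q) -> \bar R, measurable_fun setT f -> (forall X, 0 <= f X)%E ->
  (\int[@lebesgue_mx R p q]_X f X = \int[mu]_t f (phi t))%E.
Proof.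
move=> mphi mubox f mf f0.
transitivity (\int[pushforward mu phi]_X f X)%E.
  apply: eq_measure_integral => B mB _.
  exact: (@lebesgue_mx_unique R p q (measure_function_pushforward__canonical__measure_function_Measure mu mphi)).
by rewrite (ge0_integral_pushforward mphi) // => X _; exact: f0.
Qed.


Lemma ge0_integral_lebesgue_rV n (f : 'rV[R]_n -> \bar R) :
  measurable_fun setT f -> (forall X, 0 <= f X)%E ->
  (\int[lebesgue_rV R n]_x f x = \int[@lebesgue_mx R 1 n]_x f x)%E.
Proof.
move=> mf f0; apply/esym.
apply: (ge0_integral_lebesgue_mx_transfer (phi := id : 'rV[R]_n -> 'rV[R]_n)) => // A mA.
rewrite big_ord1 -lebesgue_rV_box //; congr lebesgue_rV; apply/seteqP; split => x /= h.
  by move=> j; exact: h.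
by move=> i j; rewrite ord1.
Qed.

Lemma ge0_integral_power_measure_rows p q (f : p.-tuple 'rV[R]_q -> \bar R) :
  measurable_fun setT f -> (forall t, 0 <= f t)%E ->
  (\int[power_measure (lebesgue_rV R q) p]_t f t =
   \int[@lebesgue_mx R p q]_X f (rows_of_mx X))%E.
Proof.
move=> mf f0; pose g (X : 'M[R]_(p, q)) := f (rows_of_mx X).
have mg : measurable_fun setT g.
  by apply: measurableT_comp => //; exact: measurable_rows_of_mx.
have := ge0_integral_pushforward (@measurable_mx_of_rows R p q)
  (power_measure (lebesgue_rV R q) p) measurableT mg.
rewrite preimage_setT => -> //; last by move=> X _; exact: f0.
by apply: eq_integral => t _; rewrite /g /= mx_of_rowsK.
Qed.

Lemma ge0_integral_trmx p q (f : 'M[R]_(p, q) -> \bar R) :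
  measurable_fun setT f -> (forall X, 0 <= f X)%E ->
  (\int[@lebesgue_mx R p q]_X f X = \int[@lebesgue_mx R q p]_X f X^T)%E.
Proof.
move=> mf f0; apply: ge0_integral_lebesgue_mx_transfer => //.
  by apply: measurable_mxP => i j; under eq_fun do rewrite mxE; exact: measurable_coord.
move=> A mA; rewrite exchange_big /=.
transitivity (@lebesgue_mx R q p (mx_box (fun i j => A j i))).
  by congr lebesgue_mx; apply/seteqP; split => X h i j; have := h j i; rewrite mxE.
by rewrite lebesgue_mx_box.
Qed.

Lemma ge0_integral_col_perm p q (s : 'S_q) (f : 'M[R]_(p, q) -> \bar R) :
  measurable_fun setT f -> (forall X, 0 <= f X)%E ->
  (\int[@lebesgue_mx R p q]_X f X = \int[@lebesgue_mx R p q]_X f (col_perm s X))%E.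
Proof.
move=> mf f0; apply: ge0_integral_lebesgue_mx_transfer => //.
  by apply: measurable_mxP => i j; under eq_fun do rewrite mxE; exact: measurable_coord.
move=> A mA; transitivity (@lebesgue_mx R p q (mx_box (fun i j => A i (s^-1%g j)))).
  congr lebesgue_mx; apply/seteqP; split => X h i j.
    by have := h i (s^-1%g j); rewrite mxE permKV.
  by have := h i (s j); rewrite mxE permK.
rewrite lebesgue_mx_box //; apply: eq_bigr => i _.
by rewrite [RHS](reindex_perm s^-1).
Qed.

Lemma measurable_row_mx d (T : measurableType d) p q1 q2 (f : T -> 'M[R]_(p, q1))
    (g : T -> 'M[R]_(p, q2)) :
  measurable_fun setT f -> measurable_fun setT g ->
  measurable_fun setT (fun x => row_mx (f x) (g x)).
Proof.
move=> mf mg; apply: measurable_mxP => i j.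
case: (split_ordP j) => k ->.
  by under eq_fun do rewrite row_mxEl; exact: (measurableT_comp (measurable_coord i k)).
by under eq_fun do rewrite row_mxEr; exact: (measurableT_comp (measurable_coord i k)).
Qed.

Lemma measurable_trmx d (T : measurableType d) p q (f : T -> 'M[R]_(p, q)) :
  measurable_fun setT f -> measurable_fun setT (fun x => (f x)^T).
Proof.
move=> mf; apply: measurable_mxP => i j; under eq_fun do rewrite mxE.
exact: (measurableT_comp (measurable_coord j i)).
Qed.

Lemma measurable_col_mx d (T : measurableType d) p1 p2 q (f : T -> 'M[R]_(p1, q))
    (g : T -> 'M[R]_(p2, q)) :
  measurable_fun setT f -> measurable_fun setT g ->
  measurable_fun setT (fun x => col_mx (f x) (g x)).
Proof.
move=> mf mg; under eq_fun do rewrite -[col_mx _ _]trmxK tr_col_mx.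
by apply: measurable_trmx; apply: measurable_row_mx; exact: measurable_trmx.
Qed.

Lemma ge0_integral_row_mx p q1 q2 (f : 'M[R]_(p, q1 + q2) -> \bar R) :
  measurable_fun setT f -> (forall X, 0 <= f X)%E ->
  (\int[@lebesgue_mx R p (q1 + q2)]_X f X =
   \int[@lebesgue_mx R p q1]_X \int[@lebesgue_mx R p q2]_Y f (row_mx X Y))%E.
Proof.
move=> mf f0.
have mphi : measurable_fun setT
    (fun z : 'M[R]_(p, q1) * 'M[R]_(p, q2) => row_mx z.1 z.2).
  by apply: measurable_row_mx.
rewrite (ge0_integral_lebesgue_mx_transfer
  (mu := (@lebesgue_mx R p q1 \x @lebesgue_mx R p q2)%E) mphi) //.
  have mg := measurableT_comp mf mphi.
  by rewrite (fubini_tonelli1 _ mg) // => z; exact: f0.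
move=> A mA; transitivity ((@lebesgue_mx R p q1 \x @lebesgue_mx R p q2)%E
    (mx_box (fun i j => A i (lshift q2 j)) `*` mx_box (fun i j => A i (rshift q1 j)))).
  congr product_measure1; apply/seteqP; split => -[X Y] /=.
    move=> h; split => i j.
      by have := h i (lshift q2 j); rewrite row_mxEl.
    by have := h i (rshift q1 j); rewrite row_mxEr.
  move=> [hX hY] i j; case: (split_ordP j) => k ->.
    by rewrite row_mxEl.
  by rewrite row_mxEr.
rewrite product_measure1E; try exact: measurable_mx_box.
rewrite /= !lebesgue_mx_box //.
by rewrite -big_split /=; apply: eq_bigr => i _; rewrite big_split_ord.
Qed.

Lemma ge0_integral_col_mx p1 p2 q (f : 'M[R]_(p1 + p2, q) -> \bar R) :
  measurable_fun setT f -> (forall X, 0 <= f X)%E ->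
  (\int[@lebesgue_mx R (p1 + p2) q]_X f X =
   \int[@lebesgue_mx R p1 q]_X \int[@lebesgue_mx R p2 q]_Y f (col_mx X Y))%E.
Proof.
move=> mf f0.
have mphi : measurable_fun setT
    (fun z : 'M[R]_(p1, q) * 'M[R]_(p2, q) => col_mx z.1 z.2).
  by apply: measurable_col_mx.
rewrite (ge0_integral_lebesgue_mx_transfer
  (mu := (@lebesgue_mx R p1 q \x @lebesgue_mx R p2 q)%E) mphi) //.
  have mg := measurableT_comp mf mphi.
  by rewrite (fubini_tonelli1 _ mg) // => z; exact: f0.
move=> A mA; transitivity ((@lebesgue_mx R p1 q \x @lebesgue_mx R p2 q)%E
    (mx_box (fun i j => A (lshift p2 i) j) `*` mx_box (fun i j => A (rshift p1 i) j))).
  congr product_measure1; apply/seteqP; split => -[X Y] /=.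
    move=> h; split => i j.
      by have := h (lshift p2 i) j; rewrite col_mxEu.
    by have := h (rshift p1 i) j; rewrite col_mxEd.
  move=> [hX hY] i j; case: (split_ordP i) => k ->.
    by rewrite col_mxEu.
  by rewrite col_mxEd.
rewrite product_measure1E; try exact: measurable_mx_box.
by rewrite /= !lebesgue_mx_box // big_split_ord.
Qed.

Lemma lebesgue_measure_shift (a : R) (A : set R) : measurable A ->
  lebesgue_measure ((fun x => x + a) @^-1` A) = lebesgue_measure A.
Proof.
move=> mA; apply/esym.
pose phi := (fun x => x + a) : R -> measurableTypeR R.
have mphi : measurable_fun setT phi by exact: measurable_funD.
apply: (@lebesgue_measure_unique R (measure_function_pushforward__canonical__measure_function_Measure (@lebesgue_measure R) mphi)) => //= _ [[x y]] _ <-.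
rewrite /pushforward /phi /=.
rewrite (_ : _ @^-1` _ = `]x - a, y - a]%classic); last first.
  by apply/seteqP; split => z /=; rewrite !in_itv /= ltrBlDr lerBrDr.
by rewrite !lebesgue_measure_itv /= !lte_fin ltrD2r -!EFinB opprB addrA subrK.
Qed.

End transfer.

Section measurable_matrix_operations.
Context (R : realType) d (T : measurableType d).

Lemma measurable_mx_coord p q (f : T -> 'M[R]_(p, q)) i j :
  measurable_fun setT f -> measurable_fun setT (fun x => f x i j).
Proof. by move=> mf; exact: (measurableT_comp (measurable_coord i j)). Qed.

Lemma measurable_mulmx p q r (f : T -> 'M[R]_(p, q)) (g : T -> 'M[R]_(q, r)) :
  measurable_fun setT f -> measurable_fun setT g ->
  measurable_fun setT (fun x => f x *m g x).
Proof.
move=> mf mg; apply: measurable_mxP => i j; under eq_fun do rewrite mxE.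
by apply: measurable_sum => k; apply: measurable_funM; exact: measurable_mx_coord.
Qed.

Lemma measurable_addmx p q (f g : T -> 'M[R]_(p, q)) :
  measurable_fun setT f -> measurable_fun setT g ->
  measurable_fun setT (fun x => f x + g x).
Proof.
move=> mf mg; apply: measurable_mxP => i j; under eq_fun do rewrite mxE.
by apply: measurable_funD; exact: measurable_mx_coord.
Qed.

Lemma measurable_scalemx p q (f : T -> R) (g : T -> 'M[R]_(p, q)) :
  measurable_fun setT f -> measurable_fun setT g ->
  measurable_fun setT (fun x => f x *: g x).
Proof.
move=> mf mg; apply: measurable_mxP => i j; under eq_fun do rewrite mxE.
by apply: measurable_funM => //; exact: measurable_mx_coord.
Qed.

Lemma measurable_oppmx p q (f : T -> 'M[R]_(p, q)) :
  measurable_fun setT f -> measurable_fun setT (fun x => - f x).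
Proof.
move=> mf; under eq_fun do rewrite -scaleN1r.
exact: measurable_scalemx.
Qed.

Lemma measurable_det n (f : T -> 'M[R]_n) :
  measurable_fun setT f -> measurable_fun setT (fun x => \det (f x)).
Proof.
move=> mf; apply: measurable_sum => s; apply: measurable_funM => //.
by apply: measurable_prod => i _; exact: measurable_mx_coord.
Qed.

Lemma measurable_invr (f : T -> R) :
  measurable_fun setT f -> measurable_fun setT (fun x => (f x)^-1).
Proof.
move=> mf; rewrite (_ : (fun _ => _) = fun x => f x * (f x ^+ 2) `^ (-1)).
  apply: measurable_funM => //.
  by apply: (measurableT_comp (measurable_powR (-1))); exact: measurable_funX.
apply/funext => x; rewrite powR_inv1 ?sqr_ge0 // expr2 invfM mulrA.
have [->|fx0] := eqVneq (f x) 0; first by rewrite mul0r invr0 mulr0.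
by rewrite divff // mul1r.
Qed.

Lemma measurable_invmx n (f : T -> 'M[R]_n) :
  measurable_fun setT f -> measurable_fun setT (fun x => invmx (f x)).
Proof.
(* [invmx] returns its argument on singular matrices, hence the second branch. *)
move=> mf; rewrite (_ : (fun _ => _) =
    fun x => if \det (f x) != 0 then (\det (f x))^-1 *: \adj (f x) else f x).
  apply: measurable_fun_ifT => //.
    apply: (measurable_fun_bool true).
    rewrite setTI (_ : _ @^-1` _ = ~` ((fun x => \det (f x)) @^-1` [set 0])).
      apply: measurableC; rewrite -[X in measurable X]setTI.
      exact: measurable_det.
    by apply/seteqP; split => x /= /eqP.
  apply: measurable_scalemx; first by apply: measurable_invr; exact: measurable_det.
  apply: measurable_mxP => i j; under eq_fun do rewrite mxE.
  apply: measurable_funM => //; apply: measurable_det.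
  by apply: measurable_mxP => k l; under eq_fun do rewrite !mxE; exact: measurable_mx_coord.
by apply/funext => x; rewrite /invmx unitmxE unitfE.
Qed.

Lemma measurable_lsubmx p q1 q2 (f : T -> 'M[R]_(p, q1 + q2)) :
  measurable_fun setT f -> measurable_fun setT (fun x => lsubmx (f x)).
Proof.
move=> mf; apply: measurable_mxP => i j; under eq_fun do rewrite mxE.
exact: measurable_mx_coord.
Qed.

Lemma measurable_rsubmx p q1 q2 (f : T -> 'M[R]_(p, q1 + q2)) :
  measurable_fun setT f -> measurable_fun setT (fun x => rsubmx (f x)).
Proof.
move=> mf; apply: measurable_mxP => i j; under eq_fun do rewrite mxE.
exact: measurable_mx_coord.
Qed.

Lemma measurable_usubmx p1 p2 q (f : T -> 'M[R]_(p1 + p2, q)) :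
  measurable_fun setT f -> measurable_fun setT (fun x => usubmx (f x)).
Proof.
move=> mf; apply: measurable_mxP => i j; under eq_fun do rewrite mxE.
exact: measurable_mx_coord.
Qed.

Lemma measurable_dsubmx p1 p2 q (f : T -> 'M[R]_(p1 + p2, q)) :
  measurable_fun setT f -> measurable_fun setT (fun x => dsubmx (f x)).
Proof.
move=> mf; apply: measurable_mxP => i j; under eq_fun do rewrite mxE.
exact: measurable_mx_coord.
Qed.

Lemma measurable_row p q i (f : T -> 'M[R]_(p, q)) :
  measurable_fun setT f -> measurable_fun setT (fun x => row i (f x)).
Proof.
move=> mf; apply: measurable_mxP => k j; under eq_fun do rewrite mxE.
exact: measurable_mx_coord.
Qed.

End measurable_matrix_operations.

(** * Linear change of variables *)

Section affine_change_of_variables.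
Context (R : realType).

Lemma ge0_integral_lebesgue_opp (f : R -> \bar R) :
  measurable_fun setT f -> (forall t, 0 <= f t)%E ->
  (\int[@lebesgue_measure R]_t f (- t)%R = \int[@lebesgue_measure R]_t f t)%E.
Proof.
move=> mf f0.
pose phi := (-%R) : measurableTypeR R -> measurableTypeR R.
have mphi : measurable_fun setT phi by exact: measurable_funN.
transitivity (\int[pushforward (@lebesgue_measure R) phi]_X f X)%E.
  by rewrite (ge0_integral_pushforward mphi) // => X _; exact: f0.
pose m := measure_function_pushforward__canonical__measure_function_Measure
  (@lebesgue_measure R) mphi.
by apply: (@eq_measure_integral _ _ _ _ _ m) => B mB _; exact: lebesgue_measureN.
Qed.

Lemma lebesgue_measure_scale (a : R) (A : set R) : 0 < a -> measurable A ->
  (a%:E * lebesgue_measure (( *%R a) @^-1` A) = lebesgue_measure A)%E.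
Proof.
move=> a0 mA; apply/esym.
pose phi := ( *%R a) : measurableTypeR R -> measurableTypeR R.
have mphi : measurable_fun setT phi by exact: mulrl_measurable.
pose m := measure_function_pushforward__canonical__measure_function_Measure
  (@lebesgue_measure R) mphi.
pose m' := mscale (NngNum (ltW a0)) m.
apply: (@lebesgue_measure_unique R m') => //= _ [[x y]] _ <-.
rewrite /mscale /= /pushforward /phi /=.
rewrite (_ : _ @^-1` _ = `]x / a, y / a]%classic); last first.
  by apply/seteqP; split => z /=; rewrite !in_itv /= ltr_pdivrMr // ler_pdivlMr // [z * a]mulrC.
rewrite !lebesgue_measure_itv /= !lte_fin ltr_pM2r ?invr_gt0 //.
case: ifP => _; last by rewrite mule0.
by rewrite -!EFinB -EFinM -mulrBl mulrC divfK // gt_eqF.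
Qed.

Lemma ge0_integral_lebesgue_scale (a : R) (f : R -> \bar R) : a != 0 ->
  measurable_fun setT f -> (forall t, 0 <= f t)%E ->
  (`|a|%:E * \int[@lebesgue_measure R]_t f (a * t)%R = \int[@lebesgue_measure R]_t f t)%E.
Proof.
move=> a0 mf f0.
wlog a_gt0 : a a0 / 0 < a.
  move=> wl; have [/wl ->//|a_le0] := ltP 0 a.
  have a_lt0 : a < 0 by rewrite lt_neqAle a0.
  rewrite -normrN -(wl (- a)) ?oppr_eq0 ?oppr_gt0 //.
  congr (_ * _)%E; rewrite -ge0_integral_lebesgue_opp //; last first.
    exact: (measurableT_comp mf (mulrl_measurable a)).
  by apply: eq_integral => t _; rewrite mulrN mulNr.
rewrite gtr0_norm //.
pose phi := ( *%R a) : measurableTypeR R -> measurableTypeR R.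
have mphi : measurable_fun setT phi by exact: mulrl_measurable.
pose m := measure_function_pushforward__canonical__measure_function_Measure
  (@lebesgue_measure R) mphi.
transitivity (\int[mscale (NngNum (ltW a_gt0)) m]_X f X)%E.
  rewrite ge0_integral_mscale //.
  by rewrite (ge0_integral_pushforward mphi) // => X _; exact: f0.
apply: eq_measure_integral => B mB _; exact: lebesgue_measure_scale.
Qed.

End affine_change_of_variables.

Section tonelli.
Context d1 d2 (T1 : measurableType d1) (T2 : measurableType d2) (R : realType).
Variables (m1 : {sigma_finite_measure set T1 -> \bar R})
  (m2 : {sigma_finite_measure set T2 -> \bar R}).
Variable F : T1 -> T2 -> \bar R.
Hypothesis mF : measurable_fun setT (fun z : T1 * T2 => F z.1 z.2).

Hypothesis F0 : forall x y, (0 <= F x y)%E.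

Lemma measurable_integral_r : measurable_fun setT (fun x => \int[m2]_y F x y)%E.
Proof. by apply: (measurable_fun_fubini_tonelli_F (fun z => F z.1 z.2) mF) => z. Qed.

Lemma measurable_integral_l : measurable_fun setT (fun y => \int[m1]_x F x y)%E.
Proof. by apply: (measurable_fun_fubini_tonelli_G (fun z => F z.1 z.2) mF) => z. Qed.

Lemma ge0_integral_swap :
  (\int[m1]_x \int[m2]_y F x y = \int[m2]_y \int[m1]_x F x y)%E.
Proof. by apply: (fubini_tonelli (fun z => F z.1 z.2) mF) => z. Qed.

End tonelli.

Section linear_change_of_variables.
Context (R : realType).

Lemma ge0_integral_shiftmx p q (B : 'M[R]_(p, q)) (f : 'M[R]_(p, q) -> \bar R) :
  measurable_fun setT f -> (forall X, 0 <= f X)%E ->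
  (\int[@lebesgue_mx R p q]_X f (X + B)%R = \int[@lebesgue_mx R p q]_X f X)%E.
Proof.
move=> mf f0; apply/esym/ge0_integral_lebesgue_mx_transfer => //.
  by apply: measurable_addmx.
move=> A mA.
transitivity (@lebesgue_mx R p q (mx_box (fun i j => (fun x => x + B i j) @^-1` A i j))).
  by congr lebesgue_mx; apply/seteqP; split => X h i j; have := h i j; rewrite mxE.
rewrite lebesgue_mx_box.
  by do 2!(apply: eq_bigr => ? _); exact: lebesgue_measure_shift.
move=> i j; rewrite -[X in measurable X]setTI.
have mshift : measurable_fun setT (fun x : R => x + B i j) by exact: measurable_funD.
exact: mshift.
Qed.

Lemma ge0_integral_mx11 (f : 'M[R]_1 -> \bar R) :
  measurable_fun setT f -> (forall X, 0 <= f X)%E ->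
  (\int[@lebesgue_mx R 1 1]_X f X = \int[@lebesgue_measure R]_t f t%:M)%E.
Proof.
move=> mf f0.
apply: (ge0_integral_lebesgue_mx_transfer (mu := @lebesgue_measure R)
  (phi := fun t : measurableTypeR R => t%:M)) => //.
  apply: measurable_mxP => i j; under eq_fun do rewrite mxE !ord1 eqxx mulr1n.
  exact: measurable_id.
move=> A mA; rewrite !big_ord1; congr lebesgue_measure; apply/seteqP; split => t /=.
  by move=> /(_ 0 0); rewrite mxE.
by move=> h i j; rewrite !ord1 mxE.
Qed.

(** The change of variables formula for rows is made a predicate on the matrix because it is stable
    under products, so that it can be checked on the factors of a decomposition. *)
Definition linear_scaling n (A : 'M[R]_n) :=
  forall f : 'rV[R]_n -> \bar R, measurable_fun setT f -> (forall X, 0 <= f X)%E ->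
  (`|\det A|%:E * \int[@lebesgue_mx R 1 n]_x f (x *m A) =
   \int[@lebesgue_mx R 1 n]_x f x)%E.

Lemma linear_scalingM n (A B : 'M[R]_n) :
  linear_scaling A -> linear_scaling B -> linear_scaling (A *m B).
Proof.
move=> hA hB f mf f0; have mg : measurable_fun setT (fun x : 'rV[R]_n => f (x *m B)).
  by apply: measurableT_comp => //; exact: measurable_mulmx.
have /= hAg := hA _ mg (fun x => f0 _).
rewrite -[RHS]hB // -hAg muleA -EFinM -normrM det_mulmx mulrC.
by congr (_ * _)%E; apply: eq_integral => x _; rewrite mulmxA.
Qed.

Lemma linear_scaling_perm n (s : 'S_n) : linear_scaling (perm_mx s).
Proof.
move=> f mf f0; rewrite det_perm normrX normrN1 expr1n mul1e.
rewrite [RHS](ge0_integral_col_perm s^-1) //.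
by apply: eq_integral => x _; rewrite col_permE invgK.
Qed.

(** The matrix sends [(t, y)] to [(t + y *m l, y)]. With [t] integrated first, [y] being fixed, this
    is a translation. *)
Lemma linear_scaling_lblock n (l : 'cV[R]_n) :
  linear_scaling (block_mx (1%:M : 'M[R]_1) 0 l 1%:M).
Proof.
move=> f mf f0; rewrite det_lblock !det1 mulr1 normr1 mul1e.
have mfr : measurable_fun setT (fun z : 'M[R]_(1, 1) * 'rV[R]_n => f (row_mx z.1 z.2)).
  by apply: measurableT_comp => //; exact: measurable_row_mx.
have mg : measurable_fun setT
    (fun x : 'rV[R]_(1 + n) => f (x *m block_mx (1%:M : 'M[R]_1) 0 l 1%:M)).
  by apply: measurableT_comp => //; exact: measurable_mulmx.
rewrite (ge0_integral_row_mx mf f0) (ge0_integral_row_mx mg (fun _ => f0 _)).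
have mgr := measurableT_comp mg (measurable_row_mx measurable_fst measurable_snd).
transitivity (\int[@lebesgue_mx R 1 n]_y \int[@lebesgue_mx R 1 1]_t
    f (row_mx t y *m block_mx (1%:M : 'M[R]_1) 0 l 1%:M))%E.
  exact: (ge0_integral_swap _ _ mgr (fun _ _ => f0 _)).
transitivity (\int[@lebesgue_mx R 1 n]_y \int[@lebesgue_mx R 1 1]_t f (row_mx t y))%E;
  last by apply/esym; exact: (ge0_integral_swap _ _ mfr (fun _ _ => f0 _)).
apply: eq_integral => y _.
have mfy : measurable_fun setT (fun t : 'M[R]_1 => f (row_mx t y)).
  by apply: (measurableT_comp mf); exact: measurable_row_mx.
rewrite -[RHS](ge0_integral_shiftmx (y *m l) mfy (fun _ => f0 _)).
by apply: eq_integral => t _; rewrite mul_row_block !mulmx1 mulmx0 add0r.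
Qed.

Lemma linear_scaling_mx11 (a : R) : a != 0 -> linear_scaling (a%:M : 'M[R]_1).
Proof.
move=> a0 f mf f0; rewrite det_scalar expr1 !ge0_integral_mx11 //; last first.
  by apply: measurableT_comp => //; exact: measurable_mulmx.
rewrite -[RHS](ge0_integral_lebesgue_scale a0) //; last first.
  apply: measurableT_comp => //; apply: measurable_mxP => i j.
  under eq_fun do rewrite mxE !ord1 eqxx mulr1n.
  exact: measurable_id.
congr (_ * _)%E; apply: eq_integral => t _.
by rewrite -scalar_mxM mulrC.
Qed.

(** The matrix sends [(t, y)] to [(t *m a%:M, t *m r + y *m S)]: for fixed [t] the variable [y] is
    transformed by [S] and translated, and then [t] is scaled by [a]. *)
Lemma linear_scaling_ublock n (a : R) (r : 'rV[R]_n) (S : 'M[R]_n) : a != 0 ->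
  linear_scaling S -> linear_scaling (block_mx (a%:M : 'M[R]_1) r 0 S).
Proof.
move=> a0 hS f mf f0; rewrite det_ublock normrM EFinM.
have mfr : measurable_fun setT (fun z : 'M[R]_(1, 1) * 'rV[R]_n => f (row_mx z.1 z.2)).
  by apply: measurableT_comp => //; exact: measurable_row_mx.
have mg : measurable_fun setT
    (fun x : 'rV[R]_(1 + n) => f (x *m block_mx (a%:M : 'M[R]_1) r 0 S)).
  by apply: measurableT_comp => //; exact: measurable_mulmx.
rewrite (ge0_integral_row_mx mf f0) (ge0_integral_row_mx mg (fun _ => f0 _)).
pose h t := (\int[@lebesgue_mx R 1 n]_y f (row_mx t y))%E.
have mh : measurable_fun setT h by apply: measurable_integral_r => //; exact: mfr.
have h0 t : (0 <= h t)%E by exact: integral_ge0.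
rewrite -(linear_scaling_mx11 a0 mh h0).
rewrite -muleA; congr (_ * _)%E; rewrite -ge0_integralZl //; last 2 first.
- apply: measurable_integral_r => //.
  exact: (measurableT_comp mg (measurable_row_mx measurable_fst measurable_snd)).
- by move=> t _; exact: integral_ge0.
apply: eq_integral => t _.
have mft : measurable_fun setT (fun y : 'rV[R]_n => f (row_mx (t *m a%:M) y)).
  by apply: (measurableT_comp mf); exact: measurable_row_mx.
rewrite -[RHS](ge0_integral_shiftmx (t *m r) mft (fun _ => f0 _)).
rewrite -[RHS]hS //; last first.
  by apply: (measurableT_comp mft); exact: measurable_addmx.
congr (_ * _)%E; apply: eq_integral => y _.
by rewrite mul_row_block mulmx0 addr0 addrC.
Qed.

(* LU decomposition, after a row exchange which makes the pivot nonzero. *)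
Lemma linear_scaling_unitmx n (A : 'M[R]_n) : A \in unitmx -> linear_scaling A.
Proof.
elim: n A => [|n IHn] A uA.
  move=> f mf f0; rewrite det_mx00 normr1 mul1e.
  by apply: eq_integral => x _; rewrite [_ *m _]thinmx0 [x]thinmx0.
have pivot (B : 'M[R]_(1 + n)) : B \in unitmx -> B 0 0 != 0 -> linear_scaling B.
  move=> uB a0; set a := B 0 0 in a0.
  (* [S] is the Schur complement of the pivot; it is invertible because [B] is, so the induction
     hypothesis applies to it. *)
  pose c := dlsubmx B; pose r := ursubmx B; pose S := drsubmx B - a^-1 *: c *m r.
  have BE : B = block_mx (1%:M : 'M[R]_1) 0 (a^-1 *: c) 1%:M *m block_mx (a%:M : 'M[R]_1) r 0 S.
    rewrite mulmx_block !mul1mx !mul0mx !addr0 /S [_ *m r + _]addrC subrK.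
    rewrite mul_mx_scalar scalerA divff // scale1r -[LHS]submxK; congr block_mx.
    by rewrite [LHS]mx11_scalar; congr (_%:M); rewrite !mxE; congr (B _ _); exact: val_inj.
  rewrite BE; apply: linear_scalingM; first exact: linear_scaling_lblock.
  apply: linear_scaling_ublock => //; apply: IHn.
  move: uB; rewrite BE unitmx_mul => /andP[_]; rewrite unitmxE det_ublock unitrM.
  by rewrite -unitmxE => /andP[].
have [i Ai] : exists i, A i 0 != 0.
  apply/existsP; apply: contraTT uA; rewrite negb_exists => /forallP A0.
  rewrite unitmxE unitfE negbK (expand_det_col _ 0) big1 // => i _.
  by move: (A0 i); rewrite negbK => /eqP ->; rewrite mul0r.
have tK : tperm_mx 0 i *m tperm_mx 0 i = 1%:M :> 'M[R]_n.+1.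
  by rewrite -perm_mxM tperm2 perm_mx1.
rewrite -[A]mul1mx -tK -mulmxA; apply: linear_scalingM.
  exact: linear_scaling_perm.
apply: pivot; first by rewrite unitmx_mul unitmx_perm.
by rewrite -xrowE mxE tpermL.
Qed.

Lemma ge0_integral_mulmxr p n (A : 'M[R]_n) (f : 'M[R]_(p, n) -> \bar R) :
  A \in unitmx -> measurable_fun setT f -> (forall X, 0 <= f X)%E ->
  ((`|\det A| ^+ p)%:E * \int[@lebesgue_mx R p n]_X f (X *m A) =
   \int[@lebesgue_mx R p n]_X f X)%E.
Proof.
move=> uA; elim: p f => [|p IHp] f mf f0.
  rewrite expr0 mul1e.
  by apply: eq_integral => X _; rewrite [_ *m _]flatmx0 [X]flatmx0.
have mfc : measurable_fun setT (fun z : 'rV[R]_n * 'M[R]_(p, n) => f (col_mx z.1 z.2)).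
  by apply: measurableT_comp => //; exact: measurable_col_mx.
have mg : measurable_fun setT (fun X : 'M[R]_(1 + p, n) => f (X *m A)).
  by apply: measurableT_comp => //; exact: measurable_mulmx.
rewrite (@ge0_integral_col_mx R 1 p n f mf f0).
rewrite (ge0_integral_col_mx mg (fun _ => f0 _)).
pose h (x : 'rV[R]_n) := (\int[@lebesgue_mx R p n]_X f (col_mx x X))%E.
have mh : measurable_fun setT h by apply: measurable_integral_r => //; exact: mfc.
have h0 t : (0 <= h t)%E by exact: integral_ge0.
rewrite -(linear_scaling_unitmx uA mh h0).
rewrite exprS EFinM -muleA; congr (_ * _)%E; rewrite -ge0_integralZl //; last 2 first.
- apply: measurable_integral_r => //.
  exact: (measurableT_comp mg (measurable_col_mx measurable_fst measurable_snd)).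
- by move=> t _; exact: integral_ge0.
apply: eq_integral => x _.
have mfx : measurable_fun setT (fun X : 'M[R]_(p, n) => f (col_mx (x *m A) X)).
  exact: (measurableT_comp mfc (pair1_measurable (x *m A))).
rewrite -[RHS](IHp _ mfx (fun _ => f0 _)).
by congr (_ * _)%E; apply: eq_integral => y _; rewrite mul_col_mx.
Qed.

Lemma ge0_integral_mulmxl p n (A : 'M[R]_p) (f : 'M[R]_(p, n) -> \bar R) :
  A \in unitmx -> measurable_fun setT f -> (forall X, 0 <= f X)%E ->
  ((`|\det A| ^+ n)%:E * \int[@lebesgue_mx R p n]_X f (A *m X) =
   \int[@lebesgue_mx R p n]_X f X)%E.
Proof.
move=> uA mf f0.
have mg : measurable_fun setT (fun X : 'M[R]_(p, n) => f (A *m X)).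
  by apply: measurableT_comp => //; exact: measurable_mulmx.
have mft : measurable_fun setT (fun X : 'M[R]_(n, p) => f X^T).
  by apply: (measurableT_comp mf); exact: measurable_trmx.
rewrite (ge0_integral_trmx mf f0) (ge0_integral_trmx mg (fun _ => f0 _)) -det_tr.
rewrite -[RHS](ge0_integral_mulmxr (A := A^T) _ mft (fun _ => f0 _)) ?unitmx_tr //.
by congr (_ * _)%E; apply: eq_integral => X _; rewrite trmx_mul trmxK.
Qed.

End linear_change_of_variables.

(** * Null sets detected along lines *)

Section null_sets.
Context (R : realType).

Lemma finite_roots (p : {poly R}) : p != 0 -> finite_set [set t | root p t].
Proof.
have [k] := ubnP (size p); elim: k p => // k IHk p pk p0.
have [[a pa]|nopa] := pselect (exists a, root p a); last first.
  rewrite (_ : [set _ | _] = set0) // -subset0 => t /= pt.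
  by apply: nopa; exists t.
have /factor_theorem[q pE] := pa.
have q0 : q != 0 by apply: contraNneq p0 => q0; rewrite pE q0 mul0r.
rewrite (_ : [set _ | _] = [set t | root q t] `|` [set a]); last first.
  by apply/seteqP; split => t /=; rewrite pE rootM root_XsubC;
    [case/orP => [|/eqP ->]; [left|right]|case=> [->|->]; rewrite ?eqxx ?orbT].
rewrite finite_setU; split => //; apply: IHk => //.
by move: pk; rewrite pE size_mul ?polyXsubC_eq0 // size_XsubC addn2 /= ltnS.
Qed.

(** By translation invariance, the measure of [Z] is that of its translate by [- t *: E] for every
    [t]. Integrated over all real [t] and exchanged by Tonelli, this becomes the integral over [X]
    of the lengths of the traces of [Z] on the lines [X + t *: E], which is zero; restricting to [t]
    in the unit interval then bounds the measure of [Z]. *)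
Lemma lebesgue_mx_null_direction p q (Z : set 'M[R]_(p, q)) (E : 'M[R]_(p, q)) :
  measurable Z ->
  (forall X, lebesgue_measure [set t : R | Z (X + t *: E)] = 0%E) ->
  @lebesgue_mx R p q Z = 0%E.
Proof.
move=> mZ Z0.
pose F (X : 'M[R]_(p, q)) (t : measurableTypeR R) : \bar R := (\1_Z (X + t *: E))%:E.
have mF : measurable_fun setT (fun z : 'M[R]_(p, q) * measurableTypeR R => F z.1 z.2).
  have mline : measurable_fun setT
      (fun z : 'M[R]_(p, q) * measurableTypeR R => z.1 + (z.2 : R) *: E).
    by apply: measurable_addmx => //; exact: measurable_scalemx.
  have mind : measurable_fun setT (fun X : 'M[R]_(p, q) => \1_Z X : R).
    exact: measurable_indic.
  by apply/measurable_EFinP; exact: (measurableT_comp mind mline).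
have F0 X t : (0 <= F X t)%E by rewrite lee_fin indicE ler0n.
have mline X : measurable [set t : R | Z (X + t *: E)].
  have mt : measurable_fun setT (fun t : measurableTypeR R => X + t *: E).
    by apply: measurable_addmx => //; apply: measurable_scalemx.
  by rewrite -[X in measurable X]setTI; exact: mt.
have ZT0 : (\int[@lebesgue_measure R]_t (@lebesgue_mx R p q Z) = 0)%E.
  transitivity (\int[@lebesgue_measure R]_t \int[@lebesgue_mx R p q]_X F X t)%E.
    apply: eq_integral => t _; rewrite /F.
    rewrite (ge0_integral_shiftmx (t *: E) (f := fun X => (\1_Z X)%:E)).
    - by rewrite integral_indic // setIT.
    - exact/measurable_EFinP/measurable_indic.
    - by move=> X; rewrite lee_fin indicE ler0n.
  rewrite -(ge0_integral_swap _ _ mF F0); apply: integral0_eq => X _.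
  transitivity (\int[@lebesgue_measure R]_t (\1_[set t : R | Z (X + t *: E)] t)%:E)%E.
    by apply: eq_integral => t _; rewrite /F !indicE.
  rewrite integral_indic ?setIT //; [exact: Z0|exact: mline].
pose J : set R := `[0, 1]%classic.
have J1 : lebesgue_measure J = 1%E by rewrite lebesgue_measure_itv /= lte01 sube0.
apply/eqP; rewrite eq_le measure_ge0 andbT -[leLHS]mule1 -J1.
rewrite -(integral_cst (@lebesgue_measure R)) -?ZT0; last exact: measurable_itv.
by apply: ge0_subset_integral => //; exact: measurable_itv.
Qed.

End null_sets.

Section affine_charts.
Context (R : realType) (n : nat).

(* The rows of [bary u] are the homogeneous coordinates of the points [u]. *)
Definition bary (u : 'M[R]_(n.+1, n)) : 'M[R]_n.+1 :=
  row_mx (const_mx 1 : 'cV[R]_n.+1) u.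

(** Subtracting the first row from the others leaves the edge vectors from the first vertex. *)
Lemma det_bary (u0 : 'rV[R]_n) (u : 'M[R]_n) :
  \det (bary (col_mx u0 u)) = \det (u - const_mx 1 *m u0).
Proof.
have -> : bary (col_mx u0 u) = block_mx (1%:M : 'M[R]_1) 0 (const_mx 1) 1%:M
    *m block_mx (1%:M : 'M[R]_1) u0 0 (u - const_mx 1 *m u0).
  rewrite mulmx_block !mul1mx !mul0mx !addr0 mulmx1 [_ *m u0 + _]addrC subrK.
  rewrite block_mxEh /bary; apply: (congr1 (fun c : 'cV[R]_(1 + n) => row_mx c _)).
  apply/matrixP => i j.
  by rewrite !mxE; case: splitP => k _; rewrite !mxE // !ord1.
by rewrite det_mulmx (@det_lblock R 1 n) (@det_ublock R 1 n) !det1 !mul1r.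
Qed.

Lemma bary_affine (u : 'M[R]_(n.+1, n)) (a : 'rV[R]_n) (A : 'M[R]_n) :
  bary (u *m A + const_mx 1 *m a) = bary u *m block_mx (1%:M : 'M[R]_1) a 0 A.
Proof. by rewrite /bary (@mul_row_block R _ 1 n 1 n) mulmx1 mulmx0 addr0 addrC. Qed.

Lemma det_bary_affine (u : 'M[R]_(n.+1, n)) (a : 'rV[R]_n) (A : 'M[R]_n) :
  \det (bary (u *m A + const_mx 1 *m a)) = \det (bary u) * \det A.
Proof. by rewrite bary_affine det_mulmx (@det_ublock R 1 n) det1 mul1r. Qed.

Lemma measurable_bary d (T : measurableType d) (f : T -> 'M[R]_(n.+1, n)) :
  measurable_fun setT f -> measurable_fun setT (fun x => bary (f x)).
Proof.
exact: (@measurable_row_mx R _ _ n.+1 1 n (fun=> const_mx 1) f (measurable_cst _)).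
Qed.

Definition degenerate : set 'M[R]_(n.+1, n) := [set u | \det (bary u) = 0].

Lemma measurable_degenerate : measurable degenerate.
Proof.
rewrite -[X in measurable X]setTI.
have mdet : measurable_fun setT (fun u : 'M[R]_(n.+1, n) => \det (bary u)).
  by apply: measurable_det; exact: measurable_bary.
exact: (mdet measurableT [set 0]).
Qed.

(** Fix the first vertex and move the others along the rows of [t *: 1%:M]. The edge matrix becomes
    [D + t *: 1%:M], whose determinant is the characteristic polynomial of [- D] at [t], a monic
    polynomial with finitely many roots. *)
Lemma lebesgue_degenerate : @lebesgue_mx R n.+1 n degenerate = 0%E.
Proof.
apply: (lebesgue_mx_null_direction (E := col_mx (0 : 'rV[R]_n) 1%:M)).
  exact: measurable_degenerate.
move=> X; apply: countable_lebesgue_measure0; apply: finite_set_countable.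
pose D := dsubmx (X : 'M[R]_(1 + n, n)) - const_mx 1 *m usubmx (X : 'M[R]_(1 + n, n)).
apply: (@sub_finite_set _ _ [set t | root (char_poly (- D)) t]); last first.
  by apply: finite_roots; rewrite monic_neq0 // char_poly_monic.
move=> t; rewrite /degenerate /= -[X](@vsubmxK _ 1 n) scale_col_mx add_col_mx.
rewrite scaler0 addr0 det_bary => tD; rewrite /root /char_poly -horner_evalE -det_map_mx.
rewrite -tD; apply/eqP; congr (\det _); apply/matrixP => i j.
rewrite !mxE /= horner_evalE hornerD hornerN hornerC hornerMn hornerX opprK mulr_natr.
by rewrite addrCA addrA.
Qed.

(* The points are [(u_i, (1, u_i) *m N)]: [u] gives their first [n] coordinates and
   [N] the affine map of which their flat is the graph. *)
Lemma ge0_integral_chart m (F : 'M[R]_(n.+1, n + m) -> \bar R) :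
  measurable_fun setT F -> (forall X, 0 <= F X)%E ->
  (\int[@lebesgue_mx R n.+1 (n + m)]_X F X =
   \int[@lebesgue_mx R n.+1 m]_N \int[@lebesgue_mx R n.+1 n]_u
      ((`|\det (bary u)| ^+ m)%:E * F (row_mx u (bary u *m N))))%E.
Proof.
move=> mF F0; rewrite (ge0_integral_row_mx mF F0).
pose H (N : 'M[R]_(n.+1, m)) (u : 'M[R]_(n.+1, n)) :=
  ((`|\det (bary u)| ^+ m)%:E * F (row_mx u (bary u *m N)))%E.
have H0 N u : (0 <= H N u)%E by apply: mule_ge0; rewrite ?lee_fin.
have mH : measurable_fun setT (fun z : 'M[R]_(n.+1, m) * 'M[R]_(n.+1, n) => H z.1 z.2).
  have mb : measurable_fun setT (fun z : 'M[R]_(n.+1, m) * 'M[R]_(n.+1, n) => bary z.2).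
    exact: measurable_bary.
  apply: emeasurable_funM.
    apply/measurable_EFinP/measurable_funX/measurableT_comp => //.
    exact: measurable_det.
  apply: measurableT_comp => //; apply: measurable_row_mx => //.
  exact: measurable_mulmx.
rewrite (ge0_integral_swap _ _ mH H0).
have mFr : measurable_fun setT
    (fun z : 'M[R]_(n.+1, n) * 'M[R]_(n.+1, m) => F (row_mx z.1 z.2)).
  by apply: measurableT_comp => //; exact: measurable_row_mx.
apply: ge0_ae_eq_integral => //.
- by apply: measurable_integral_r => //; exact: mFr.
- by apply: measurable_integral_l => //; exact: mH.
- by move=> u _; exact: integral_ge0.
- by move=> u _; exact: integral_ge0.
exists degenerate; split; [exact: measurable_degenerate|exact: lebesgue_degenerate|].
move=> u /= /not_implyP[_ neq]; apply/eqP; apply: contra_notT neq => udet.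
have ub : bary u \in unitmx by rewrite unitmxE unitfE.
have mFu : measurable_fun setT (fun V : 'M[R]_(n.+1, m) => F (row_mx u V)).
  exact: (measurableT_comp mFr (pair1_measurable u)).
rewrite -[LHS](ge0_integral_mulmxl ub mFu (fun _ => F0 _)) -ge0_integralZl //.
apply: (measurableT_comp mFu); exact: measurable_mulmx.
Qed.

End affine_charts.

(** * Charts of the affine Grassmannian *)

Section disintegration.
Context (R : realType) (n m : nat).

Lemma measurable_sqrtr d (T : measurableType d) (f : T -> R) :
  measurable_fun setT f -> measurable_fun setT (fun x => Num.sqrt (f x)).
Proof.
exact: measurableT_comp (continuous_measurable_fun (@sqrt_continuous R)).
Qed.

(* If the rows of [A] have Gram matrix [G], then [|\det A| = sqrt (\det G)]. *)
Lemma norm_det_gram p (A G : 'M[R]_p) : A *m A^T = G -> `|\det A| = Num.sqrt (\det G).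
Proof. by move=> <-; rewrite det_mulmx det_tr -expr2 sqrtr_sqr. Qed.

Definition gram_dir (M : 'M[R]_(n, m)) : 'M[R]_n := 1%:M + M *m M^T.
Definition gram_perp (M : 'M[R]_(n, m)) : 'M[R]_m := 1%:M + M^T *m M.

(** The two Gram determinants are equal, so this is the power [- (n + m) / 2] of
    [\det (1%:M + M *m M^T)]: the density, up to a constant, of the rotation invariant measure on
    the Grassmannian in the chart of graphs. It is kept as it arises, the first factor from the
    coordinates in the flat and the second from the foot. *)
Definition chart_weight (M : 'M[R]_(n, m)) : R :=
  (Num.sqrt (\det (gram_dir M)))^-1 ^+ (m + n.+1) * Num.sqrt (\det (gram_perp M)).

Lemma chart_weight_ge0 M : 0 <= chart_weight M.
Proof. by rewrite mulr_ge0 // exprn_ge0 // invr_ge0. Qed.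

Lemma measurable_chart_weight : measurable_fun setT chart_weight.
Proof.
apply: measurable_funM.
  apply: measurable_funX; apply: measurable_invr; apply: measurable_sqrtr.
  apply: measurable_det; apply: measurable_addmx => //.
  by apply: measurable_mulmx => //; exact: measurable_trmx.
apply: measurable_sqrtr; apply: measurable_det; apply: measurable_addmx => //.
by apply: measurable_mulmx => //; exact: measurable_trmx.
Qed.

(* Its value is never computed, see [grassmann_massE]. *)
Definition grassmann_mass : \bar R :=
  (\int[@lebesgue_mx R n m]_M (chart_weight M)%:E)%E.

Lemma grassmann_mass_ge0 : (0 <= grassmann_mass)%E.
Proof. by apply: integral_ge0 => M _; rewrite lee_fin chart_weight_ge0. Qed.

(** All that the computation retains of the isometries: they turn the parameters of the chart into
    affine, respectively linear, coordinates whose Gram matrices are known. *)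
Variables (flat_coords : 'M[R]_(n, m) -> 'rV[R]_m -> 'M[R]_(n.+1, n) -> 'M[R]_(n.+1, n)).
Variables (foot_coords : 'M[R]_(n, m) -> 'rV[R]_m -> 'rV[R]_m).
Hypothesis flat_coordsE : forall M w, exists (A : 'M[R]_n) (a : 'rV[R]_n), A *m A^T = gram_dir M /\
  forall u, flat_coords M w u = u *m A + const_mx 1 *m a.
Hypothesis foot_coordsE : forall M, exists B : 'M[R]_m, B *m B^T = invmx (gram_perp M) /\
  forall w, foot_coords M w = w *m B.
Hypothesis gram_dir_unit : forall M, gram_dir M \in unitmx.
Hypothesis gram_perp_unit : forall M, gram_perp M \in unitmx.

Variable G : 'M[R]_(n.+1, n) -> 'rV[R]_m -> \bar R.
Hypothesis mG : measurable_fun setT (fun z : 'M[R]_(n.+1, n) * 'rV[R]_m => G z.1 z.2).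
Hypothesis G0 : forall z y, (0 <= G z y)%E.

Let K (y : 'rV[R]_m) := (\int[@lebesgue_mx R n.+1 n]_z
  ((`|\det (bary z)| ^+ m)%:E * G z y))%E.

Let mdG : measurable_fun setT (fun z : 'M[R]_(n.+1, n) * 'rV[R]_m =>
  ((`|\det (bary z.1)| ^+ m)%:E * G z.1 z.2))%E.
Proof.
apply: emeasurable_funM => //.
apply/measurable_EFinP/measurable_funX/measurableT_comp => //.
by apply: measurable_det; exact: measurable_bary.
Qed.

Let dG0 z y : (0 <= (`|\det (bary z)| ^+ m)%:E * G z y)%E.
Proof. by apply: mule_ge0; rewrite ?lee_fin. Qed.

(** The substitution [z = u *m A + const_mx 1 *m a] contributes [|\det A|] once for each of the
    [n.+1] rows, and [\det (bary z) = \det (bary u) * \det A] contributes it [m] times more;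
    together they give the exponent [m + n.+1]. *)
Lemma ge0_integral_fiber M w :
  (\int[@lebesgue_mx R n.+1 n]_u
     ((`|\det (bary u)| ^+ m)%:E * G (flat_coords M w u) (foot_coords M w)) =
   ((Num.sqrt (\det (gram_dir M)))^-1 ^+ (m + n.+1))%:E * K (foot_coords M w))%E.
Proof.
have [A [a [AG uE]]] := flat_coordsE M w.
have uA : A \in unitmx.
  by have := gram_dir_unit M; rewrite -AG unitmx_mul => /andP[].
rewrite -(norm_det_gram AG); set y := foot_coords M w; set D := `|\det A|.
have D0 : D != 0 by rewrite normr_eq0 -unitfE -unitmxE.
pose h z := ((`|\det (bary z)| ^+ m)%:E * G z y)%E.
have mh : measurable_fun setT h.
  exact: (measurableT_comp mdG (pair2_measurable y)).
have h0 z : (0 <= h z)%E by exact: dG0.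
have mhs : measurable_fun setT (fun z : 'M[R]_(n.+1, n) => h (z + const_mx 1 *m a)).
  by apply: (measurableT_comp mh); exact: measurable_addmx.
have hE : (K y = (D ^+ n.+1)%:E *
    \int[@lebesgue_mx R n.+1 n]_u h (u *m A + const_mx 1 *m a)%R)%E.
  rewrite /K -(ge0_integral_shiftmx (const_mx 1 *m a) mh h0).
  by rewrite -(ge0_integral_mulmxr uA mhs).
rewrite exprD EFinM -muleA hE [X in (_ * X)%E]muleA -EFinM -exprMn mulVf // expr1n mul1e.
rewrite -ge0_integralZl //; last 2 first.
- apply: (measurableT_comp mh); apply: measurable_addmx => //.
  exact: measurable_mulmx.
- by rewrite lee_fin exprn_ge0 // invr_ge0 normr_ge0.
apply: eq_integral => u _; rewrite /h -uE muleA -EFinM; congr (_%:E * _)%E.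
rewrite uE det_bary_affine normrM -exprMn -/D; congr (_ ^+ _).
by rewrite mulrCA mulVf // mulr1.
Qed.

(** After the integration over the fibre, [w] only enters through the foot [w *m B]. The Jacobian of
    this last substitution is the inverse root of the determinant of [gram_perp M], which produces
    the second factor of [chart_weight]. *)
Lemma ge0_integral_disintegration :
  (\int[@lebesgue_mx R n m]_M \int[@lebesgue_mx R 1 m]_w \int[@lebesgue_mx R n.+1 n]_u
     ((`|\det (bary u)| ^+ m)%:E * G (flat_coords M w u) (foot_coords M w)) =
   grassmann_mass * \int[@lebesgue_mx R 1 m]_y \int[@lebesgue_mx R n.+1 n]_z
     ((`|\det (bary z)| ^+ m)%:E * G z y))%E.
Proof.
have mK : measurable_fun setT K.
  by apply: measurable_integral_l => //; exact: mdG.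
have K0 y : (0 <= K y)%E by apply: integral_ge0.
rewrite /grassmann_mass.
have mW : measurable_fun setT (fun M => (chart_weight M)%:E).
  by apply/measurable_EFinP; exact: measurable_chart_weight.
have W0 M : setT M -> (0 <= (chart_weight M)%:E)%E by rewrite lee_fin chart_weight_ge0.
have KT0 : (0 <= \int[@lebesgue_mx R 1 m]_y K y)%E by exact: integral_ge0.
rewrite -(ge0_integralZr _ measurableT mW W0 KT0).
apply: eq_integral => M _.
under eq_integral do rewrite ge0_integral_fiber.
have [B [BH etaB]] := foot_coordsE M.
have uB : B \in unitmx.
  by have := gram_perp_unit M; rewrite -unitmx_inv -BH unitmx_mul => /andP[].
under eq_integral do rewrite etaB.
have mKB : measurable_fun setT (fun w : 'rV[R]_m => K (w *m B)).
  by apply: (measurableT_comp mK); exact: measurable_mulmx.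
have c0 : (0 <= ((Num.sqrt (\det (gram_dir M)))^-1 ^+ (m + n.+1))%:E)%E.
  by rewrite lee_fin exprn_ge0 // invr_ge0.
rewrite (ge0_integralZl _ measurableT mKB (fun _ _ => K0 _) c0).
rewrite /chart_weight EFinM -muleA; congr (_ * _)%E.
rewrite -(ge0_integral_mulmxr uB mK K0) muleA -EFinM expr1.
have -> : \det (gram_perp M) = (\det B ^+ 2)^-1.
  by rewrite -[gram_perp M]invmxK -BH det_inv det_mulmx det_tr expr2.
rewrite sqrtrV ?sqr_ge0 // sqrtr_sqr mulVf ?mul1e //.
by rewrite normr_eq0 -unitfE -unitmxE.
Qed.

End disintegration.

(** * Inner products of rows and isometries *)

Section euclidean_rows.
Context (R : realType).
Implicit Types n : nat.

Lemma edotE n (u v : 'rV[R]_n) : edot u v = (u *m v^T) 0 0.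
Proof. by rewrite mxE; apply: eq_bigr => i _; rewrite mxE. Qed.

Lemma edotC n (u v : 'rV[R]_n) : edot u v = edot v u.
Proof. by apply: eq_bigr => i _; rewrite mulrC. Qed.

Lemma edotDl n (u v w : 'rV[R]_n) : edot (u + v) w = edot u w + edot v w.
Proof. by rewrite !edotE mulmxDl mxE. Qed.

Lemma edotZl n a (u v : 'rV[R]_n) : edot (a *: u) v = a * edot u v.
Proof. by rewrite !edotE -scalemxAl mxE. Qed.

Lemma edotNl n (u v : 'rV[R]_n) : edot (- u) v = - edot u v.
Proof. by rewrite -scaleN1r edotZl mulN1r. Qed.

Lemma edotDr n (u v w : 'rV[R]_n) : edot w (u + v) = edot w u + edot w v.
Proof. by rewrite edotC edotDl ![edot _ w]edotC. Qed.

Lemma edotZr n a (u v : 'rV[R]_n) : edot v (a *: u) = a * edot v u.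
Proof. by rewrite edotC edotZl edotC. Qed.

Lemma edotNr n (u v : 'rV[R]_n) : edot v (- u) = - edot v u.
Proof. by rewrite edotC edotNl edotC. Qed.

Lemma edot0l n (v : 'rV[R]_n) : edot 0 v = 0.
Proof. by rewrite -(scale0r 0) edotZl mul0r. Qed.

Lemma edot_mulmxl n p (u : 'rV[R]_n) (A : 'M[R]_(n, p)) (v : 'rV[R]_p) :
  edot (u *m A) v = edot u (v *m A^T).
Proof. by rewrite !edotE trmx_mul trmxK mulmxA. Qed.

Lemma edot_ge0 n (u : 'rV[R]_n) : 0 <= edot u u.
Proof. by apply: sumr_ge0 => i _; rewrite -expr2 sqr_ge0. Qed.

Lemma edot_eq0 n (u : 'rV[R]_n) : edot u u = 0 -> u = 0.
Proof.
move/eqP; rewrite psumr_eq0 => [/allP u0|i _]; last by rewrite -expr2 sqr_ge0.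
apply/rowP => i; have := u0 i; rewrite mem_index_enum => /(_ isT).
by rewrite -expr2 sqrf_eq0 mxE => /eqP.
Qed.

Lemma enorm_ge0 n (u : 'rV[R]_n) : 0 <= enorm u.
Proof. exact: sqrtr_ge0. Qed.

Lemma sqr_enorm n (u : 'rV[R]_n) : enorm u ^+ 2 = edot u u.
Proof. by rewrite sqr_sqrtr // edot_ge0. Qed.

Lemma enorm_edot n p (u : 'rV[R]_n) (v : 'rV[R]_p) :
  enorm u = enorm v -> edot u u = edot v v.
Proof. by move=> uv; rewrite -!sqr_enorm uv. Qed.

Lemma edot_sqrB n (u v : 'rV[R]_n) :
  edot (u - v) (u - v) = edot u u - edot u v *+ 2 + edot v v.
Proof.
rewrite edotDl !edotDr !edotNl !edotNr opprK [edot v u]edotC mulr2n.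
by rewrite opprD !addrA.
Qed.

Lemma edot_delta n (u : 'rV[R]_n) i : edot u (delta_mx 0 i) = u 0 i.
Proof.
rewrite /edot (bigD1 i) //= mxE !eqxx mulr1 big1 ?addr0 // => j ji.
by rewrite mxE (negbTE ji) andbF mulr0.
Qed.

(* A map preserving a quadratic form is affine: polarisation gives the inner
   products of the images, and then [g u - g 0] and its linear candidate are
   at distance zero. *)
Lemma quadratic_isometry_affine n p (Q : 'M[R]_n) (g : 'rV[R]_n -> 'rV[R]_p) :
  Q^T = Q ->
  (forall u v, edot (g u - g v) (g u - g v) = edot ((u - v) *m Q) (u - v)) ->
  exists A : 'M[R]_(n, p), A *m A^T = Q /\ forall u, g u = u *m A + g 0.
Proof.
move=> Qsym gQ; pose h u := g u - g 0.
have hh u : edot (h u) (h u) = edot (u *m Q) u by rewrite gQ subr0.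
have hpol u v : edot (h u) (h v) = edot (u *m Q) v.
  have huv : h u - h v = g u - g v by rewrite /h opprB addrA subrK.
  have vu : edot (v *m Q) u = edot (u *m Q) v by rewrite edot_mulmxl Qsym edotC.
  have := gQ u v; rewrite -huv edot_sqrB !hh mulmxBl.
  rewrite [in RHS]edotDl [in RHS]edotNl ![in RHS]edotDr ![in RHS]edotNr vu.
  move: (edot (h u) (h v)) (edot (u *m Q) v) => a b.
  by rewrite mulr2n; lra.
pose A : 'M[R]_(n, p) := \matrix_i h (delta_mx 0 i).
have AA : A *m A^T = Q.
  apply/matrixP => i j; rewrite -[RHS](_ : edot (delta_mx 0 i *m Q) (delta_mx 0 j) = _).
    rewrite -hpol edotE !mxE; apply: eq_bigr => k _.
    by rewrite !mxE.
  by rewrite edot_delta -rowE mxE.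
exists A; split=> // u.
suff : h u - u *m A = 0 by move/eqP; rewrite subr_eq0 /h subr_eq => /eqP.
(* In the expansion of [|h u - u *m A|^2] the two squares and the inner product all equal
   [edot (u *m Q) u], so everything cancels. *)
apply: edot_eq0; rewrite edot_sqrB hh [edot (u *m A) _]edot_mulmxl -mulmxA AA.
have -> : edot (h u) (u *m A) = edot (u *m Q) u.
  rewrite [edot (h u) _]edotC edot_mulmxl edotC /edot; apply: eq_bigr => i _.
  congr (_ * _); rewrite -[RHS]edot_delta -hpol edotE !mxE; apply: eq_bigr => k _.
  by rewrite !mxE.
by rewrite [edot u _]edotC mulr2n; lra.
Qed.

End euclidean_rows.

(** * Flats, closest points and graphs *)

Section flats.
Context (R : realType) (d : nat).
Implicit Types (E : set 'rV[R]_d) (x y z : 'rV[R]_d).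

Lemma flat_ofP l (q : 'rV[R]_d * 'M[R]_(l, d)) y :
  flat_of q y <-> exists c : 'rV[R]_l, y = q.1 + c *m q.2.
Proof.
split; first by move=> /submxP[c yc]; exists c; rewrite -yc addrC subrK.
by move=> [c ->]; rewrite /flat_of /= addrC addKr submxMl.
Qed.

Lemma oproj_id E x : E x -> oproj E x = x.
Proof.
move=> Ex; have Px : [set y | E y /\ forall z, E z -> edot (x - y) (z - y) = 0] x.
  by split => // z _; rewrite subrr edot0l.
have [_ /(_ x Ex) /edot_eq0 /eqP] := xgetI 0 Px.
by rewrite subr_eq0 => /eqP /esym.
Qed.

Lemma pythagoras_foot E y z : (forall z, E z -> edot y (z - y) = 0) -> E z ->
  edot z z = edot y y + edot (z - y) (z - y).
Proof.
move=> yE Ez; have /eqP := yE z Ez; rewrite edotDr edotNr subr_eq0 => /eqP yz.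
by rewrite edot_sqrB [edot z y]edotC yz; lra.
Qed.

Lemma closest_pointE E y : E y -> (forall z, E z -> edot y (z - y) = 0) ->
  closest_point E = y.
Proof.
move=> Ey yE; have Py : [set y | E y /\ forall z, E z -> enorm y <= enorm z] y.
  split => // z Ez; rewrite -ler_sqr ?nnegrE ?enorm_ge0 // !sqr_enorm.
  by rewrite (pythagoras_foot yE Ez) lerDl edot_ge0.
have [Ec cE] := xgetI 0 Py; have := pythagoras_foot yE Ec.
have := cE y Ey; rewrite -ler_sqr ?nnegrE ?enorm_ge0 // !sqr_enorm => h1 h2.
apply/eqP; rewrite -subr_eq0; apply/eqP/edot_eq0/eqP.
rewrite eq_le edot_ge0 andbT.
by move: h1; rewrite h2 gerDl.
Qed.

Lemma aff_rowsP p (X : 'M[R]_(p, d)) y :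
  aff (rows_of_mx X) y <->
  exists c : 'rV[R]_p, c *m (const_mx 1 : 'cV[R]_p) = 1%:M /\ y = c *m X.
Proof.
split=> [[c [c1 ->]]|[c [c1 ->]]].
  exists (\row_i c i); split.
    apply/matrixP => i j; rewrite !ord1 [LHS]mxE [RHS]mxE eqxx -[RHS]c1.
    by apply: eq_bigr => k _; rewrite !mxE mulr1.
  by rewrite mulmx_sum_row; apply: eq_bigr => i _; rewrite mxE tnth_mktuple.
exists (fun i => c 0 i); split.
  move/matrixP/(_ 0 0): c1; rewrite [LHS]mxE [RHS]mxE eqxx mulr1n => <-.
  by apply: eq_bigr => k _; rewrite !mxE mulr1.
by rewrite mulmx_sum_row; apply: eq_bigr => i _; rewrite tnth_mktuple.
Qed.

End flats.

Section chart_geometry.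
Context (R : realType) (n m : nat).
Implicit Types (M : 'M[R]_(n, m)) (w : 'rV[R]_m) (u : 'M[R]_(n.+1, n)).

(* In the orthonormal frame given by the rows of [P], a generic [n]-flat is the
   graph of the affine map [v |-> w + v *m M]. *)
Definition dir_basis M : 'M[R]_(n, n + m) := row_mx 1%:M M.
Definition perp_basis M : 'M[R]_(m, n + m) := row_mx (- M^T) 1%:M.
Definition base_point w : 'rV[R]_(n + m) := row_mx 0 w.
(** The orthogonal projection of [base_point w] on the row space of [perp_basis M]: its inner
    products with the rows of that basis are the entries of [w], and the inverse Gram matrix turns
    them into coefficients. *)
Definition foot M w : 'rV[R]_(n + m) := w *m invmx (gram_perp M) *m perp_basis M.

Lemma dir_basis_gram M : dir_basis M *m (dir_basis M)^T = gram_dir M.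
Proof. by rewrite tr_row_mx mul_row_col trmx1 mulmx1. Qed.

Lemma perp_basis_gram M : perp_basis M *m (perp_basis M)^T = gram_perp M.
Proof.
by rewrite tr_row_mx mul_row_col trmx1 mulmx1 linearN /= trmxK mulmxN mulNmx opprK addrC.
Qed.

Lemma perp_dir_basis M : perp_basis M *m (dir_basis M)^T = 0.
Proof. by rewrite tr_row_mx mul_row_col trmx1 mulmx1 mul1mx addNr. Qed.

Lemma dir_perp_basis M : dir_basis M *m (perp_basis M)^T = 0.
Proof. by rewrite -[dir_basis M]trmxK -trmx_mul perp_dir_basis trmx0. Qed.

Lemma gram_unit p q (K : 'M[R]_(p, q)) : 1%:M + K *m K^T \in unitmx.
Proof.
rewrite -row_free_unit; apply: inj_row_free => v vG0.
apply: edot_eq0; apply/eqP; rewrite eq_le edot_ge0 andbT.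
have : edot (v *m (1%:M + K *m K^T)) v = 0 by rewrite vG0 edot0l.
rewrite mulmxDr mulmx1 edotDl mulmxA edot_mulmxl trmxK.
by have := edot_ge0 (v *m K); lra.
Qed.

Lemma gram_dir_unit M : gram_dir M \in unitmx.
Proof. exact: gram_unit. Qed.

Lemma gram_perp_unit M : gram_perp M \in unitmx.
Proof. by have := gram_unit M^T; rewrite trmxK. Qed.

Lemma gram_dir_sym M : (gram_dir M)^T = gram_dir M.
Proof. by rewrite -dir_basis_gram trmx_mul trmxK. Qed.

Lemma gram_perp_sym M : (gram_perp M)^T = gram_perp M.
Proof. by rewrite -perp_basis_gram trmx_mul trmxK. Qed.

Lemma chart_pointsE u w M :
  row_mx u (bary u *m (col_mx w M : 'M[R]_(1 + n, m))) =
  const_mx 1 *m base_point w + u *m dir_basis M.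
Proof.
rewrite /bary (@mul_row_col R _ 1 n) /base_point /dir_basis !mul_mx_row add_row_mx.
by rewrite mulmx1 mulmx0 add0r.
Qed.

Variable P : 'M[R]_(n + m).
Hypothesis PPt : P *m P^T = 1%:M.

Let PtP : P^T *m P = 1%:M.
Proof. exact: mulmx1C. Qed.

Definition chart_flat M w := flat_of (base_point w *m P, dir_basis M *m P).
Definition chart_perp M := flat_of (0 : 'rV[R]_(n + m), perp_basis M *m P).

Lemma affG_chart_flat M w : affG R (n + m) n (chart_flat M w).
Proof.
exists (base_point w *m P, dir_basis M *m P); split => //=.
apply/row_freeP; exists (P^T *m col_mx 1%:M 0).
by rewrite -mulmxA (mulmxA P) PPt mul1mx mul_row_col mulmx1 mulmx0 addr0.
Qed.

Lemma affG_chart_perp M : affG R (n + m) m (chart_perp M).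
Proof.
exists (0, perp_basis M *m P); split => //=.
apply/row_freeP; exists (P^T *m col_mx 0 1%:M).
by rewrite -mulmxA (mulmxA P) PPt mul1mx mul_row_col mulmx1 mulmx0 add0r.
Qed.

Lemma edotP (u v : 'rV[R]_(n + m)) : edot (u *m P) (v *m P) = edot u v.
Proof. by rewrite edot_mulmxl -mulmxA PPt mulmx1. Qed.

Lemma aff_perp_chart_flat M w : aff_perp (chart_flat M w) = chart_perp M.
Proof.
apply/seteqP; split=> v.
  move=> vE; apply/flat_ofP => /=.
  pose v' := v *m P^T.
  have v'0 : v' *m (dir_basis M)^T = 0.
    (* The vector to be shown zero serves itself as test displacement: [v] is orthogonal to
       [c *m (dir_basis M *m P)], and this inner product is [|c|^2]. *)
    apply: edot_eq0; set c := _ *m _.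
    have Ey : chart_flat M w (base_point w *m P + c *m (dir_basis M *m P)).
      by apply/flat_ofP; exists c.
    have Ez : chart_flat M w (base_point w *m P).
      by apply/flat_ofP; exists 0; rewrite mul0mx addr0.
    have := vE _ _ Ey Ez; rewrite addrC addKr => <-.
    by rewrite [RHS]edotC [RHS]edot_mulmxl trmx_mul mulmxA.
  exists (rsubmx v'); rewrite add0r mulmxA.
  have -> : rsubmx v' *m perp_basis M = v'.
    rewrite -[RHS]hsubmxK mul_mx_row mulmx1 mulmxN; congr row_mx.
    apply/eqP; rewrite eq_sym -addr_eq0; apply/eqP; rewrite -[RHS]v'0.
    by rewrite -[in RHS](hsubmxK v') tr_row_mx mul_row_col trmx1 mulmx1.
  by rewrite /v' -mulmxA PtP mulmx1.
move=> /flat_ofP[c /= ->] y z /flat_ofP[a ->] /flat_ofP[b ->] /=.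
rewrite add0r opprD addrACA subrr add0r -mulmxBl !mulmxA edotP.
by rewrite edot_mulmxl -mulmxA dir_perp_basis mulmx0 edotC edot0l.
Qed.

Lemma base_point_foot M w :
  base_point w = foot M w + (w *m invmx (gram_perp M) *m M^T) *m dir_basis M.
Proof.
rewrite /foot /base_point !mul_mx_row add_row_mx mulmxN !mulmx1 addNr; congr row_mx.
rewrite -[X in X + _]mulmx1 -!mulmxA -mulmxDr -mulmxDr mulmxA -[RHS]mulmxA.
by rewrite mulVmx ?gram_perp_unit // mulmx1.
Qed.

Lemma chart_flat_foot M w y :
  chart_flat M w y <-> exists c : 'rV[R]_n, y = (foot M w + c *m dir_basis M) *m P.
Proof.
split=> [/flat_ofP[c ->]|[c ->]] /=.
  exists (w *m invmx (gram_perp M) *m M^T + c).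
  by rewrite [(_ + c) *m _]mulmxDl addrA -base_point_foot mulmxDl mulmxA.
apply/flat_ofP; exists (c - w *m invmx (gram_perp M) *m M^T) => /=.
rewrite mulmxA -mulmxDl (base_point_foot M w) mulmxBl; congr (_ *m P).
by rewrite addrACA subrr addr0.
Qed.

Lemma edot_foot_dir M w (c : 'rV[R]_n) : edot (foot M w) (c *m dir_basis M) = 0.
Proof.
by rewrite edotC edot_mulmxl /foot -mulmxA perp_dir_basis mulmx0 edotC edot0l.
Qed.

Lemma closest_point_chart_flat M w : closest_point (chart_flat M w) = foot M w *m P.
Proof.
apply: closest_pointE.
  by apply/chart_flat_foot; exists 0; rewrite mul0mx addr0.
move=> z /chart_flat_foot[c ->].
by rewrite -mulmxBl edotP addrC addKr edot_foot_dir.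
Qed.

Lemma chart_perp_foot M w : chart_perp M (foot M w *m P).
Proof.
by apply/flat_ofP; exists (w *m invmx (gram_perp M)); rewrite /= add0r mulmxA.
Qed.

Lemma closest_point_chart_perp M : closest_point (chart_perp M) = 0.
Proof.
apply: closest_pointE => [|z _]; last by rewrite edot0l.
by apply/flat_ofP; exists 0; rewrite /= mul0mx addr0.
Qed.

Lemma edot_foot M w w' : edot (foot M w - foot M w') (foot M w - foot M w') =
  edot ((w - w') *m invmx (gram_perp M)) (w - w').
Proof.
rewrite /foot -!mulmxBl [LHS]edot_mulmxl -[_ *m perp_basis M *m _]mulmxA perp_basis_gram.
by rewrite -[_ *m invmx _ *m gram_perp M]mulmxA mulVmx ?gram_perp_unit // mulmx1.
Qed.

Lemma chart_flatT u w M (i : 'I_n.+1) :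
  row i (row_mx u (bary u *m (col_mx w M : 'M[R]_(1 + n, m))) *m P) =
  base_point w *m P + row i u *m (dir_basis M *m P).
Proof.
rewrite chart_pointsE mulmxDl linearD /= -!mulmxA !row_mul; congr (_ + _).
by rewrite (_ : row i _ = 1%:M) ?mul1mx //; apply/matrixP => a b; rewrite !ord1 !mxE.
Qed.

Lemma aff_chart u w M : \det (bary u) != 0 ->
  aff (rows_of_mx (row_mx u (bary u *m (col_mx w M : 'M[R]_(1 + n, m))) *m P)) =
  chart_flat M w.
Proof.
move=> ub; rewrite chart_pointsE; apply/seteqP; split=> y.
  move=> /aff_rowsP[c [c1 ->]]; apply/flat_ofP => /=; exists (c *m u).
  by rewrite mulmxA mulmxDr mulmxA c1 mul1mx mulmxDl -!mulmxA.
move=> /flat_ofP[v /= ->]; apply/aff_rowsP.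
have uub : bary u \in unitmx by rewrite unitmxE unitfE.
(* The barycentric coordinates of [v] with respect to the rows of [u]: the column of ones in
   [bary u] encodes that the weights sum to one. *)
pose c : 'rV[R]_n.+1 := (row_mx (1%:M : 'M[R]_1) v : 'rV[R]_(1 + n)) *m invmx (bary u).
have : c *m bary u = (row_mx (1%:M : 'M[R]_1) v : 'rV[R]_(1 + n)) by rewrite mulmxKV.
rewrite /bary (@mul_mx_row R _ _ 1 n) => /(@eq_row_mx R 1 1 n _ _ _ _)[c1 cu].
exists c; split => //.
by rewrite [RHS]mulmxA [c *m (_ + _)]mulmxDr [RHS]mulmxDl !mulmxA c1 mul1mx cu.
Qed.

End chart_geometry.

(** * Measurable dependence on a flat *)

Section borel_grassmannian.
Context (R : realType) (d l : nat).

Lemma continuous_sumr (T : topologicalType) (I : Type) (r : seq I) (F : I -> T -> R) :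
  (forall i, continuous (F i)) -> continuous (fun x => \sum_(i <- r) F i x).
Proof. by move=> cF; apply: continuous_big => //; exact: add_continuous. Qed.

Lemma continuous_prodr (T : topologicalType) (I : Type) (r : seq I) (F : I -> T -> R) :
  (forall i, continuous (F i)) -> continuous (fun x => \prod_(i <- r) F i x).
Proof. by move=> cF; apply: continuous_big => //; exact: mul_continuous. Qed.

Lemma row_free_gram (B : 'M[R]_(l, d)) : row_free B = (\det (B *m B^T) != 0).
Proof.
rewrite -unitfE -unitmxE -row_free_unit; apply/idP/idP => h.
  apply: inj_row_free => v vB0.
  have vB : v *m B = 0.
    by apply: edot_eq0; rewrite edot_mulmxl -mulmxA vB0 edotC edot0l.
  by apply: (row_free_inj h); rewrite vB mul0mx.
apply: inj_row_free => v vB0; apply: (row_free_inj h).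
by rewrite mulmxA vB0 !mul0mx.
Qed.

(** Independence of the rows means that the Gram determinant, a continuous function of the entries,
    is nonzero. *)
Lemma open_row_free : open [set q : 'rV[R]_d * 'M[R]_(l, d) | row_free q.2].
Proof.
pose f (q : 'rV[R]_d * 'M[R]_(l, d)) := \det (q.2 *m q.2^T).
have cf : continuous f.
  apply: continuous_sumr => s q; apply: cvgM; first exact: cvg_cst.
  move: q; apply: continuous_prodr => i.
  rewrite (_ : (fun _ => _) = fun q : 'rV[R]_d * 'M[R]_(l, d) =>
      \sum_k q.2 i k * q.2 (s i) k); last first.
    by apply/funext => q; rewrite mxE; apply: eq_bigr => k _; rewrite mxE.
  have cc a b : continuous (fun q : 'rV[R]_d * 'M[R]_(l, d) => q.2 a b).
    move=> q; apply: (cvg_comp (fun q : 'rV[R]_d * 'M[R]_(l, d) => q.2) (fun B => B a b)).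
      exact: cvg_snd.
    exact: coord_continuous.
  by apply: continuous_sumr => k q; apply: cvgM; exact: cc.
rewrite (_ : [set _ | _] = f @^-1` [set x | x != 0]); last first.
  by apply/seteqP; split => q /=; rewrite row_free_gram.
by apply: open_comp => [q _|]; [exact: cf|exact: open_neq].
Qed.

Lemma measurable_affG : measurable (affG R d l : set (borel_affG R d l)).
Proof.
apply: sub_sigma_algebra; split => //.
rewrite (_ : [set _ | _] = [set q : 'rV[R]_d * 'M[R]_(l, d) | row_free q.2]).
  exact: open_row_free.
by apply/seteqP; split => [q []|q /= qB] //; split => //; exists q.
Qed.

(** Open sets of pairs become open sets of matrices, which are Borel by definition. This avoids
    comparing the Borel sets of the product space with the product sigma-algebra. *)
Lemma open_col_mx_preimage (O : set ('rV[R]_d * 'M[R]_(l, d))) : open O ->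
  open [set X : 'M[R]_(1 + l, d) | O (usubmx X, dsubmx X)].
Proof.
rewrite !openE => oO X /= /oO /nbhs_ballP[e /= e0 eO].
have : nbhs_ball X [set X : 'M[R]_(1 + l, d) | O (usubmx X, dsubmx X)]; last first.
  by rewrite nbhs_ballE.
exists e => //= Y [_ XY]; apply: eO; split.
  by split=> // i j; rewrite !mxE.
by split=> // i j; rewrite !mxE.
Qed.

Context d1 (T : measurableType d1).

Lemma measurable_flat (a : T -> 'rV[R]_d) (B : T -> 'M[R]_(l, d)) :
  measurable_fun setT a -> measurable_fun setT B -> (forall t, row_free (B t)) ->
  measurable_fun setT (fun t => flat_of (a t, B t) : borel_affG R d l).
Proof.
move=> ma mB freeB; apply: (@measurability _ _ T (borel_affG R d l) setT _ (open_affG R d l)) => //.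
move=> _ [U [_ oU] <-].
rewrite setTI.
have mU := open_measurable_mx (open_col_mx_preimage oU).
have mc : measurable_fun setT (fun t => col_mx (a t) (B t)) by exact: measurable_col_mx.
have := mc measurableT _ mU; rewrite setTI => mOU.
suff -> : (fun t => flat_of (a t, B t) : borel_affG R d l) @^-1` U =
  [set t | row_free (B t) /\ U (flat_of (a t, B t))].
  by move: mOU; congr measurable; apply/seteqP; split => t /=; rewrite col_mxKu col_mxKd.
by apply/seteqP; split => t /=; [split|case].
Qed.

(** The assumed measurability concerns the isometry after the orthogonal projection; at a point of
    the flat the projection does nothing. *)
Lemma measurable_isometry_family (J : set 'rV[R]_d -> 'rV[R]_d -> 'rV[R]_l)
    (a x : T -> 'rV[R]_d) (B : T -> 'M[R]_(l, d)) :
  isometry_family J ->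
  measurable_fun setT a -> measurable_fun setT B -> (forall t, row_free (B t)) ->
  measurable_fun setT x -> (forall t, flat_of (a t, B t) (x t)) ->
  measurable_fun setT (fun t => J (flat_of (a t, B t)) (x t)).
Proof.
move=> [_ _ mJ] ma mB freeB mx xE.
pose g t : 'rV[R]_d * borel_affG R d l := (x t, flat_of (a t, B t)).
have mg : measurable_fun setT g by apply: measurable_fun_pair => //; exact: measurable_flat.
rewrite (_ : (fun _ => _) = (fun q => J q.2 (oproj q.2 q.1)) \o g); last first.
  by apply/funext => t /=; rewrite oproj_id.
apply: (measurable_comp _ _ mJ mg).
  rewrite (_ : [set _ | _] = snd @^-1` (affG R d l : set (borel_affG R d l))) //.
  have msnd : measurable_fun setT
      (fun q : 'rV[R]_d * borel_affG R d l => q.2) by exact: measurable_snd.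
  by rewrite -[X in measurable X]setTI; exact: msnd measurableT _ measurable_affG.
by move=> _ [t _ <-] /=; exists (a t, B t); split => //=; exact: freeB.
Qed.

End borel_grassmannian.

(** * The isometries read in a chart *)

Section isometric_coordinates.
Context (R : realType) (n m : nat).
Variables (Ip : set 'rV[R]_(n + m) -> 'rV[R]_(n + m) -> 'rV[R]_n)
  (Iq : set 'rV[R]_(n + m) -> 'rV[R]_(n + m) -> 'rV[R]_m).
Hypotheses (Ip_iso : isometry_family Ip) (Iq_iso : isometry_family Iq).

Lemma isometry_family_edot l (J : set 'rV[R]_(n + m) -> 'rV[R]_(n + m) -> 'rV[R]_l)
    E x y : isometry_family J -> affG R (n + m) l E -> E x -> E y ->
  edot (J E x - J E y) (J E x - J E y) = edot (x - y) (x - y).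
Proof. by move=> [Jiso _ _] EG Ex Ey; apply: enorm_edot; exact: Jiso. Qed.

Section fixed_frame.
Variable P : 'M[R]_(n + m).
Hypothesis PPt : P *m P^T = 1%:M.

Let PtP : P^T *m P = 1%:M.
Proof. exact: mulmx1C. Qed.

Definition chart_point (M : 'M[R]_(n, m)) (w : 'rV[R]_m) (v : 'rV[R]_n) :=
  base_point n w *m P + v *m (dir_basis M *m P).

Definition flat_coords (M : 'M[R]_(n, m)) (w : 'rV[R]_m) (u : 'M[R]_(n.+1, n)) :
    'M[R]_(n.+1, n) :=
  \matrix_i Ip (chart_flat P M w) (chart_point M w (row i u)).

Definition foot_coords (M : 'M[R]_(n, m)) (w : 'rV[R]_m) : 'rV[R]_m :=
  Iq (chart_perp P M) (foot M w *m P).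

Lemma chart_flat_point M w v : chart_flat P M w (chart_point M w v).
Proof. by apply/flat_ofP; exists v. Qed.

Lemma chart_flat_footP M w : chart_flat P M w (foot M w *m P).
Proof. by apply/chart_flat_foot; exists 0; rewrite mul0mx addr0. Qed.

Lemma flat_coords_affine M w : exists (A : 'M[R]_n) (a : 'rV[R]_n),
  A *m A^T = gram_dir M /\ forall u, flat_coords M w u = u *m A + const_mx 1 *m a.
Proof.
pose g v := Ip (chart_flat P M w) (chart_point M w v).
have gQ v v' : edot (g v - g v') (g v - g v') = edot ((v - v') *m gram_dir M) (v - v').
  rewrite (isometry_family_edot Ip_iso (affG_chart_flat PPt M w)); try exact: chart_flat_point.
  rewrite /chart_point opprD addrACA subrr add0r -mulmxBl !mulmxA (edotP PPt).
  by rewrite edotC edot_mulmxl -mulmxA dir_basis_gram edotC.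
have [A [AG gA]] := quadratic_isometry_affine (gram_dir_sym M) gQ.
exists A, (g 0); split=> // u; apply/row_matrixP => i.
rewrite rowK -/(g (row i u)) gA linearD /= !row_mul; congr (_ + _).
by rewrite (_ : row i _ = 1%:M) ?mul1mx //; apply/matrixP => a b; rewrite !ord1 !mxE.
Qed.

(** All flats of direction [M] have the same orthogonal complement, so a single isometry is at work
    for all [w]. It has no constant term since the point of the complement closest to the origin is
    the origin itself. *)
Lemma foot_coords_linear M : exists B : 'M[R]_m,
  B *m B^T = invmx (gram_perp M) /\ forall w, foot_coords M w = w *m B.
Proof.
have Qsym : (invmx (gram_perp M))^T = invmx (gram_perp M).
  by rewrite trmx_inv gram_perp_sym.
have gQ w w' : edot (foot_coords M w - foot_coords M w') (foot_coords M w - foot_coords M w') =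
    edot ((w - w') *m invmx (gram_perp M)) (w - w').
  rewrite (isometry_family_edot Iq_iso (affG_chart_perp PPt M));
    try exact: chart_perp_foot.
  by rewrite -mulmxBl (edotP PPt) edot_foot.
have [B [BG gB]] := quadratic_isometry_affine Qsym gQ.
exists B; split=> // w; rewrite gB /foot_coords /foot !mul0mx.
have [_ I0 _] := Iq_iso; have := I0 _ (affG_chart_perp PPt M).
by rewrite (closest_point_chart_perp P) => ->; rewrite addr0.
Qed.

Lemma edot_foot_coords M w : edot (foot_coords M w) (foot_coords M w) = edot (foot M w) (foot M w).
Proof.
have [_ I0 _] := Iq_iso; have := I0 _ (affG_chart_perp PPt M).
rewrite (closest_point_chart_perp P) => I00.
have p0 : chart_perp P M 0 by apply/flat_ofP; exists 0; rewrite /= mul0mx addr0.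
have := isometry_family_edot Iq_iso (affG_chart_perp PPt M) (chart_perp_foot P M w) p0.
by rewrite I00 !subr0 (edotP PPt).
Qed.

(** Pythagoras at the foot; both isometries send the closest point of their flat to [0], so they
    preserve the two lengths involved. *)
Lemma edot_chart_point M w u i :
  edot (chart_point M w (row i u)) (chart_point M w (row i u)) =
  edot (row i (flat_coords M w u)) (row i (flat_coords M w u)) +
  edot (foot_coords M w) (foot_coords M w).
Proof.
have fE z : chart_flat P M w z -> edot (foot M w *m P) (z - foot M w *m P) = 0.
  move=> /chart_flat_foot[c ->].
  by rewrite -mulmxBl (edotP PPt) addrC addKr edot_foot_dir.
rewrite (pythagoras_foot fE (chart_flat_point M w (row i u))) (edotP PPt) -edot_foot_coords addrC.
congr (_ + _); rewrite rowK.
have := isometry_family_edot Ip_iso (affG_chart_flat PPt M w)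
  (chart_flat_point M w (row i u)) (chart_flat_footP M w).
have [_ I0 _] := Ip_iso; have := I0 _ (affG_chart_flat PPt M w).
by rewrite (closest_point_chart_flat PPt) => ->; rewrite subr0.
Qed.

(** The inverse of the chart: the first [n] coordinates in the frame [P], then the affine map
    recovered from the remaining ones by solving a linear system. The maps are total because [invmx]
    is; they have their meaning on [chart_domain] only. *)
Definition chart_u (X : 'M[R]_(n.+1, n + m)) : 'M[R]_(n.+1, n) := lsubmx (X *m P^T).
Definition chart_N (X : 'M[R]_(n.+1, n + m)) : 'M[R]_(1 + n, m) :=
  invmx (bary (chart_u X)) *m rsubmx (X *m P^T).
Definition chart_w X := usubmx (chart_N X).
Definition chart_M X := dsubmx (chart_N X).
Definition chart_Z X := flat_coords (chart_M X) (chart_w X) (chart_u X).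
Definition chart_Y X := foot_coords (chart_M X) (chart_w X).
Definition chart_domain : set 'M[R]_(n.+1, n + m) := ~` [set X | degenerate (chart_u X)].

Lemma measurable_chart_u : measurable_fun setT chart_u.
Proof. by apply: measurable_lsubmx; exact: measurable_mulmx. Qed.

Lemma measurable_chart_N : measurable_fun setT chart_N.
Proof.
apply: (@measurable_mulmx _ _ _ n.+1 n.+1 m (fun X => invmx (bary (chart_u X)))
  (fun X => rsubmx (X *m P^T))).
  by apply: measurable_invmx; apply: measurable_bary; exact: measurable_chart_u.
by apply: measurable_rsubmx; exact: measurable_mulmx.
Qed.

Lemma measurable_chart_M : measurable_fun setT chart_M.
Proof. by apply: measurable_dsubmx; exact: measurable_chart_N. Qed.

Lemma measurable_chart_w : measurable_fun setT chart_w.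
Proof. by apply: measurable_usubmx; exact: measurable_chart_N. Qed.

Lemma measurable_chart_domain : measurable chart_domain.
Proof.
apply: measurableC.
have := measurable_chart_u measurableT (@measurable_degenerate R n).
by rewrite setTI.
Qed.

Lemma row_free_dir_basis M : row_free (dir_basis M *m P).
Proof.
apply/row_freeP; exists (P^T *m col_mx 1%:M 0).
by rewrite -mulmxA (mulmxA P) PPt mul1mx mul_row_col mulmx1 mulmx0 addr0.
Qed.

Lemma row_free_perp_basis M : row_free (perp_basis M *m P).
Proof.
apply/row_freeP; exists (P^T *m col_mx 0 1%:M).
by rewrite -mulmxA (mulmxA P) PPt mul1mx mul_row_col mulmx1 mulmx0 add0r.
Qed.

Lemma measurable_dir_basis d (T : measurableType d) (f : T -> 'M[R]_(n, m)) :
  measurable_fun setT f -> measurable_fun setT (fun x => dir_basis (f x) *m P).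
Proof.
by move=> mf; apply: measurable_mulmx => //; exact: measurable_row_mx.
Qed.

Lemma measurable_perp_basis d (T : measurableType d) (f : T -> 'M[R]_(n, m)) :
  measurable_fun setT f -> measurable_fun setT (fun x => perp_basis (f x)).
Proof.
move=> mf; apply: measurable_row_mx => //; apply: measurable_oppmx.
exact: measurable_trmx.
Qed.

Lemma measurable_chart_Z : measurable_fun setT chart_Z.
Proof.
have mb : measurable_fun setT (fun X => base_point n (chart_w X) *m P).
  apply: measurable_mulmx => //; apply: measurable_row_mx => //.
  exact: measurable_chart_w.
have md := measurable_dir_basis measurable_chart_M.
apply: measurable_mxP => i j; under eq_fun do rewrite mxE.
apply: measurable_mx_coord; apply: measurable_isometry_family => //.
- by move=> X; exact: row_free_dir_basis.
- apply: measurable_addmx => //; apply: measurable_mulmx => //.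
  by apply: measurable_row; exact: measurable_chart_u.
- by move=> X; exact: chart_flat_point.
Qed.

Lemma measurable_chart_Y : measurable_fun setT chart_Y.
Proof.
have mp := measurable_perp_basis measurable_chart_M.
apply: measurable_isometry_family => //.
- exact: measurable_mulmx.
- by move=> X; exact: row_free_perp_basis.
- apply: measurable_mulmx => //; apply: measurable_mulmx => //.
  apply: measurable_mulmx; first exact: measurable_chart_w.
  apply: measurable_invmx; apply: measurable_addmx => //.
  apply: measurable_mulmx; last exact: measurable_chart_M.
  by apply: measurable_trmx; exact: measurable_chart_M.
- by move=> X; exact: chart_perp_foot.
Qed.

Lemma chart_decomposition X : chart_domain X ->
  X = row_mx (chart_u X) (bary (chart_u X) *m
        (col_mx (chart_w X) (chart_M X) : 'M[R]_(1 + n, m))) *m P.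
Proof.
move=> /eqP Xu; rewrite vsubmxK /chart_N mulmxA mulmxV ?unitmxE ?unitfE //.
by rewrite mul1mx hsubmxK -mulmxA PtP mulmx1.
Qed.

(* [T1] and [T2] for [k = n.+1] and [d = n + m]; here [m] stands for the index
   [(d - k).+1], which does not reduce to it. *)
Definition tuple_T1 (x : n.+1.-tuple 'rV[R]_(n + m)) : n.+1.-tuple 'rV[R]_n :=
  [tuple (Num.sqrt (dist0 (aff x) ^+ 2 - 1))^-1 *: Ip (aff x) (tnth x i) | i < n.+1].

Definition tuple_T2 (x : n.+1.-tuple 'rV[R]_(n + m)) : 'rV[R]_m :=
  Iq (aff_perp (aff x)) (closest_point (aff x)).

Section in_chart.
Variable X : 'M[R]_(n.+1, n + m).
Hypothesis XP : chart_domain X.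

Lemma aff_chart_domain : aff (rows_of_mx X) = chart_flat P (chart_M X) (chart_w X).
Proof. by rewrite [in LHS](chart_decomposition XP) aff_chart //; exact/eqP. Qed.

Lemma row_chart_domain i :
  row i X = chart_point (chart_M X) (chart_w X) (row i (chart_u X)).
Proof. by rewrite [in LHS](chart_decomposition XP) chart_flatT. Qed.

Lemma tuple_T2_chart : tuple_T2 (rows_of_mx X) = chart_Y X.
Proof.
rewrite /tuple_T2 aff_chart_domain (aff_perp_chart_flat PPt).
by rewrite (closest_point_chart_flat PPt).
Qed.

Lemma sqr_dist0_chart : dist0 (aff (rows_of_mx X)) ^+ 2 = edot (chart_Y X) (chart_Y X).
Proof.
by rewrite /dist0 aff_chart_domain (closest_point_chart_flat PPt) sqr_enorm (edotP PPt)
  edot_foot_coords.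
Qed.

Lemma tuple_T1_chart : tuple_T1 (rows_of_mx X) =
  rows_of_mx ((Num.sqrt (edot (chart_Y X) (chart_Y X) - 1))^-1 *: chart_Z X).
Proof.
apply: eq_from_tnth => i; rewrite !tnth_mktuple sqr_dist0_chart aff_chart_domain.
by rewrite linearZ /= rowK row_chart_domain.
Qed.

Lemma edot_row_chart i : edot (row i X) (row i X) =
  edot (row i (chart_Z X)) (row i (chart_Z X)) + edot (chart_Y X) (chart_Y X).
Proof. by rewrite row_chart_domain edot_chart_point. Qed.

(** In a chart the dimension is automatically right, and a flat misses the ball exactly when its
    closest point does. *)
Lemma Skd_chart : Skd R (n + m) n.+1 (rows_of_mx X) <-> 1 < edot (chart_Y X) (chart_Y X).
Proof.
rewrite edot_foot_coords; set f := foot _ _; rewrite /Skd /= aff_chart_domain.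
have fE z : chart_flat P (chart_M X) (chart_w X) z -> edot (f *m P) (z - f *m P) = 0.
  move=> /chart_flat_foot[c ->].
  by rewrite -mulmxBl (edotP PPt) addrC addKr edot_foot_dir.
have ball z : closed_unit_ball R (n + m) z <-> edot z z <= 1.
  by rewrite -sqr_enorm -[X in _ <= X](expr1n _ 2) ler_sqr ?nnegrE ?enorm_ge0.
split=> [[E0 _]|f1]; last first.
  split; last exact: affG_chart_flat.
  rewrite -subset0 => z [Ez /ball z1]; have := pythagoras_foot fE Ez.
  by rewrite (edotP PPt); have := edot_ge0 (z - f *m P); lra.
rewrite ltNge; apply/negP => f1.
suff : (chart_flat P (chart_M X) (chart_w X) `&` closed_unit_ball R (n + m)) (f *m P).
  by rewrite E0.
by split; [exact: chart_flat_footP|apply/ball; rewrite (edotP PPt)].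
Qed.

End in_chart.

End fixed_frame.

End isometric_coordinates.

(** * Charts with permuted coordinates cover all configurations *)

Section chart_cover.
Context (R : realType).

Lemma injection_extends_perm n m (f : 'I_n -> 'I_(n + m)) : injective f ->
  exists s : 'S_(n + m), forall j, s (lshift m j) = f j.
Proof.
(* The values of [f], in order, followed by all other indices: an enumeration without repetition,
   read as a permutation. *)
move=> f_inj; pose s := codom f ++ [seq x <- enum 'I_(n + m) | x \notin codom f].
have us : uniq s.
  rewrite cat_uniq (map_inj_uniq f_inj) enum_uniq filter_uniq ?enum_uniq // andbT.
  by apply/hasPn => x; rewrite mem_filter => /andP[].
have szs : size s = (n + m)%N.
  have /card_uniqP <- := us; rewrite -[RHS]card_ord; apply: eq_card => x.
  by rewrite mem_cat mem_filter mem_enum andbT orbN.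
have g_inj : injective (fun i : 'I_(n + m) => nth i s i).
  move=> i j /eqP; rewrite (set_nth_default i j) ?szs // nth_uniq ?szs //.
  by move/eqP/val_inj.
exists (perm g_inj) => j; rewrite permE nth_cat size_codom card_ord /= ltn_ord.
rewrite (nth_map j) ?size_enum_ord //; congr f; apply: val_inj => /=.
by rewrite nth_enum_ord.
Qed.

Context (n m : nat).

Definition edge_mx (X : 'M[R]_(1 + n, n + m)) : 'M[R]_(n, n + m) :=
  dsubmx X - const_mx 1 *m usubmx X.

(** Two points of the affine hull differ by a combination of the vertices with coefficients of sum
    zero, hence by a combination of the edges. So the edges span the direction space, whose
    dimension is [n]. *)
Lemma row_free_edge_mx (X : 'M[R]_(n.+1, n + m)) :
  affG R (n + m) n (aff (rows_of_mx X)) -> row_free (edge_mx X).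
Proof.
move=> [[a B] /= [freeB affE]].
have aE v : exists2 c : 'rV[R]_n.+1,
    c *m (const_mx 1 : 'cV[R]_n.+1) = 1%:M & a + v *m B = c *m X.
  have : aff (rows_of_mx X) (a + v *m B) by rewrite affE; apply/flat_ofP; exists v.
  by move=> /aff_rowsP[c [c1 cX]]; exists c.
have BX : (B <= edge_mx X)%MS.
  apply/row_subP => i; rewrite rowE.
  have [c c1 cX] := aE (delta_mx 0 i); have [c' c'1] := aE 0.
  rewrite mul0mx addr0 => c'X.
  pose e : 'rV[R]_(1 + n) := c - c'.
  (* The coefficients sum to zero, so that of the first vertex is minus the sum of the others, and
     [e *m X] is [rsubmx e *m edge_mx X]. *)
  have e0 : lsubmx e = - (rsubmx e *m const_mx 1).
    have : e *m (const_mx 1 : 'cV[R]_(1 + n)) = 0 by rewrite mulmxBl c1 c'1 subrr.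
    rewrite -[e in e *m _]hsubmxK -[const_mx 1]vsubmxK mul_row_col.
    move/eqP; rewrite addr_eq0 => /eqP; rewrite (_ : usubmx _ = 1%:M).
      rewrite mulmx1 => ->; congr (- (_ *m _)).
      by apply/matrixP => k l; rewrite !mxE.
    by apply/matrixP => k l; rewrite !ord1 !mxE.
  have -> : delta_mx 0 i *m B = e *m (X : 'M[R]_(1 + n, n + m)).
    by rewrite mulmxBl -cX -c'X addrC addKr.
  apply/submxP; exists (rsubmx e).
  rewrite -{1}[e]hsubmxK -{1}[X](@vsubmxK _ 1 n) mul_row_col e0 mulNmx /edge_mx mulmxBr.
  by rewrite mulmxA addrC.
by rewrite /row_free eqn_leq rank_leq_row -{1}(eqP freeB) mxrankS.
Qed.

(** The edge matrix has rank [n], hence [n] independent columns; a permutation moves them to the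
    front, where they form the edge matrix of the projected simplex. *)
Lemma chart_domain_cover (X : 'M[R]_(n.+1, n + m)) : Skd R (n + m) n.+1 (rows_of_mx X) ->
  exists s : 'S_(n + m), chart_domain (perm_mx s) X.
Proof.
move=> [_ /row_free_edge_mx]; set D := edge_mx X => freeD.
have fullD : row_full D^T by rewrite /row_full mxrank_tr.
have [s sE] := injection_extends_perm (@fullrankfun_inj _ _ _ _ fullD).
exists s; rewrite /chart_domain /degenerate /= /chart_u tr_perm_mx -col_permE.
have -> : lsubmx (col_perm s X) =
    col_mx (lsubmx (col_perm s (usubmx (X : 'M[R]_(1 + n, n + m)))))
           (lsubmx (col_perm s (dsubmx (X : 'M[R]_(1 + n, n + m))))).
  rewrite -{1}[X](@vsubmxK _ 1 n).
  by apply/matrixP => i j; rewrite !mxE; case: splitP => k _; rewrite !mxE.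
rewrite det_bary; apply/eqP; rewrite -unitfE -unitmxE.
have := fullrowsub_unit fullD; rewrite -unitmx_tr; congr (_ \in unitmx).
apply/matrixP => i j; rewrite !mxE -sE; congr (_ - _).
by apply: eq_bigr => k _; rewrite !mxE.
Qed.

End chart_cover.

(** * The Blaschke-Petkantschin formula *)

Section blaschke_petkantschin.
Context (R : realType) (n m : nat).
Variables (Ip : set 'rV[R]_(n + m) -> 'rV[R]_(n + m) -> 'rV[R]_n)
  (Iq : set 'rV[R]_(n + m) -> 'rV[R]_(n + m) -> 'rV[R]_m).
Hypotheses (Ip_iso : isometry_family Ip) (Iq_iso : isometry_family Iq).

Let perm_orthogonal (s : 'S_(n + m)) : perm_mx s *m (perm_mx s)^T = 1%:M :> 'M[R]_(n + m).
Proof. by rewrite tr_perm_mx -perm_mxM mulgV perm_mx1. Qed.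

Lemma id_orthogonal : (1%:M : 'M[R]_(n + m)) *m 1%:M^T = 1%:M.
Proof. by rewrite trmx1 mulmx1. Qed.

(** In each chart the conditions are expressed by measurable functions, and the set is the union
    over the finitely many permuted charts. A single chart would only describe it up to a null
    set. *)
Lemma measurable_Skd_T12 (C : set (n.+1.-tuple 'rV[R]_n * 'rV[R]_m)) : measurable C ->
  measurable [set X : 'M[R]_(n.+1, n + m) | Skd R (n + m) n.+1 (rows_of_mx X) /\
    C (tuple_T1 Ip (rows_of_mx X), tuple_T2 Iq (rows_of_mx X))].
Proof.
move=> mC; pose Z s := chart_Z Ip (perm_mx s : 'M[R]_(n + m)).
pose Y s := chart_Y Iq (n := n) (perm_mx s : 'M[R]_(n + m)).
pose c s X := edot (Y s X) (Y s X).
have mZ s : measurable_fun setT (Z s) by exact: measurable_chart_Z.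
have mY s : measurable_fun setT (Y s) by exact: measurable_chart_Y.
have mc s : measurable_fun setT (c s).
  apply: measurable_sum => i; apply: measurable_funM; exact: measurable_mx_coord.
pose T s X := (rows_of_mx ((Num.sqrt (c s X - 1))^-1 *: Z s X), Y s X).
have mT s : measurable_fun setT (T s).
  apply: measurable_fun_pair => //.
  apply: (measurableT_comp (@measurable_rows_of_mx R n.+1 n)).
  apply: measurable_scalemx => //; apply: measurable_invr; apply: measurable_sqrtr.
  exact: measurable_funB.
rewrite (_ : [set _ | _] = \bigcup_(s in [set: 'S_(n + m)])
  (chart_domain (perm_mx s : 'M[R]_(n + m)) `&` (c s @^-1` `]1, +oo[%classic `&` T s @^-1` C))).
  apply: fin_bigcup_measurable; first exact: finite_finset.
  move=> s _.
  apply: measurableI; first exact: measurable_chart_domain.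
  apply: measurableI; rewrite -[X in measurable X]setTI; last exact: mT.
  by apply: mc => //; exact: measurable_itv.
apply/seteqP; split => X.
  move=> [XS XC]; have [s sX] := chart_domain_cover XS; exists s => //.
  split=> //; split.
    by rewrite /= in_itv /= andbT; apply/(Skd_chart Iq_iso (perm_orthogonal s) sX).
  rewrite /T /= /c /Y /Z -(tuple_T1_chart Ip Iq_iso (perm_orthogonal s) sX).
  by rewrite -(tuple_T2_chart Iq (perm_orthogonal s) sX).
move=> [s _ [sX [/= Xc XC]]]; split.
  apply/(Skd_chart Iq_iso (perm_orthogonal s) sX).
  by move: Xc; rewrite in_itv /= andbT.
rewrite (tuple_T1_chart Ip Iq_iso (perm_orthogonal s) sX).
by rewrite (tuple_T2_chart Iq (perm_orthogonal s) sX).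
Qed.

Local Notation chart1 := (chart_domain (1%:M : 'M[R]_(n + m))).
Local Notation Z1 := (chart_Z Ip (1%:M : 'M[R]_(n + m))).
Local Notation Y1 := (chart_Y Iq (n := n) (1%:M : 'M[R]_(n + m))).

Lemma chart_u1 u (V : 'M[R]_(n.+1, m)) : chart_u 1%:M (row_mx u V) = u.
Proof. by rewrite /chart_u trmx1 mulmx1 row_mxKl. Qed.

Lemma chart_N1 u (N : 'M[R]_(1 + n, m)) : ~ degenerate u ->
  chart_N 1%:M (row_mx u (bary u *m N)) = N.
Proof.
move=> /eqP ub; rewrite /chart_N chart_u1 trmx1 mulmx1 row_mxKr mulmxA.
by rewrite mulVmx ?mul1mx // unitmxE unitfE.
Qed.

(** Membership only depends on the first [n] columns, so for each choice of the other columns the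
    section is the null set of degenerate simplices. *)
Lemma lebesgue_chart_domainC : @lebesgue_mx R n.+1 (n + m) (~` chart1) = 0%E.
Proof.
have mC : measurable (~` chart1) by apply: measurableC; exact: measurable_chart_domain.
transitivity (\int[@lebesgue_mx R n.+1 (n + m)]_X (\1_(~` chart1) X)%:E)%E.
  by rewrite integral_indic // setIT.
have mf : measurable_fun setT (fun X => (\1_(~` chart1) X)%:E : \bar R).
  by apply/measurable_EFinP; exact: measurable_indic.
have f0 X : (0 <= (\1_(~` chart1) X)%:E :> \bar R)%E by rewrite lee_fin indicE ler0n.
rewrite (ge0_integral_row_mx mf f0).
have mfr : measurable_fun setT (fun z : 'M[R]_(n.+1, n) * 'M[R]_(n.+1, m) =>
    (\1_(~` chart1) (row_mx z.1 z.2))%:E : \bar R).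
  by apply: (measurableT_comp mf); exact: measurable_row_mx.
transitivity (\int[@lebesgue_mx R n.+1 m]_V \int[@lebesgue_mx R n.+1 n]_u
    (\1_(~` chart1) (row_mx u V))%:E)%E.
  exact: (ge0_integral_swap _ _ mfr (fun _ _ => f0 _)).
apply: integral0_eq => V _.
transitivity (\int[@lebesgue_mx R n.+1 n]_u (\1_(@degenerate R n) u)%:E)%E.
  apply: eq_integral => u _; rewrite !indicE /chart_domain setCK; congr (_%:R%:E).
  by congr nat_of_bool; apply/idP/idP; rewrite !inE /= chart_u1.
have mdeg := @measurable_degenerate R n.
by rewrite integral_indic // setIT; exact: lebesgue_degenerate.
Qed.

Lemma ge0_blaschke_petkantschin (G : 'M[R]_(n.+1, n) -> 'rV[R]_m -> \bar R) :
  (0 < m)%N ->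
  measurable_fun setT (fun z : 'M[R]_(n.+1, n) * 'rV[R]_m => G z.1 z.2) ->
  (forall z y, 0 <= G z y)%E ->
  (\int[@lebesgue_mx R n.+1 (n + m)]_X ((\1_chart1 X)%:E * G (Z1 X) (Y1 X)) =
   grassmann_mass R n m * \int[@lebesgue_mx R 1 m]_y \int[@lebesgue_mx R n.+1 n]_z
     ((`|\det (bary z)| ^+ m)%:E * G z y))%E.
Proof.
move=> m0 mG G0.
pose F X := ((\1_chart1 X)%:E * G (Z1 X) (Y1 X))%E.
have F0 X : (0 <= F X)%E by apply: mule_ge0 => //; rewrite lee_fin indicE ler0n.
have mF : measurable_fun setT F.
  apply: emeasurable_funM.
    by apply/measurable_EFinP; apply: measurable_indic; exact: measurable_chart_domain.
  apply: (measurableT_comp mG (f := fun z => G z.1 z.2) (g := fun X => (Z1 X, Y1 X))).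
  by apply: measurable_fun_pair; [exact: (measurable_chart_Z Ip_iso id_orthogonal)|
    exact: (measurable_chart_Y Iq_iso id_orthogonal)].
rewrite -(ge0_integral_disintegration (flat_coords_affine Ip_iso id_orthogonal)
  (foot_coords_linear Iq_iso id_orthogonal) (@gram_dir_unit R n m) (@gram_perp_unit R n m) mG G0).
rewrite (ge0_integral_chart mF F0).
pose H (N : 'M[R]_(1 + n, m)) (u : 'M[R]_(n.+1, n)) :=
  ((`|\det (bary u)| ^+ m)%:E * F (row_mx u (bary u *m N)))%E.
have H0 N u : (0 <= H N u)%E by apply: mule_ge0; rewrite ?lee_fin.
have mH : measurable_fun setT (fun z : 'M[R]_(1 + n, m) * 'M[R]_(n.+1, n) => H z.1 z.2).
  have mb : measurable_fun setT (fun z : 'M[R]_(1 + n, m) * 'M[R]_(n.+1, n) => bary z.2).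
    exact: measurable_bary.
  apply: emeasurable_funM.
    apply/measurable_EFinP/measurable_funX/measurableT_comp => //.
    exact: measurable_det.
  apply: (measurableT_comp mF); apply: measurable_row_mx => //.
  exact: (@measurable_mulmx _ _ _ n.+1 n.+1 m _ _ mb measurable_fst).
have mHH : measurable_fun setT (fun N => \int[@lebesgue_mx R n.+1 n]_u H N u)%E.
  by apply: measurable_integral_r => //; exact: mH.
rewrite [LHS](@ge0_integral_col_mx R 1 n m _ mHH); last by move=> N; exact: integral_ge0.
have mHw : measurable_fun setT (fun z : 'rV[R]_m * 'M[R]_(n, m) =>
    \int[@lebesgue_mx R n.+1 n]_u H (col_mx z.1 z.2) u)%E.
  apply: (measurableT_comp mHH); exact: measurable_col_mx.
(* The first row of [N] is the base point [w] of the graph and the other rows form its slope [M];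
   the direction is moved outermost. *)
transitivity (\int[@lebesgue_mx R n m]_M \int[@lebesgue_mx R 1 m]_w
    \int[@lebesgue_mx R n.+1 n]_u H (col_mx w M) u)%E.
  by apply: (ge0_integral_swap _ _ mHw) => w M; exact: integral_ge0.
apply: eq_integral => M _; apply: eq_integral => w _; apply: eq_integral => u _.
(* For degenerate [u] the chart cannot be inverted, but both sides carry the factor [0 ^+ m], which
   vanishes as [m] is positive. *)
rewrite /H /F; have [ub|ub] := pselect (degenerate u).
  by rewrite ub normr0 expr0n (gtn_eqF m0) !mul0e.
congr (_ * _)%E; rewrite indicE mem_set ?mul1e; last by rewrite /chart_domain /= chart_u1.
rewrite /chart_Z /chart_Y /chart_M /chart_w chart_N1 // chart_u1.
by rewrite col_mxKu col_mxKd.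
Qed.

End blaschke_petkantschin.

(** * The normalising constant of the beta' density *)

Section gaussian_integrals.
Context (R : realType).
Local Notation mu := (@lebesgue_measure R).

Lemma measurable_edot d (T : measurableType d) n (f g : T -> 'rV[R]_n) :
  measurable_fun setT f -> measurable_fun setT g ->
  measurable_fun setT (fun x => edot (f x) (g x)).
Proof.
move=> mf mg; apply: measurable_sum => i.
by apply: measurable_funM; exact: measurable_mx_coord.
Qed.

Lemma measurable_powRl d (T : measurableType d) (f : T -> R) p :
  measurable_fun setT f -> measurable_fun setT (fun x => f x `^ p).
Proof. by move=> mf; exact: (measurableT_comp (measurable_powR p) mf). Qed.

Lemma measurable_expRcomp d (T : measurableType d) (f : T -> R) :
  measurable_fun setT f -> measurable_fun setT (fun x => expR (f x)).
Proof. by move=> mf; exact: (measurableT_comp (@measurable_expR R) mf). Qed.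

Lemma integral_gauss_scale (t : R) : 0 < t ->
  (\int[mu]_x (expR (- (t * x ^+ 2)))%:E = (Num.sqrt (pi / t))%:E)%E.
Proof.
move=> t0; have s0 : 0 < Num.sqrt t by rewrite sqrtr_gt0.
have mg : measurable_fun setT (fun x : R => (gauss_fun x)%:E).
  by apply/measurable_EFinP; exact: measurable_gauss_fun.
have g0 x : (0 <= (gauss_fun x : R)%:E)%E by rewrite lee_fin gauss_fun_ge0.
have := ge0_integral_lebesgue_scale (lt0r_neq0 s0) mg g0.
rewrite integralT_gauss gtr0_norm // => E.
have -> : (\int[mu]_x (expR (- (t * x ^+ 2)))%:E =
    \int[mu]_x (gauss_fun (Num.sqrt t * x))%:E)%E.
  by apply: eq_integral => x _; rewrite /gauss_fun exprMn sqr_sqrtr // ltW.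
rewrite sqrtrM ?pi_ge0 // sqrtrV ?ltW // EFinM -E muleAC -EFinM divff ?mul1e //.
exact: lt0r_neq0.
Qed.

Lemma edot_row_mx p q (x x' : 'rV[R]_p) (y y' : 'rV[R]_q) :
  edot (row_mx x y) (row_mx x' y') = edot x x' + edot y y'.
Proof. by rewrite !edotE tr_row_mx mul_row_col mxE. Qed.

Lemma lebesgue_mx_setT0 p : @lebesgue_mx R p 0 setT = 1%E.
Proof.
rewrite (_ : setT = mx_box (fun _ _ => setT : set R)); last first.
  by apply/seteqP; split.
by rewrite lebesgue_mx_box // big1 // => i _; rewrite big_ord0.
Qed.

Lemma integral_gauss_rV n (t : R) : 0 < t ->
  (\int[@lebesgue_mx R 1 n]_x (expR (- (t * edot x x)))%:E =
   (Num.sqrt (pi / t) ^+ n)%:E)%E.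
Proof.
move=> t0; elim: n => [|n IHn].
  transitivity (\int[@lebesgue_mx R 1 0]_x (cst 1%E) x)%E.
    by apply: eq_integral => x _; rewrite /edot big_ord0 mulr0 oppr0 expR0.
  by rewrite integral_cst // mul1e expr0; exact: lebesgue_mx_setT0.
pose f k (x : 'rV[R]_k) := (expR (- (t * edot x x)))%:E.
have mf k : measurable_fun setT (f k).
  apply/measurable_EFinP/measurable_expRcomp/measurable_funN/measurable_funM => //.
  exact: measurable_edot.
have f0 k x : (0 <= f k x)%E by rewrite lee_fin expR_ge0.
transitivity (\int[@lebesgue_mx R 1 1]_x \int[@lebesgue_mx R 1 n]_y (f 1%N x * f n y))%E.
  rewrite (@ge0_integral_row_mx R 1 1 n _ (mf n.+1) (f0 n.+1)).
  apply: eq_integral => x _; apply: eq_integral => y _.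
  by rewrite /f (@edot_row_mx 1 n) mulrDr opprD expRD.
transitivity (\int[@lebesgue_mx R 1 1]_x (f 1%N x * (Num.sqrt (pi / t) ^+ n)%:E))%E.
  by apply: eq_integral => x _; rewrite -IHn (ge0_integralZl _ measurableT (mf n)).
rewrite (ge0_integralZr _ measurableT (mf 1%N)) ?lee_fin ?exprn_ge0 //.
rewrite (ge0_integral_mx11 (mf 1%N) (f0 1%N)) exprS EFinM -(integral_gauss_scale t0).
congr (_ * _)%E; apply: eq_integral => x _.
by rewrite /f /edot big_ord1 !mxE eqxx mulr1n expr2.
Qed.

End gaussian_integrals.

(** * Gamma integrals and the normalisation of beta' densities *)

Section gamma_identity.
Context (R : realType).
Local Notation mu := (@lebesgue_measure R).

(** Extended by zero to the whole line, so that the scaling formula for integrals over the line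
    applies directly; the rate [a] will be [1 + |x|^2]. *)
Definition gamma_kernel (s a t : R) : R :=
  \1_(`]0, +oo[%classic : set R) t * (t `^ (s - 1) * expR (- (a * t))).

(** Extended-valued, so that the identities hold before convergence is known, and can be used to
    prove it. *)
Definition gamma_integral (s : R) : \bar R := (\int[mu]_t (gamma_kernel s 1 t)%:E)%E.

Lemma gamma_kernel_ge0 s a t : 0 <= gamma_kernel s a t.
Proof. by rewrite /gamma_kernel indicE mulr_ge0 ?ler0n // mulr_ge0 ?powR_ge0 ?expR_ge0. Qed.

Lemma gamma_kernelE s a t : 0 < t ->
  gamma_kernel s a t = t `^ (s - 1) * expR (- (a * t)).
Proof. by move=> t0; rewrite /gamma_kernel indicE mem_set ?mul1r //= in_itv /= t0. Qed.

Lemma gamma_kernel_le0 s a t : t <= 0 -> gamma_kernel s a t = 0.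
Proof.
move=> t0; rewrite /gamma_kernel indicE memNset ?mul0r //= in_itv /= andbT.
by apply/negP; rewrite -leNgt.
Qed.

Lemma measurable_gamma_kernel d (T : measurableType d) s (a t : T -> R) :
  measurable_fun setT a -> measurable_fun setT t ->
  measurable_fun setT (fun x => gamma_kernel s (a x) (t x)).
Proof.
move=> ma mt; apply: measurable_funM.
  have m1 : measurable_fun setT (fun t : R => \1_(`]0, +oo[%classic : set R) t : R).
    by apply: measurable_indic; exact: measurable_itv.
  exact: measurableT_comp m1 mt.
apply: measurable_funM; first exact: measurable_powRl.
by apply: measurable_expRcomp; apply: measurable_funN; exact: measurable_funM.
Qed.

Lemma GammaE s : Gamma s = fine (gamma_integral s).
Proof.
rewrite /Gamma /Rintegral /gamma_integral integral_mkcond; congr fine.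
apply: eq_integral => t _; rewrite /gamma_kernel /patch indicE mul1r.
by case: ifPn => _; rewrite ?mul1r ?mul0r.
Qed.

Lemma gamma_integral_scale s a : 0 < a ->
  (\int[mu]_t (gamma_kernel s a t)%:E = (a `^ (- s))%:E * gamma_integral s)%E.
Proof.
move=> a0.
have mk : measurable_fun setT (fun t : R => (gamma_kernel s 1 t)%:E).
  by apply/measurable_EFinP; exact: measurable_gamma_kernel.
have k0 (t : R) : (0 <= (gamma_kernel s 1 t)%:E)%E by rewrite lee_fin gamma_kernel_ge0.
have mka : measurable_fun setT (fun t : R => (gamma_kernel s 1 (a * t))%:E).
  by apply/measurable_EFinP; apply: measurable_gamma_kernel => //; exact: measurable_funM.
rewrite /gamma_integral -(ge0_integral_lebesgue_scale (lt0r_neq0 a0) mk k0).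
rewrite gtr0_norm // muleA -EFinM -ge0_integralZl //; last first.
  by rewrite lee_fin mulr_ge0 ?powR_ge0 // ltW.
apply: eq_integral => t _; rewrite -EFinM; congr (_%:E).
have [t0|t0] := ltP 0 t; last first.
  by rewrite !gamma_kernel_le0 ?mulr0 // pmulr_rle0.
rewrite !gamma_kernelE ?mulr_gt0 // powRM ?ltW // mul1r !mulrA; congr (_ * _).
rewrite -[LHS]mul1r; congr (_ * _).
rewrite -mulrA [a * _]mulrC -[in X in _ * (_ * X)](powRr1 (ltW a0)).
rewrite -!powRD ?(lt0r_neq0 a0) ?implybT //.
by rewrite subrK addNr powRr0.
Qed.

(* Integrate the Gaussian mixture
   [Gamma s * (1 + |x|^2)^(- s) = \int t^(s - 1) exp (- t (1 + |x|^2)) dt] in [x]. *)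
Lemma gamma_integral_rV n (s : R) :
  (gamma_integral s * \int[@lebesgue_mx R 1 n]_x ((1 + edot x x) `^ (- s))%:E =
   ((pi `^ (n%:R / 2))%:E * gamma_integral (s - n%:R / 2)))%E.
Proof.
have edot1 (x : 'rV[R]_n) : 0 < 1 + edot x x by rewrite ltr_pwDl // edot_ge0.
have mp : measurable_fun setT (fun x : 'rV[R]_n => ((1 + edot x x) `^ (- s))%:E).
  apply/measurable_EFinP/measurable_powRl/measurable_funD => //.
  exact: measurable_edot.
rewrite -(ge0_integralZl _ measurableT mp) //; last 2 first.
- by move=> x _; rewrite lee_fin powR_ge0.
- by apply: integral_ge0 => t _; rewrite lee_fin gamma_kernel_ge0.
transitivity (\int[@lebesgue_mx R 1 n]_x \int[mu]_t (gamma_kernel s (1 + edot x x) t)%:E)%E.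
  by apply: eq_integral => x _; rewrite gamma_integral_scale // muleC.
have mk : measurable_fun setT (fun z : 'rV[R]_n * measurableTypeR R =>
    (gamma_kernel s (1 + edot z.1 z.1) (z.2 : R))%:E).
  apply/measurable_EFinP; apply: measurable_gamma_kernel => //.
  by apply: measurable_funD => //; exact: measurable_edot.
transitivity (\int[mu]_t \int[@lebesgue_mx R 1 n]_x (gamma_kernel s (1 + edot x x) t)%:E)%E.
  by apply: (ge0_integral_swap _ _ mk) => x t; rewrite lee_fin gamma_kernel_ge0.
rewrite /gamma_integral -ge0_integralZl //; last 3 first.
- by apply/measurable_EFinP; exact: measurable_gamma_kernel.
- by move=> t _; rewrite lee_fin gamma_kernel_ge0.
- by rewrite lee_fin powR_ge0.
apply: eq_integral => t _.
have [t0|t0] := ltP 0 t; last first.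
  rewrite gamma_kernel_le0 // mule0; apply: integral0_eq => x _.
  by rewrite gamma_kernel_le0.
transitivity (\int[@lebesgue_mx R 1 n]_x
    ((t `^ (s - 1) * expR (- t))%:E * (expR (- (t * edot x x)))%:E))%E.
  apply: eq_integral => x _; rewrite gamma_kernelE // -EFinM -mulrA -expRD.
  by rewrite mulrDl mul1r opprD [edot x x * t]mulrC.
have mg : measurable_fun setT (fun x : 'rV[R]_n => (expR (- (t * edot x x)))%:E).
  apply/measurable_EFinP/measurable_expRcomp/measurable_funN/measurable_funM => //.
  exact: measurable_edot.
rewrite (ge0_integralZl _ measurableT mg); last 2 first.
- by move=> x _; rewrite lee_fin expR_ge0.
- by rewrite lee_fin mulr_ge0 ?powR_ge0 ?expR_ge0.
(* The Gaussian integral [Num.sqrt (pi / t) ^+ n] is [pi]^ (n / 2)[times]t [^ (- n / 2)], which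
   shifts the parameter from [s] to [s - n / 2]. *)
rewrite integral_gauss_rV // -!EFinM gamma_kernelE // mul1r; congr (_%:E).
rewrite -powR12_sqrt ?divr_ge0 ?pi_ge0 ?ltW // -powR_mulrn ?powR_ge0 // -powRrM.
rewrite powRM ?pi_ge0 ?invr_ge0 ?ltW // -[t^-1]powR_inv1 ?ltW // -powRrM.
rewrite mulrC -!mulrA [2^-1 * _]mulrC; congr (_ * _).
rewrite mulrA -powRD ?(lt0r_neq0 t0) ?implybT //; congr (_ `^ _ * _).
by rewrite mulN1r; ring.
Qed.

End gamma_identity.

Section gamma_finite.
Context (R : realType).
Local Notation mu := (@lebesgue_measure R).

Lemma gamma_integral_gt0 (s : R) : (0 < gamma_integral s)%E.
Proof.
have mk : measurable_fun setT (fun t : R => (gamma_kernel s 1 t)%:E).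
  by apply/measurable_EFinP; exact: measurable_gamma_kernel.
rewrite lt0e; apply/andP; split; last first.
  by apply: integral_ge0 => t _; rewrite lee_fin gamma_kernel_ge0.
apply/negP => /eqP G0.
have : (\int[mu]_t `|(gamma_kernel s 1 t)%:E| = 0)%E.
  rewrite -[RHS]G0; apply: eq_integral => t _.
  by rewrite gee0_abs // lee_fin gamma_kernel_ge0.
move/(ae_eq_integral_abs mu measurableT mk) => -[N [mN N0 subN]].
have : (mu (`]0%R, 1%R[%classic : set R) <= mu N)%E.
  apply: le_measure; rewrite ?inE //.
  move=> t; rewrite /= in_itv /= => /andP[t0 _]; apply: subN => /= /(_ Logic.I) [].
  apply/eqP; rewrite gamma_kernelE // mulf_neq0 //.
    by rewrite gt_eqF // powR_gt0.
  by rewrite gt_eqF // expR_gt0.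
by rewrite N0 lebesgue_measure_itv /= lte_fin ltr01 sube0 lee_fin ler10.
Qed.

(** The inequality [x <= expR x] at [x = t / (2 * a)], raised to the power [a]. *)
Lemma powR_le_expR (a t : R) : 0 <= a -> 0 < t ->
  t `^ a <= (2 * a) `^ a * expR (t / 2).
Proof.
rewrite le_eqVlt => /predU1P[<- t0|a0 t0].
  by rewrite !powRr0 mul1r -expR0 ler_expR divr_ge0 // ltW.
have a20 : 0 < 2 * a by rewrite mulr_gt0.
have tE : t = 2 * a * (t / (2 * a)) by rewrite mulrCA divff ?mulr1 // gt_eqF.
have ta0 : 0 < t / (2 * a) by rewrite divr_gt0.
rewrite {1}tE [leLHS]powRM ?(ltW a20) ?(ltW ta0) // ler_pM2l ?powR_gt0 //.
have -> : t / 2 = t / (2 * a) * a by field; rewrite gt_eqF.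
rewrite expRM; apply: ge0_ler_powR; rewrite ?nnegrE ?expR_ge0 ?(ltW a0) //.
  by rewrite ltW // divr_gt0.
by apply: le_trans (expR_ge1Dx _); rewrite lerDr ler01.
Qed.

Lemma gamma_integral_lty_ge1 (s : R) : 1 <= s -> (gamma_integral s < +oo)%E.
Proof.
move=> s1; pose a := s - 1; have a0 : 0 <= a by rewrite subr_ge0.
(* The factor [2] compensates the [2^-1] in front of the exponential density of rate [2^-1], which
   dominates the kernel. *)
pose C := 2 * (2 * a) `^ a.
have C0 : 0 <= C by rewrite mulr_ge0 ?powR_ge0.
have h0 : (0 : R) < 2^-1 by rewrite invr_gt0.
pose e (t : measurableTypeR R) : \bar R := (exponential_pdf (2^-1) (t : R))%:E.
have mexp : measurable_fun setT e.
  by apply/measurable_EFinP; exact: measurable_exponential_pdf.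
have exp0 t : (0 <= e t)%E.
  by rewrite lee_fin exponential_pdf_ge0 // ltW.
apply: (@le_lt_trans _ _ (\int[mu]_t (C%:E * e t))%E); last first.
  rewrite (ge0_integralZl _ measurableT mexp) ?lee_fin //.
  by rewrite integral_exponential_pdf // mule1 ltry.
apply: ge0_le_integral => //.
- by move=> t _; rewrite lee_fin gamma_kernel_ge0.
- by apply/measurable_EFinP; exact: measurable_gamma_kernel.
- by apply: emeasurable_funM.
move=> t _; rewrite -EFinM lee_fin.
have [t0|t0] := ltP 0 t; last first.
  by rewrite gamma_kernel_le0 // mulr_ge0 // -lee_fin; exact: exp0.
rewrite gamma_kernelE // mul1r -/a /exponential_pdf /patch mem_set; last first.
  by rewrite /= in_itv /= andbT ltW.
apply: (@le_trans _ _ ((2 * a) `^ a * expR (t / 2) * expR (- t))).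
  by rewrite ler_pM2r ?expR_gt0 // powR_le_expR.
have -> : C * (2^-1 * expR (- 2^-1 * t)) = (2 * a) `^ a * expR (- 2^-1 * t).
  by rewrite /C; field.
by rewrite -mulrA -expRD ler_wpM2l ?powR_ge0 // ler_expR; lra.
Qed.

Lemma powR_neg_cvgy (r : R) : 0 < r -> x `^ (- r) @[x --> +oo] --> (0 : R).
Proof.
move=> r0; apply/cvgr0Pnorm_le => e e0; near=> x.
have x0 : 0 < x by near: x; exact: nbhs_pinfty_gt.
rewrite ger0_norm ?powR_ge0 // powRN invf_ple ?posrE ?powR_gt0 //.
have -> : e^-1 = (e `^ (- r^-1)) `^ r.
  by rewrite -powRrM mulNr mulVf ?gt_eqF // powR_inv1 // ltW.
have ex : e `^ (- r^-1) <= x by near: x; apply: nbhs_pinfty_ge; exact: num_real.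
by apply: ge0_ler_powR ex; rewrite ?nnegrE ?powR_ge0 ?(ltW r0) ?(ltW x0).
Unshelve. all: by end_near. Qed.

Lemma integral_powR_tail (q : R) : 1 < q ->
  (\int[mu]_(x in `[1%R, +oo[) (x `^ (- q))%:E < +oo)%E.
Proof.
move=> q1; pose F (x : R) : R := - (q - 1)^-1 * x `^ (- (q - 1)).
have q10 : 0 < q - 1 by rewrite subr_gt0.
have dF (x : R) : 0 < x -> is_derive x 1 F (x `^ (- q)).
  move=> x0; have := is_derive1_powR (- (q - 1)) x0.
  move=> /(@is_deriveZ _ _ _ _ (- (q - 1)^-1) _ _ _) dp.
  have dF' : is_derive x 1 F (- (q - 1)^-1 * (- (q - 1) * x `^ (- (q - 1) - 1))) by exact: dp.
  apply: (is_derive_eq dF'); rewrite mulrA mulrNN mulVf ?gt_eqF // mul1r.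
  by congr (_ `^ _); ring.
rewrite (@ge0_continuous_FTC2y R (fun x => x `^ (- q)) F 1 0) ?ltry //.
- by move=> x _; rewrite powR_ge0.
- apply: derivable_within_continuous => x; rewrite in_itv /= andbT => x1.
  by apply: derivable_powR; rewrite in_itv /= andbT; exact: lt_le_trans x1.
- rewrite -[X in _ --> X](mulr0 (- (q - 1)^-1)); apply: cvgMr.
  exact: powR_neg_cvgy.
- by move=> x x1; have [] := dF x (lt_trans ltr01 x1).
- apply: cvg_at_right_filter; apply: differentiable_continuous.
  by apply/derivable1_diffP; have [] := dF 1 ltr01.
- move=> x; rewrite in_itv /= andbT => x1; rewrite derive1E.
  by have [_ ->] := dF x (lt_trans ltr01 x1).
Qed.

Lemma integral_student_lty (p : R) : 2^-1 < p ->
  (\int[@lebesgue_mx R 1 1]_x ((1 + edot x x) `^ (- p))%:E < +oo)%E.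
Proof.
move=> p2; have p0 : 0 < p by apply: lt_trans p2; rewrite invr_gt0.
pose f (x : R) := (1 + x ^+ 2) `^ (- p).
have mf0 : measurable_fun setT (fun x : 'rV[R]_1 => ((1 + edot x x) `^ (- p))%:E).
  apply/measurable_EFinP/measurable_powRl/measurable_funD => //.
  exact: measurable_edot.
rewrite (ge0_integral_mx11 mf0); last by move=> x; rewrite lee_fin powR_ge0.
have -> : (\int[mu]_t ((1 + edot (t%:M : 'rV[R]_1) t%:M) `^ (- p))%:E = \int[mu]_t (f t)%:E)%E.
  apply: eq_integral => t _; rewrite /edot big_ord1 !mxE eqxx mulr1n.
  by rewrite /f expr2.
pose J : set R := `[0, 1]%classic; pose K : set R := `[1, +oo[%classic.
have mJ : measurable J by exact: measurable_itv.
have mK : measurable K by exact: measurable_itv.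
pose h (x : R) := \1_J x + \1_K x * x `^ (- (2 * p)).
have h0 x : 0 <= h x by rewrite addr_ge0 ?mulr_ge0 ?indicE ?ler0n ?powR_ge0.
have mhK : measurable_fun setT (fun x : R => \1_K x * x `^ (- (2 * p))).
  by apply: measurable_funM => //; exact: measurable_powRl.
have mh : measurable_fun setT (fun x : R => (h x)%:E).
  by apply/measurable_EFinP; apply: measurable_funD.
have hfin : (\int[mu]_x (h x)%:E < +oo)%E.
  pose h1 (x : measurableTypeR R) : \bar R := (\1_J (x : R))%:E.
  pose h2 (x : measurableTypeR R) : \bar R := (\1_K (x : R) * (x : R) `^ (- (2 * p)))%:E.
  have mh1 : measurable_fun setT h1 by apply/measurable_EFinP.
  have mh2 : measurable_fun setT h2 by apply/measurable_EFinP.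
  have h10 x : setT x -> (0 <= h1 x)%E by rewrite lee_fin indicE ler0n.
  have h20 x : setT x -> (0 <= h2 x)%E.
    by rewrite lee_fin mulr_ge0 ?indicE ?ler0n ?powR_ge0.
  rewrite (_ : \int[mu]_x (h x)%:E = \int[mu]_x (h1 x + h2 x))%E //.
  rewrite (ge0_integralD mu measurableT h10 mh1 h20 mh2).
  have J1 : mu J = 1%E by rewrite lebesgue_measure_itv /= lte01 sube0.
  have -> : (\int[mu]_x h1 x = 1)%E.
    by transitivity (mu (J `&` setT)); [exact: integral_indic|rewrite setIT J1].
  apply: lte_add_pinfty; first exact: ltry.
  have q1 : 1 < 2 * p by lra.
  apply: le_lt_trans (integral_powR_tail q1).
  suff -> : (\int[mu]_x h2 x = \int[mu]_(x in K) (x `^ (- (2 * p)))%:E)%E by [].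
  rewrite [RHS]integral_mkcond; apply: eq_integral => x _; rewrite /h2 /patch indicE.
  by case: ifPn => _; rewrite ?mul1r ?mul0r.
have fh x : f x <= h x + h (- x).
  wlog x0 : x / 0 <= x.
    move=> wl; have [/wl//|x0] := leP 0 x.
    have := wl (- x); rewrite opprK addrC /f sqrrN; apply.
    by rewrite oppr_ge0 ltW.
  apply: (@le_trans _ _ (h x)); last by rewrite lerDl.
  have [x1|x1] := leP x 1.
    apply: (@le_trans _ _ 1).
      rewrite /f powRN invf_le1 ?powR_gt0 //; last by rewrite ltr_pwDl // sqr_ge0.
      rewrite -[leLHS](powRr0 (1 + x ^+ 2)); apply: ler_powR (ltW p0).
      by rewrite lerDl sqr_ge0.
    rewrite /h [\1_J x]indicE mem_set; last by rewrite /J /= in_itv /= x0 x1.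
    by rewrite lerDl mulr_ge0 ?indicE ?ler0n ?powR_ge0.
  have xx0 : 0 < x by rewrite (lt_trans ltr01).
  rewrite /h [\1_K x]indicE mem_set; last by rewrite /K /= in_itv /= andbT ltW.
  rewrite mul1r; apply: (@le_trans _ _ (x `^ (- (2 * p)))); last first.
    by rewrite lerDr indicE ler0n.
  rewrite /f !powRN lef_pV2 ?posrE ?powR_gt0 //; last by rewrite ltr_pwDl // sqr_ge0.
  rewrite powRrM -powR_mulrn ?(ltW xx0) //; apply: ge0_ler_powR.
  - exact: ltW.
  - by rewrite nnegrE powR_ge0.
  - by rewrite nnegrE addr_ge0 // powR_ge0.
  by rewrite lerDr.
apply: (@le_lt_trans _ _ (\int[mu]_x ((h x)%:E + (h (- x))%:E))%E).
  apply: ge0_le_integral => //.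
  - by move=> x _; rewrite lee_fin powR_ge0.
  - apply/measurable_EFinP/measurable_powRl/measurable_funD => //.
  - apply: emeasurable_funD => //.
    by apply: (measurableT_comp mh); exact: measurable_funN.
  - by move=> x _; rewrite -EFinD lee_fin.
pose g (x : measurableTypeR R) : \bar R := (h x)%:E.
pose g' (x : measurableTypeR R) : \bar R := (h (- (x : R)))%:E.
have mg : measurable_fun setT g by [].
have mg' : measurable_fun setT g'.
  by apply: (measurableT_comp mh); exact: measurable_funN.
have g0 x : setT x -> (0 <= g x)%E by rewrite lee_fin.
have g'0 x : setT x -> (0 <= g' x)%E by rewrite lee_fin.
rewrite (ge0_integralD mu measurableT g0 mg g'0 mg').
rewrite /g' (ge0_integral_lebesgue_opp mh); last by move=> x; rewrite lee_fin.
exact: lte_add_pinfty.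
Qed.

(* For small [s], [gamma_integral_rV] in dimension 1 passes from [s + 1/2] to [s]. *)
Lemma gamma_integral_lty (s : R) : 0 < s -> (gamma_integral s < +oo)%E.
Proof.
have step (r : R) : 0 < r -> (gamma_integral (r + 2^-1) < +oo)%E -> (gamma_integral r < +oo)%E.
  move=> r0 rfin; have := gamma_integral_rV 1 (r + 2^-1).
  rewrite mul1r addrK => E.
  have c0 : 0 < pi `^ 2^-1 :> R by rewrite powR_gt0 // pi_gt0.
  have : ((pi `^ 2^-1)%:E * gamma_integral r < +oo)%E.
    rewrite -E lte_mul_pinfty // ?ltW ?gamma_integral_gt0 //.
      by rewrite ge0_fin_numE // ltW // gamma_integral_gt0.
    by apply: integral_student_lty; rewrite ltrDr.
  by rewrite !ltey; apply: contra_neq => ->; rewrite gt0_muley // lte_fin.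
(* Two steps of one half lead from [s] to [s + 1], which is at least [1]. *)
move=> s0; apply: (step _ s0); apply: step; first by rewrite addr_gt0 // invr_gt0.
by apply: gamma_integral_lty_ge1; lra.
Qed.

Lemma EFin_Gamma (s : R) : 0 < s -> (Gamma s)%:E = gamma_integral s.
Proof.
move=> s0; rewrite GammaE fineK // ge0_fin_numE ?gamma_integral_lty //.
by rewrite ltW // gamma_integral_gt0.
Qed.

Lemma Gamma_gt0 (s : R) : 0 < s -> 0 < Gamma s.
Proof. by move=> s0; rewrite -lte_fin EFin_Gamma // gamma_integral_gt0. Qed.

Lemma ctilde_gt0 n (b : R) : n%:R / 2 < b -> 0 < ctilde n b.
Proof.
move=> nb; have b0 : 0 < b by apply: le_lt_trans nb; rewrite divr_ge0.
by rewrite divr_gt0 ?mulr_gt0 ?Gamma_gt0 ?powR_gt0 ?pi_gt0 ?subr_gt0.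
Qed.

Lemma integral_beta_prime n (b : R) : n%:R / 2 < b ->
  (\int[@lebesgue_mx R 1 n]_x ((1 + edot x x) `^ (- b))%:E = ((ctilde n b)^-1)%:E)%E.
Proof.
move=> nb; have b0 : 0 < b by apply: le_lt_trans nb; rewrite divr_ge0.
have := gamma_integral_rV n b; rewrite -!EFin_Gamma ?subr_gt0 // -EFinM.
have G0 := Gamma_gt0 b0; set X := (\int[_]_x _)%E => E.
have -> : X = ((Gamma b)^-1%:E * ((Gamma b)%:E * X))%E.
  by rewrite muleA -EFinM mulVf ?mul1e // gt_eqF.
by rewrite E -EFinM invf_div mulrC.
Qed.

End gamma_finite.

(** * The volume of a simplex *)

Section simplex_volume.
Context (R : realType) (n : nat).

Lemma continuous_mx (T : topologicalType) p q (f : T -> 'M[R]_(p, q)) :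
  (forall i j, continuous (fun x => f x i j)) -> continuous f.
Proof.
move=> cf x A [P PM sPA]; apply: (filterS (fun y h => sPA (f y) h)).
by apply: filter_forall => i; apply: filter_forall => j; exact: cf (PM i j).
Qed.

Lemma conv_hull_rowsP (X : 'M[R]_(n.+1, n)) y : conv_hull (rows_of_mx X) y <->
  exists c : 'rV[R]_n.+1, [/\ forall i, 0 <= c 0 i, \sum_i c 0 i = 1 & y = c *m X].
Proof.
split=> [[c [c0 c1 ->]]|[c [c0 c1 ->]]].
  exists (\row_i c i); split; first by move=> i; rewrite mxE.
    by rewrite -[RHS]c1; apply: eq_bigr => i _; rewrite mxE.
  by rewrite mulmx_sum_row; apply: eq_bigr => i _; rewrite mxE tnth_mktuple.
exists (fun i => c 0 i); split => //.
by rewrite mulmx_sum_row; apply: eq_bigr => i _; rewrite tnth_mktuple.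
Qed.

(** The hull is the continuous image of the compact set of barycentric weights. Compactness makes it
    closed, hence Borel, so that its volume is meaningful. *)
Lemma compact_conv_hull (X : 'M[R]_(n.+1, n)) : compact (conv_hull (rows_of_mx X)).
Proof.
pose box : set 'rV[R]_n.+1 := [set c | forall i, `[0, 1]%classic (c ord0 i)].
pose f (c : 'rV[R]_n.+1) : R := \sum_i c 0 i.
have cf : continuous f by apply: continuous_sumr => i; exact: coord_continuous.
have cbox : compact box.
  by apply: (@rV_compact R n.+1 (fun=> `[0, 1]%classic)) => i; exact: segment_compact.
have clos : closed (f @^-1` [set 1]).
  by apply: preimage_closed => [c _|]; [exact: cf|exact: closed_eq].
rewrite (_ : conv_hull _ = (fun c => c *m X) @` (box `&` f @^-1` [set 1])).
  apply: continuous_compact; last exact: compact_closedI.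
  apply: continuous_subspaceT; apply: continuous_mx => i j.
  rewrite (_ : (fun _ => _) = fun c : 'rV[R]_n.+1 => \sum_k c i k * X k j); last first.
    by apply/funext => c; rewrite mxE.
  apply: continuous_sumr => k c.
  by apply: (@cvgM R 'rV[R]_n.+1 (nbhs c)); [exact: coord_continuous|exact: cvg_cst].
apply/seteqP; split=> y.
  move=> /conv_hull_rowsP[c [c0 c1 ->]]; exists c => //; split => // i.
  rewrite /= in_itv /= c0 /= -c1 (bigD1 i) //= lerDl sumr_ge0 //.
move=> [c [cb c1] <-]; apply/conv_hull_rowsP; exists c; split => // i.
by have := cb i; rewrite /= in_itv /= => /andP[].
Qed.

Lemma measurable_conv_hull (X : 'M[R]_(n.+1, n)) : measurable (conv_hull (rows_of_mx X)).
Proof.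
rewrite -[X in measurable X]setCK; apply: measurableC; apply: open_measurable_mx.
apply: closed_openC; apply: compact_closed; last exact: compact_conv_hull.
exact: norm_hausdorff.
Qed.

Lemma lebesgue_rVE (A : set 'rV[R]_n) : measurable A ->
  lebesgue_rV R n A = @lebesgue_mx R 1 n A.
Proof.
move=> mA; have := @ge0_integral_lebesgue_rV R n (fun x => (\1_A x)%:E).
rewrite !integral_indic // !setIT; apply; first by apply/measurable_EFinP.
by move=> x; rewrite lee_fin indicE ler0n.
Qed.

Definition corner_simplex : set 'rV[R]_n :=
  [set s | (forall i, 0 <= s 0 i) /\ \sum_i s 0 i <= 1].

(* Actually [1 / n!], but only its positivity matters. *)
Definition corner_volume : R := fine (@lebesgue_mx R 1 n corner_simplex).

Lemma measurable_corner_simplex : measurable corner_simplex.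
Proof.
have ms : measurable_fun setT (fun s : 'rV[R]_n => \sum_i s 0 i).
  by apply: measurable_sum => i; exact: measurable_coord.
rewrite (_ : corner_simplex = (\bigcap_(i in [set: 'I_n])
    (fun s : 'rV[R]_n => s 0 i) @^-1` `[0, +oo[%classic) `&`
  (fun s : 'rV[R]_n => \sum_i s 0 i) @^-1` `]-oo, 1]%classic).
  apply: measurableI; last first.
    by rewrite -[X in measurable X]setTI; apply: ms => //; exact: measurable_itv.
  apply: fin_bigcap_measurable => // i _; rewrite -[X in measurable X]setTI.
  by apply: measurable_coord => //; exact: measurable_itv.
apply/seteqP; split => s [s0 s1]; split; rewrite /= ?in_itv //=.
- by move=> i _; rewrite /= in_itv /= andbT.
- by move=> i; have := s0 i Logic.I; rewrite /= in_itv /= andbT.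
Qed.

Lemma lebesgue_cube (a : R) : 0 <= a ->
  @lebesgue_mx R 1 n [set s | forall i, s 0 i \in `[0, a]] = (a ^+ n)%:E.
Proof.
move=> a0; transitivity (@lebesgue_mx R 1 n (mx_box (fun _ _ => `[0, a]%classic : set R))).
  congr lebesgue_mx; apply/seteqP; split => s /= h; last by move=> i; exact: (h 0).
  by move=> i j; rewrite ord1; exact: h.
rewrite lebesgue_mx_box; last by move=> i j; exact: measurable_itv.
rewrite big_ord1; have -> : lebesgue_measure (`[0, a]%classic : set R) = a%:E.
  rewrite lebesgue_measure_itv /= lte_fin; case: ltgtP a0 => // [a0 _|<- _]; last by [].
  by rewrite sube0.
elim: n => [|k IHk]; first by rewrite big_ord0.
by rewrite big_ord_recl IHk exprS EFinM.
Qed.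

(** The corner simplex lies between the cubes of sides [n.+1%:R^-1] and [1]; the side [n.+1%:R^-1]
    also makes sense for [n = 0]. *)
Lemma corner_volume_gt0 : 0 < corner_volume /\
  (corner_volume%:E = @lebesgue_mx R 1 n corner_simplex).
Proof.
have mcube (a : R) : measurable [set s : 'rV[R]_n | forall i, s 0 i \in `[0, a]].
  have := @measurable_row_box R n (fun=> `[0, a]%classic); apply => i.
  exact: measurable_itv.
have le1 : (@lebesgue_mx R 1 n corner_simplex <= 1)%E.
  rewrite -(expr1n _ n) -lebesgue_cube //; apply: le_measure;
    [by rewrite inE; exact: measurable_corner_simplex|by rewrite inE; exact: mcube|].
  move=> s /= [s0 s1] i; rewrite in_itv /= s0 /=; apply: le_trans s1.
  by rewrite (bigD1 i) //= lerDl sumr_ge0.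
have fin : @lebesgue_mx R 1 n corner_simplex \is a fin_num.
  by rewrite ge0_fin_numE // (le_lt_trans le1) ?ltry.
rewrite /corner_volume fineK //; split=> //.
have a0 : 0 < (n.+1%:R^-1 : R) by rewrite invr_gt0.
rewrite -lte_fin fineK //.
apply: (@lt_le_trans _ _ ((n.+1%:R^-1 : R) ^+ n)%:E); first by rewrite lte_fin exprn_gt0.
rewrite -lebesgue_cube ?(ltW a0) //; apply: le_measure;
  [by rewrite inE; exact: mcube|by rewrite inE; exact: measurable_corner_simplex|].
move=> s /= sa; split=> [i|]; first by have := sa i; rewrite in_itv /= => /andP[].
apply: (@le_trans _ _ (\sum_(i < n) n.+1%:R^-1)).
  by apply: ler_sum => i _; have := sa i; rewrite in_itv /= => /andP[].
rewrite sumr_const card_ord -[X in X <= _]mulr_natl ler_pdivrMr // mul1r ler_nat.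
exact: leqnSn.
Qed.

Lemma conv_hull_corner (X : 'M[R]_(n.+1, n)) (x0 : 'rV[R]_n) (D : 'M[R]_n) :
  X = col_mx (x0 : 'M[R]_(1, n)) (D + const_mx 1 *m x0) :> 'M[R]_(1 + n, n) ->
  conv_hull (rows_of_mx X) = (fun s => x0 + s *m D) @` corner_simplex.
Proof.
move=> XE; have sumE (s : 'rV[R]_n) : s *m (const_mx 1 : 'cV[R]_n) = (\sum_i s 0 i)%:M.
  apply/matrixP => i j; rewrite !ord1 !mxE eqxx mulr1n.
  by apply: eq_bigr => k _; rewrite mxE mulr1.
have rowE (t : 'rV[R]_1) (s : 'rV[R]_n) :
    (row_mx t s : 'rV[R]_n.+1) *m X = (t 0 0 + \sum_i s 0 i) *: x0 + s *m D.
  rewrite XE (@mul_row_col R 1 1 n n) mulmxDr mulmxA sumE {1}[t]mx11_scalar.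
  by rewrite !mul_scalar_mx scalerDl [s *m D + _]addrC addrA.
apply/seteqP; split=> y.
  move=> /conv_hull_rowsP[c [cge0 csum ->]].
  have cE : c = row_mx (lsubmx (c : 'M[R]_(1, 1 + n))) (rsubmx (c : 'M[R]_(1, 1 + n))).
    by rewrite hsubmxK.
  move: csum; rewrite big_ord_recl /= => csum.
  have cr i : rsubmx (c : 'M[R]_(1, 1 + n)) 0 i = c 0 (lift ord0 i).
    by rewrite mxE; congr (c 0 _); exact: val_inj.
  have cl : lsubmx (c : 'M[R]_(1, 1 + n)) 0 0 = c 0 ord0.
    by rewrite mxE; congr (c 0 _); exact: val_inj.
  exists (rsubmx (c : 'M[R]_(1, 1 + n))).
    split=> [i|]; first by rewrite cr.
    rewrite (eq_bigr _ (fun i _ => cr i)) -csum lerDr; exact: cge0.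
  rewrite [in RHS]cE rowE (eq_bigr _ (fun i _ => cr i)) cl csum.
  by rewrite scale1r.
move=> [s [sge0 ssum] <-]; apply/conv_hull_rowsP.
exists (row_mx ((1 - \sum_i s 0 i)%:M : 'rV[R]_1) s : 'rV[R]_(1 + n)); split.
- move=> i; rewrite mxE; case: splitP => j _; last exact: sge0.
  by rewrite ord1 mxE eqxx mulr1n subr_ge0.
- rewrite (@big_split_ord _ _ _ 1 n) /= big_ord1 (@row_mxEl _ 1 1 n) mxE eqxx mulr1n.
  by rewrite (eq_bigr _ (fun i _ => @row_mxEr _ 1 1 n _ _ _ i)) subrK.
- by rewrite rowE mxE eqxx mulr1n subrK scale1r.
Qed.

(** An invertible edge matrix maps the corner simplex onto the hull, up to a translation. A singular
    one puts the hull into a hyperplane with normal vector [a], and each line of direction [a] meets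
    it in at most one point. *)
Lemma lebesgue_conv_hull (X : 'M[R]_(n.+1, n)) :
  volume (conv_hull (rows_of_mx X)) = corner_volume * `|\det (bary X)|.
Proof.
pose x0 : 'rV[R]_n := usubmx (X : 'M[R]_(1 + n, n)).
pose D := dsubmx (X : 'M[R]_(1 + n, n)) - const_mx 1 *m x0.
have XE : X = col_mx (x0 : 'M[R]_(1, n)) (D + const_mx 1 *m x0) :> 'M[R]_(1 + n, n).
  by rewrite subrK vsubmxK.
have detE : \det (bary X) = \det D by rewrite XE (@det_bary R n) addrK.
have convE := conv_hull_corner XE.
have mconv := measurable_conv_hull X.
rewrite /volume lebesgue_rVE // detE.
have [uD|nD] := boolP (D \in unitmx).
  suff : (`|\det D|%:E * corner_volume%:E =
          @lebesgue_mx R 1 n (conv_hull (rows_of_mx X)))%E.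
    by move=> <-; rewrite -EFinM /= mulrC.
  rewrite (corner_volume_gt0.2).
  pose f (y : 'rV[R]_n) : \bar R := (\1_(conv_hull (rows_of_mx X)) y)%:E.
  have mf : measurable_fun setT f by apply/measurable_EFinP; exact: measurable_indic.
  have f0 y : (0 <= f y)%E by rewrite lee_fin indicE ler0n.
  have mfx : measurable_fun setT (fun y : 'rV[R]_n => f (y + x0)).
    apply: (measurableT_comp mf).
    by apply: measurable_addmx.
  have mcor := measurable_corner_simplex.
  have indE (A : set 'rV[R]_n) : measurable A ->
      @lebesgue_mx R 1 n A = (\int[@lebesgue_mx R 1 n]_y (\1_A y)%:E)%E.
    by move=> mA; rewrite integral_indic // setIT.
  rewrite [RHS]indE //.
  rewrite -[RHS](ge0_integral_shiftmx x0 mf f0).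
  rewrite -[RHS](ge0_integral_mulmxr uD mfx (fun=> f0 _)) expr1; congr (_ * _)%E.
  rewrite indE //; apply: eq_integral => s _; rewrite /f !indicE; congr ((_ : bool)%:R)%:E.
  apply/idP/idP; rewrite !inE convE; first by move=> cs; exists s; rewrite // addrC.
  move=> [s' cs' /eqP]; rewrite addrC (inj_eq (addIr _)) => /eqP /(congr1 (mulmx^~ (invmx D))).
  by rewrite !mulmxK // => <-.
have D0 : \det D = 0 by move: nD; rewrite unitmxE unitfE negbK => /eqP.
rewrite D0 normr0 mulr0.
have : kermx D^T != 0.
  by rewrite kermx_eq0 row_free_unit unitmx_tr.
move=> /rowV0Pn[a /sub_kermxP aD a0].
suff -> : @lebesgue_mx R 1 n (conv_hull (rows_of_mx X)) = 0%E by [].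
have Da : D *m a^T = 0 by rewrite -[D]trmxK -trmx_mul aD trmx0.
apply: (lebesgue_mx_null_direction (E := a)) => // y.
apply: countable_lebesgue_measure0; apply/finite_set_countable.
have aa : 0 < edot a a by rewrite lt_def edot_ge0 andbT; apply: contra a0 => /eqP/edot_eq0 ->.
(* The inner product with [a] is constant on the hull, and this determines [t]. *)
apply: (@sub_finite_set _ _ [set edot (x0 - y) a / edot a a]) => // t /=.
rewrite convE => -[s _ /(congr1 (fun u => edot (u - y) a))].
have -> : edot (x0 + s *m D - y) a = edot (x0 - y) a.
  rewrite addrAC [LHS]edotDl -[RHS]addr0; congr (_ + _); rewrite edotE.
  by rewrite -mulmxA Da mulmx0 mxE.
by rewrite addrAC subrr add0r edotZl => ->; rewrite mulfK // gt_eqF.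
Qed.

End simplex_volume.

(** * The law of the coordinates *)

Section density_measure.
Local Open Scope ereal_scope.
Context d (T : measurableType d) (R : realType).
Variables (mu : {sigma_finite_measure set T -> \bar R}) (g : T -> R).

Definition density_measure of measurable_fun setT g & (forall x, 0 <= g x)%R :
  set T -> \bar R := fun A => \int[mu]_(x in A) (g x)%:E.

Hypothesis mg : measurable_fun setT g.
Hypothesis g0 : (forall x, 0 <= g x)%R.
Local Notation nu := (density_measure mg g0).

Let mgE : measurable_fun setT (EFin \o g).
Proof. exact/measurable_EFinP. Qed.

Let density0 : nu set0 = 0.
Proof. exact: integral_set0. Qed.

Let density_ge0 A : 0 <= nu A.
Proof. by apply: integral_ge0 => x _; rewrite lee_fin. Qed.

Let density_additive : semi_sigma_additive nu.
Proof. by apply: semi_sigma_additive_nng_induced => // x; rewrite lee_fin. Qed.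

HB.instance Definition _ := isMeasure.Build _ _ _ nu density0 density_ge0 density_additive.

Let density_sigma_finite : sigma_finite setT nu.
Proof.
have [F TF Foo] := sigma_finiteT mu.
(* A density need not be integrable on [F i]; cutting also at its level [l] bounds the new measure
   by [l] times [mu (F i)]. *)
pose H (p : nat * nat) := F p.1 `&` g @^-1` `]-oo, p.2%:R]%classic.
exists (fun i => if unpickle i is Some p then H p else set0).
  apply/seteqP; split => // x _.
  have [i _ Fx] : (\bigcup_i F i) x by rewrite -TF.
  exists (pickle (i, Num.bound (g x))) => //; rewrite pickleK; split => //=.
  by rewrite in_itv /= ltW // archi_boundP.
move=> i; case: unpickle => [[k l]|]; last by rewrite measure0.
have [mF Fk] := Foo k.
have mH : measurable (H (k, l)).
  by apply: measurableI => //; rewrite -[X in measurable X]setTI; exact: mg.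
split => //; rewrite /density_measure.
apply: (@le_lt_trans _ _ (\int[mu]_(x in H (k, l)) (l%:R)%:E)).
  apply: ge0_le_integral => //.
  - by move=> x _; rewrite lee_fin.
  - by apply: measurable_funTS.
  - by move=> x [_ /=]; rewrite in_itv /= lee_fin.
rewrite integral_cst // lte_mul_pinfty // ?lee_fin //.
apply: le_lt_trans Fk; apply: le_measure; rewrite ?inE //.
exact: subIsetl.
Qed.

HB.instance Definition _ := Measure_isSigmaFinite.Build _ _ _ nu density_sigma_finite.

Lemma power_density_measure k (A : set (k.-tuple T)) : measurable A ->
  power_measure nu k A =
  \int[power_measure mu k]_(t in A) (\prod_(i < k) g (tnth t i))%:E.
Proof.
have mprod n : measurable_fun setT (fun t : n.-tuple T => (\prod_(i < n) g (tnth t i))%:E : \bar R).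
  apply/measurable_EFinP; apply: measurable_prod => i _.
  exact: (measurableT_comp mg (@measurable_tnth _ T n i)).
have prod0 n (t : n.-tuple T) : 0 <= (\prod_(i < n) g (tnth t i))%:E.
  by rewrite lee_fin prodr_ge0.
elim: k A => [|k IHk] A mA.
  rewrite integral_mkcond [RHS]integral_dirac //; last first.
    apply/(measurable_restrictT _ _).1 => //; apply: measurable_funTS; exact: mprod.
  by rewrite patchE big_ord0 /= !diracE in_setT mul1e; case: ifP.
pose B := (fun q : T * k.-tuple T => cons_tuple q.1 q.2) @^-1` A.
have mB : measurable B.
  by rewrite -[X in measurable X]setTI; exact: measurable_cons_tuple.
pose w (t : k.-tuple T) := (\prod_(i < k) g (tnth t i))%:E.
pose F x t := (\1_B (x, t))%:E * w t.
have mF : measurable_fun setT (fun z : T * k.-tuple T => F z.1 z.2).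
  apply: emeasurable_funM; last exact: (measurableT_comp (mprod k)).
  have /measurable_EFinP : measurable_fun setT (\1_B : T * k.-tuple T -> R).
    exact: measurable_indic.
  by apply: eq_measurable_fun => -[].
have F0 x t : 0 <= F x t by apply: mule_ge0; [rewrite lee_fin indicE|exact: prod0].
transitivity (\int[nu]_x \int[power_measure mu k]_t F x t).
  apply: eq_integral => x _; rewrite [LHS]IHk; last exact: measurable_xsection.
  rewrite integral_mkcond; apply: eq_integral => t _.
  by rewrite /F patchE mem_xsection indicE; case: (_ \in _); rewrite ?mul1e ?mul0e.
(* With [nu] innermost, its integrals reduce to the values of [nu] on sections, where its definition
   by a density applies. *)
rewrite [LHS](ge0_integral_swap _ _ mF F0).
pose G x t := F x t * (g x)%:E.
have mG : measurable_fun setT (fun z : T * k.-tuple T => G z.1 z.2).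
  by apply: emeasurable_funM => //; apply: (measurableT_comp mgE); exact: measurable_fst.
have G0 x t : 0 <= G x t by apply: mule_ge0; [exact: F0|rewrite lee_fin].
transitivity (\int[power_measure mu k]_t \int[mu]_x G x t).
  apply: eq_integral => t _.
  have mB1 : measurable (ysection B t) by exact: measurable_ysection.
  have -> : \int[nu]_x F x t = w t * nu (ysection B t).
    rewrite -[in RHS](setIT (ysection B t)) -(integral_indic nu) //.
    rewrite -[RHS](ge0_integralZl _ measurableT) //.
    - by apply: eq_integral => x _; rewrite /F muleC !indicE mem_ysection.
    - by apply/measurable_EFinP; exact: measurable_indic.
    - exact: prod0.
  rewrite /density_measure integral_mkcond.
  rewrite -[LHS](ge0_integralZl _ measurableT) //.
  - apply: eq_integral => x _; rewrite /G /F patchE mem_ysection indicE.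
    by case: (_ \in _); rewrite ?mule0 ?mul0e ?mul1e.
  - by apply/(measurable_restrictT _ _).1 => //; exact: measurable_funTS.
  - by move=> x _; rewrite patchE; case: ifP; rewrite // lee_fin.
  - exact: prod0.
rewrite -[LHS](ge0_integral_swap _ _ mG G0) [in RHS]integral_mkcond.
rewrite [RHS]ge0_integral_power_measureS; last 2 first.
- apply/(measurable_restrictT _ _).1 => //; apply: measurable_funTS; exact: mprod.
- by move=> t; rewrite patchE; case: ifP.
apply: eq_integral => x _; apply: eq_integral => t _.
rewrite /G /F patchE indicE (_ : ((x, t) \in B) = (cons_tuple x t \in A)); last first.
  by apply/idP/idP; rewrite !inE.
case: (_ \in _); rewrite ?mul0e // mul1e big_ord_recl EFinM muleC; congr (_ * _).
by congr EFin; apply: eq_bigr => i _; rewrite tnthS.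
Qed.

End density_measure.

(** * Separation of variables by a homothety *)

Section beta_prime_simplices.
Context (R : realType) (n m : nat).

Definition simplex_kernel (b : R) (z : 'M[R]_(n.+1, n)) : R :=
  `|\det (bary z)| ^+ m * \prod_(i < n.+1) (1 + edot (row i z) (row i z)) `^ (- b).

Definition simplex_exponent (b : R) : R :=
  n.+1%:R * b - ((n + m).+1 * n)%:R / 2.

Lemma simplex_exponent_gt b : (n + m)%:R / 2 < b -> m%:R / 2 < simplex_exponent b.
Proof.
rewrite /simplex_exponent natrM -2!natr1 natrD => h.
have := ler0n R n; nra.
Qed.

Lemma measurable_row_edot d (T : measurableType d) p q (f : T -> 'M[R]_(p, q)) i :
  measurable_fun setT f -> measurable_fun setT (fun x => edot (row i (f x)) (row i (f x))).
Proof. by move=> mf; apply: measurable_edot; exact: measurable_row. Qed.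

Lemma measurable_det_bary : measurable_fun setT (fun z : 'M[R]_(n.+1, n) => `|\det (bary z)| ^+ m).
Proof.
apply/measurable_funX/measurableT_comp => //; apply: measurable_det.
exact: measurable_bary.
Qed.

Lemma measurable_simplex_kernel b : measurable_fun setT (simplex_kernel b).
Proof.
apply: measurable_funM; first exact: measurable_det_bary.
apply: measurable_prod => i _; apply: measurable_powRl; apply: measurable_funD => //.
exact: measurable_row_edot.
Qed.

Lemma simplex_kernel_ge0 b z : 0 <= simplex_kernel b z.
Proof. by rewrite mulr_ge0 // ?exprn_ge0 // prodr_ge0 // => i _; exact: powR_ge0. Qed.

Lemma ge0_integral_scalemx (s : R) (f : 'M[R]_(n.+1, n) -> \bar R) : 0 < s ->
  measurable_fun setT f -> (forall z, 0 <= f z)%E ->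
  (\int[@lebesgue_mx R n.+1 n]_z f z =
   (s ^+ (n * n.+1))%:E * \int[@lebesgue_mx R n.+1 n]_z f (s *: z))%E.
Proof.
move=> s0 mf f0; have us : (s%:M : 'M[R]_n) \in unitmx.
  by rewrite unitmxE det_scalar unitrX // unitfE gt_eqF.
rewrite -[LHS](ge0_integral_mulmxr us mf f0) det_scalar ger0_norm ?exprn_ge0 ?(ltW s0) //.
by rewrite exprM; congr (_ * _)%E; apply: eq_integral => z _; rewrite mul_mx_scalar.
Qed.

(** Stated for an arbitrary [q] and test function [E] because it serves twice: with [q = 1 + |y|^2]
    and a constant for the normalisation, with [q = |y|^2 - 1] and the indicator of a section for
    the law of [T1]. *)
Lemma ge0_integral_simplex_scale (q b : R) (E : 'M[R]_(n.+1, n) -> R) : 0 < q ->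
  measurable_fun setT E -> (forall z, 0 <= E z) ->
  (\int[@lebesgue_mx R n.+1 n]_z ((`|\det (bary z)| ^+ m)%:E *
     (E ((Num.sqrt q)^-1 *: z) *
      \prod_(i < n.+1) (edot (row i z) (row i z) + q) `^ (- b))%:E) =
   (q `^ (- simplex_exponent b))%:E *
   \int[@lebesgue_mx R n.+1 n]_z (E z * simplex_kernel b z)%:E)%E.
Proof.
move=> q0 mE E0; set s := Num.sqrt q; have s0 : 0 < s by rewrite sqrtr_gt0.
have sE : s = q `^ 2^-1 by rewrite /s powR12_sqrt // ltW.
pose f (z : 'M[R]_(n.+1, n)) := ((`|\det (bary z)| ^+ m)%:E * (E (s^-1 *: z) *
      \prod_(i < n.+1) (edot (row i z) (row i z) + q) `^ (- b))%:E)%E.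
have mf : measurable_fun setT f.
  apply: emeasurable_funM; first by apply/measurable_EFinP; exact: measurable_det_bary.
  apply/measurable_EFinP; apply: measurable_funM.
    by apply: (measurableT_comp mE); exact: measurable_scalemx.
  apply: measurable_prod => i _; apply: measurable_powRl; apply: measurable_funD => //.
  exact: measurable_row_edot.
have f0 z : (0 <= f z)%E.
  rewrite /f -EFinM lee_fin !mulr_ge0 ?exprn_ge0 // prodr_ge0 // => i _.
  exact: powR_ge0.
have mEk : measurable_fun setT (fun z => (E z * simplex_kernel b z)%:E).
  by apply/measurable_EFinP/measurable_funM => //; exact: measurable_simplex_kernel.
have Ek0 z : (0 <= (E z * simplex_kernel b z)%:E)%E.
  by rewrite lee_fin mulr_ge0 // simplex_kernel_ge0.
rewrite [LHS](ge0_integral_scalemx s0 mf f0).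
have fE z : f (s *: z) =
    ((s ^+ (n * m) * q `^ (- b) ^+ n.+1)%:E * (E z * simplex_kernel b z)%:E)%E.
  rewrite /f /simplex_kernel scalerA mulVf ?gt_eqF // scale1r.
  have -> : \det (bary (s *: z)) = \det (bary z) * s ^+ n.
    by rewrite -det_scalar -(det_bary_affine z 0) mulmx0 addr0 mul_mx_scalar.
  have -> : \prod_(i < n.+1) (edot (row i (s *: z)) (row i (s *: z)) + q) `^ (- b) =
      q `^ (- b) ^+ n.+1 * \prod_(i < n.+1) (1 + edot (row i z) (row i z)) `^ (- b).
    rewrite -[X in _ ^+ X](card_ord n.+1) -prodr_const -big_split /=.
    apply: eq_bigr => i _; rewrite -powRM ?(ltW q0) ?addr_ge0 ?edot_ge0 //.
    rewrite linearZ /= edotZl edotZr mulrA -expr2 sqr_sqrtr ?(ltW q0) //.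
    by rewrite mulrDr mulr1 addrC.
  rewrite normrM (ger0_norm (exprn_ge0 _ (ltW s0))) exprMn -exprM -!EFinM.
  by congr EFin; ring.
under eq_integral do rewrite fE.
rewrite (ge0_integralZl _ measurableT mEk (fun _ _ => Ek0 _)); last first.
  by rewrite lee_fin mulr_ge0 // ?exprn_ge0 ?powR_ge0 // ltW.
rewrite muleA -EFinM; congr (_%:E * _)%E.
rewrite sE -!powR_mulrn ?powR_ge0 // -!powRrM -!powRD ?(gt_eqF q0) ?implybT //.
congr (_ `^ _); rewrite /simplex_exponent !natrM -natr1 -[X in _ = - (_ - X * _ / _)]natr1 natrD.
by field.
Qed.

End beta_prime_simplices.

(** * The constants, from the total mass of beta' densities *)

Section normalization.
Context (R : realType) (n m : nat).
Variables (Ip : set 'rV[R]_(n + m) -> 'rV[R]_(n + m) -> 'rV[R]_n)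
  (Iq : set 'rV[R]_(n + m) -> 'rV[R]_(n + m) -> 'rV[R]_m).
Hypotheses (Ip_iso : isometry_family Ip) (Iq_iso : isometry_family Iq).
Hypothesis m_gt0 : (0 < m)%N.
Local Notation chart1 := (chart_domain (1%:M : 'M[R]_(n + m))).
Local Notation Z1 := (chart_Z Ip (1%:M : 'M[R]_(n + m))).
Local Notation Y1 := (chart_Y Iq (n := n) (1%:M : 'M[R]_(n + m))).

Lemma ge0_integral_chart_coordinates (F : 'M[R]_(n.+1, n + m) -> \bar R)
    (G : 'M[R]_(n.+1, n) -> 'rV[R]_m -> \bar R) :
  measurable_fun setT F -> (forall X, 0 <= F X)%E ->
  measurable_fun setT (fun z : 'M[R]_(n.+1, n) * 'rV[R]_m => G z.1 z.2) ->
  (forall z y, 0 <= G z y)%E ->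
  (forall X, chart1 X -> F X = G (Z1 X) (Y1 X)) ->
  (\int[@lebesgue_mx R n.+1 (n + m)]_X F X =
   grassmann_mass R n m * \int[@lebesgue_mx R 1 m]_y \int[@lebesgue_mx R n.+1 n]_z
     ((`|\det (bary z)| ^+ m)%:E * G z y))%E.
Proof.
move=> mF F0 mG G0 FG; rewrite -(ge0_blaschke_petkantschin Ip_iso Iq_iso m_gt0 mG G0).
have mchart := measurable_chart_domain (n := n) (m := m) (1%:M : 'M[R]_(n + m)).
apply: ge0_ae_eq_integral => //.
- apply: emeasurable_funM; first by apply/measurable_EFinP; exact: measurable_indic.
  apply: (measurableT_comp mG (f := fun z => G z.1 z.2) (g := fun X => (Z1 X, Y1 X))).
  by apply: measurable_fun_pair; [exact: (measurable_chart_Z Ip_iso (id_orthogonal R n m))|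
    exact: (measurable_chart_Y Iq_iso (id_orthogonal R n m))].
- by move=> X _; apply: mule_ge0; [rewrite lee_fin indicE|exact: G0].
exists (~` chart1); split; first exact: measurableC.
  exact: lebesgue_chart_domainC.
move=> X /= XF cX; apply: XF => _.
by rewrite indicE mem_set // mul1e FG.
Qed.

Lemma integral_power_beta_prime k d b : d%:R / 2 < b ->
  (\int[@lebesgue_mx R k d]_X (\prod_(i < k) (1 + edot (row i X) (row i X)) `^ (- b))%:E =
   ((ctilde d b)^-1 ^+ k)%:E)%E.
Proof.
move=> db.
pose g (x : 'rV[R]_d) : R := (1 + edot x x) `^ (- b).
have mg : measurable_fun setT g.
  by apply: measurable_powRl; apply: measurable_funD => //; exact: measurable_edot.
have g0 x : 0 <= g x by exact: powR_ge0.
have mgE : measurable_fun setT (EFin \o g) by exact/measurable_EFinP.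
pose nu := density_measure (lebesgue_rV R d) mg g0.
have nuT : nu setT = ((ctilde d b)^-1)%:E.
  by rewrite /nu /density_measure ge0_integral_lebesgue_rV //; exact: integral_beta_prime.
have mprod : measurable_fun setT
    (fun t : k.-tuple 'rV[R]_d => (\prod_(i < k) g (tnth t i))%:E : \bar R).
  apply/measurable_EFinP; apply: measurable_prod => i _.
  exact: (measurableT_comp mg (@measurable_tnth _ _ k i)).
transitivity (power_measure nu k setT).
  rewrite [RHS](power_density_measure _ mg g0) // ge0_integral_power_measure_rows //.
    by apply: eq_integral => X _; congr EFin; apply: eq_bigr => i _; rewrite tnth_mktuple.
  by move=> t; rewrite lee_fin prodr_ge0.
rewrite (_ : setT = [set t : k.-tuple 'rV[R]_d | forall i, setT (tnth t i)]); last first.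
  by apply/seteqP; split.
rewrite [LHS](@power_measure_box _ _ _ nu k (fun=> setT)) //.
rewrite (eq_bigr (fun=> ((ctilde d b)^-1)%:E)); last by move=> i _; exact: nuT.
by rewrite prodEFin prodr_const card_ord.
Qed.

Definition simplex_constant b : \bar R :=
  (\int[@lebesgue_mx R n.+1 n]_z (@simplex_kernel R n m b z)%:E)%E.

(** The left side is the integral of [n.+1] unnormalised beta' densities, computed point by point.
    On the right, the powers of [1 + |y|^2] extracted by the homothety leave a beta' integral in
    dimension [m]. *)
Lemma grassmann_mass_normalization b : (n + m)%:R / 2 < b ->
  (((ctilde (n + m) b)^-1 ^+ n.+1)%:E = grassmann_mass R n m *
   (((ctilde m (simplex_exponent n m b))^-1)%:E * simplex_constant b) :> \bar R)%E.
Proof.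
move=> db; rewrite -integral_power_beta_prime //.
pose G (z : 'M[R]_(n.+1, n)) (y : 'rV[R]_m) : \bar R :=
  (\prod_(i < n.+1) (1 + (edot (row i z) (row i z) + edot y y)) `^ (- b))%:E.
rewrite (@ge0_integral_chart_coordinates _ G).
- congr (_ * _)%E.
  rewrite -(integral_beta_prime (simplex_exponent_gt db)) muleC.
  have mk := measurable_simplex_kernel (R := R) (n := n) m b.
  have mp : measurable_fun setT (fun y : 'rV[R]_m =>
      ((1 + edot y y) `^ (- simplex_exponent n m b))%:E : \bar R).
    apply/measurable_EFinP; apply: measurable_powRl; apply: measurable_funD => //.
    exact: measurable_edot.
  rewrite -(ge0_integralZl _ measurableT mp) //.
  + apply: eq_integral => y _; rewrite muleC.
    have q0 : 0 < 1 + edot y y by rewrite ltr_wpDr ?edot_ge0.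
    transitivity (((1 + edot y y) `^ (- simplex_exponent n m b))%:E *
        \int[@lebesgue_mx R n.+1 n]_z (1 * simplex_kernel m b z)%:E)%E; last first.
      by congr (_ * _)%E; apply: eq_integral => z _; rewrite mul1r.
    rewrite -(@ge0_integral_simplex_scale R n m _ b (fun=> 1) q0) //.
    apply: eq_integral => z _; rewrite /G mul1r; congr (_ * _%:E)%E.
    by apply: eq_bigr => i _; congr (_ `^ _); ring.
  + by move=> y _; rewrite lee_fin powR_ge0.
  + by apply: integral_ge0 => z _; rewrite lee_fin simplex_kernel_ge0.
- apply/measurable_EFinP; apply: measurable_prod => i _; apply: measurable_powRl.
  by apply: measurable_funD => //; exact: measurable_row_edot.
- by move=> X; rewrite lee_fin prodr_ge0 // => i _; exact: powR_ge0.
- apply/measurable_EFinP; apply: measurable_prod => i _; apply: measurable_powRl.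
  apply: measurable_funD => //; apply: measurable_funD; first exact: measurable_row_edot.
  exact: measurable_edot.
- by move=> z y; rewrite lee_fin prodr_ge0 // => i _; exact: powR_ge0.
move=> X cX; rewrite /G; congr EFin; apply: eq_bigr => i _.
by rewrite (edot_row_chart Ip_iso Iq_iso (id_orthogonal R n m) cX).
Qed.

(** No estimate of the integrand is made: in the normalisation identity the left side is a positive
    real. A zero constant would make the right side zero; an infinite one would make it zero or
    infinite, according to whether the Grassmann mass vanishes. *)
Lemma simplex_constant_gt0 b : (n + m)%:R / 2 < b ->
  (0 < simplex_constant b < +oo)%E.
Proof.
move=> db; have := grassmann_mass_normalization db.
have c0 : 0 < ctilde (n + m) b by exact: ctilde_gt0.
have c'0 : 0 < ctilde m (simplex_exponent n m b).
  by apply: ctilde_gt0; exact: simplex_exponent_gt.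
have X0 : (0 <= simplex_constant b)%E.
  by apply: integral_ge0 => z _; rewrite lee_fin simplex_kernel_ge0.
have p0 : 0 < (ctilde (n + m) b)^-1 ^+ n.+1 by rewrite exprn_gt0 // invr_gt0.
have := grassmann_mass_ge0 R n m.
move: X0; case: (simplex_constant b) => [x x0|_|//] b0 E.
  rewrite ltry andbT lte_fin lt_def; move: x0; rewrite lee_fin => ->; rewrite andbT.
  by apply: contraTneq p0 => xE; rewrite -leNgt -lee_fin E xE !mule0.
exfalso; move: E p0; rewrite gt0_muley ?lte_fin ?invr_gt0 //.
move: b0; rewrite le_eqVlt => /predU1P[<-|b0]; first by rewrite mul0e => -[->]; rewrite ltxx.
by rewrite gt0_muley.
Qed.

(** On the left stand all the constants that accumulate in the law of [T2] apart from the power of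
    [alpha]: the constants of the [n.+1] densities, the mass of the directions and the integral of
    the simplex kernel. Only the real numbers [ctilde] are inverted, so the mass may stay an
    extended real. *)
Lemma grassmann_massE b : (n + m)%:R / 2 < b ->
  (grassmann_mass R n m * ((ctilde (n + m) b ^+ n.+1)%:E * simplex_constant b) =
   (ctilde m (simplex_exponent n m b))%:E)%E.
Proof.
move=> db; have := grassmann_mass_normalization db.
have c0 : 0 < ctilde (n + m) b by exact: ctilde_gt0.
have c'0 : 0 < ctilde m (simplex_exponent n m b).
  by apply: ctilde_gt0; exact: simplex_exponent_gt.
set c := ctilde m _; set p := ctilde (n + m) b => E.
rewrite muleCA.
have -> : (grassmann_mass R n m * simplex_constant b =
    c%:E * (grassmann_mass R n m * (c^-1%:E * simplex_constant b)))%E.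
  rewrite [RHS]muleCA; congr (_ * _)%E.
  by rewrite muleA -EFinM divff ?mul1e // gt_eqF.
rewrite -E -!EFinM; congr EFin.
by rewrite mulrCA exprVn divff ?mulr1 // expf_neq0 // gt_eqF.
Qed.

End normalization.

Section outer_density.
Context (R : realType) (d : nat) (a b : R).

Definition outside : set 'rV[R]_d := [set x | 1 < edot x x].

(** [fdens] cut off on the ball, where its formula is not meant, so that [Phi] becomes a measure
    with a nonnegative measurable density on the whole space. *)
Definition outer_density (x : 'rV[R]_d) : R :=
  \1_outside x * (a * ctilde d b * (edot x x - 1) `^ (- b)).

Lemma measurable_outside : measurable outside.
Proof.
rewrite (_ : outside = (fun x => edot x x) @^-1` `]1, +oo[%classic); last first.
  by apply/seteqP; split => x; rewrite /= in_itv /= andbT.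
by rewrite -[X in measurable X]setTI; apply: measurable_edot => //; exact: measurable_itv.
Qed.

Lemma measurable_outer_density : measurable_fun setT outer_density.
Proof.
apply: measurable_funM; first by apply: measurable_indic; exact: measurable_outside.
apply: measurable_funM => //; apply: measurable_powRl; apply: measurable_funB => //.
exact: measurable_edot.
Qed.

Lemma outer_density_ge0 x : 0 <= a -> d%:R / 2 < b -> 0 <= outer_density x.
Proof.
move=> a0 /ctilde_gt0/ltW c0; apply: mulr_ge0; first by rewrite indicE.
by apply: mulr_ge0; [exact: mulr_ge0|exact: powR_ge0].
Qed.

Lemma fdens_outside : (EFin \o @fdens R d a b) \_ (~` closed_unit_ball R d) =
  EFin \o outer_density.
Proof.
apply/funext => x; rewrite patchE /=.
have xE : (x \in ~` closed_unit_ball R d) = (x \in outside).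
  rewrite in_setC; apply/negP/idP; rewrite !inE /closed_unit_ball /outside /=.
    move=> /negP; rewrite -sqr_enorm -ltNge; apply: contraTT.
    by rewrite -!leNgt expr_le1 // enorm_ge0.
  by rewrite -sqr_enorm => /lt_geF h; rewrite -(expr_le1 (n := 2)) ?enorm_ge0 // h.
rewrite xE /outer_density indicE; case: (_ \in _); rewrite ?mul0r ?mul1r //.
by rewrite /fdens sqr_enorm powRN.
Qed.

Hypotheses (a_ge0 : 0 <= a) (b_gt : d%:R / 2 < b).

Lemma Phi_density : Phi d a b = density_measure (lebesgue_rV R d) measurable_outer_density
  (fun x => outer_density_ge0 x a_ge0 b_gt).
Proof.
apply/funext => A; rewrite /Phi /density_measure setDE integral_mkcondr.
by apply: eq_integral => x _; rewrite fdens_outside.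
Qed.

End outer_density.

(** * The joint law of the two coordinates *)

Section assembly.
Context (R : realType) (n m : nat) (alpha beta : R).
Hypotheses (m_gt0 : (0 < m)%N) (alpha_gt0 : 0 < alpha) (beta_gt : (n + m)%:R / 2 < beta).
Local Notation lebk := (power_measure (lebesgue_rV R n) n.+1).
Local Notation gamma := (simplex_exponent n m beta).

Let x0 := fine (simplex_constant n m beta).
Hypothesis x0_gt0 : 0 < x0.
Hypothesis x0E : simplex_constant n m beta = x0%:E.

Definition simplex_weight (t : n.+1.-tuple 'rV[R]_n) : R :=
  x0^-1 * simplex_kernel m beta (mx_of_rows t).

Lemma measurable_simplex_weight : measurable_fun setT simplex_weight.
Proof.
apply: measurable_funM => //; apply: (measurableT_comp (measurable_simplex_kernel m beta)).
exact: measurable_mx_of_rows.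
Qed.

Lemma simplex_weight_ge0 t : 0 <= simplex_weight t.
Proof. by rewrite mulr_ge0 ?simplex_kernel_ge0 // invr_ge0 ltW. Qed.

Definition simplex_law : set (n.+1.-tuple 'rV[R]_n) -> \bar R :=
  density_measure lebk measurable_simplex_weight simplex_weight_ge0.

HB.instance Definition _ := Measure.on simplex_law.

Lemma simplex_lawE A : measurable A ->
  (x0%:E * simplex_law A = \int[@lebesgue_mx R n.+1 n]_z
     (\1_A (rows_of_mx z) * simplex_kernel m beta z)%:E)%E.
Proof.
move=> mA; rewrite /simplex_law /density_measure integral_mkcond.
pose f := ((fun t => (simplex_weight t)%:E) \_ A).
have mf : measurable_fun setT f.
  apply/(measurable_restrictT _ _).1 => //; apply: measurable_funTS.
  by apply/measurable_EFinP; exact: measurable_simplex_weight.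
have f0 t : (0 <= f t)%E.
  by rewrite /f patchE; case: ifP => // _; rewrite lee_fin simplex_weight_ge0.
rewrite (ge0_integral_power_measure_rows mf f0).
have mfr : measurable_fun setT (fun z => f (rows_of_mx z)).
  by apply: (measurableT_comp mf); exact: measurable_rows_of_mx.
rewrite -(ge0_integralZl _ measurableT mfr) //; last by rewrite lee_fin ltW.
apply: eq_integral => z _; rewrite /f patchE /simplex_weight rows_of_mxK indicE.
case: (_ \in _); last by rewrite mule0 mul0r.
by rewrite mul1r -EFinM mulrA divff ?mul1r // gt_eqF.
Qed.

Lemma simplex_law_setT : simplex_law setT = 1%E.
Proof.
have := simplex_lawE measurableT.
under eq_integral do rewrite indicT mul1r.
rewrite -/(simplex_constant n m beta) x0E => /(congr1 (fun u => (x0^-1)%:E * u)%E).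
by rewrite muleA -!EFinM mulVf ?mul1e // gt_eqF.
Qed.

HB.instance Definition _ := Measure_isProbability.Build _ _ _ simplex_law simplex_law_setT.

Definition simplex_probability : probability (n.+1.-tuple 'rV[R]_n) R := simplex_law.

Variables (Ip : set 'rV[R]_(n + m) -> 'rV[R]_(n + m) -> 'rV[R]_n)
  (Iq : set 'rV[R]_(n + m) -> 'rV[R]_(n + m) -> 'rV[R]_m).
Hypotheses (Ip_iso : isometry_family Ip) (Iq_iso : isometry_family Iq).

Local Notation mu := (restrict_measure (power_measure (Phi (n + m) alpha beta) n.+1)
  (Skd R (n + m) n.+1)).
Local Notation T12 := (fun t => (tuple_T1 Ip t, tuple_T2 Iq t)).
Local Notation fout := (@outer_density R m (alpha ^+ n.+1) gamma).

Let fout_ge0 y : 0 <= fout y.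
Proof.
apply: outer_density_ge0; first by rewrite exprn_ge0 // ltW.
exact: simplex_exponent_gt.
Qed.

(** The integrand in the chart coordinates before the homothety: [z] is not yet rescaled, so the
    rescaling stands inside the indicator of [C]. Since [|x_i|^2 - 1 = |z_i|^2 + (|y|^2 - 1)], the
    quantity to factor out is [|y|^2 - 1]. *)
Let section_kernel (C : set (n.+1.-tuple 'rV[R]_n * 'rV[R]_m)) z y : \bar R :=
  (\1_C (rows_of_mx ((Num.sqrt (edot y y - 1))^-1 *: z), y) * (\1_(@outside R m) y *
    \prod_(i < n.+1) (alpha * ctilde (n + m) beta *
      (edot (row i z) (row i z) + (edot y y - 1)) `^ (- beta))))%:E.

(** Both claims are read off from this form: full sections give the density of the second
    coordinate, and Tonelli gives the product. *)
Lemma pushforward_T12 C : measurable C ->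
  (pushforward mu T12 C =
   \int[@lebesgue_mx R 1 m]_y ((fout y)%:E * simplex_law (ysection C y)))%E.
Proof.
move=> mC.
have a0 : 0 <= alpha by exact: ltW.
pose A := T12 @^-1` C `&` Skd R (n + m) n.+1.
have mA : measurable A.
  rewrite (_ : A = @mx_of_rows R n.+1 (n + m) @^-1` [set X |
      Skd R (n + m) n.+1 (rows_of_mx X) /\
      C (tuple_T1 Ip (rows_of_mx X), tuple_T2 Iq (rows_of_mx X))]).
    rewrite -[X in measurable X]setTI; apply: measurable_mx_of_rows => //.
    exact: measurable_Skd_T12.
  by apply/seteqP; split => t /=; rewrite mx_of_rowsK => -[].
transitivity (power_measure (Phi (n + m) alpha beta) n.+1 A); first by [].
rewrite (Phi_density a0 beta_gt) power_density_measure // integral_mkcond.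
set f := (_ \_ A).
have mf : measurable_fun setT f.
  apply/(measurable_restrictT _ _).1 => //; apply: measurable_funTS.
  apply/measurable_EFinP; apply: measurable_prod => i _.
  exact: (measurableT_comp (@measurable_outer_density _ _ _ _) (@measurable_tnth _ _ n.+1 i)).
have f0 t : (0 <= f t)%E.
  rewrite /f patchE; case: ifP => // _; rewrite lee_fin prodr_ge0 // => i _.
  exact: outer_density_ge0.
rewrite (ge0_integral_power_measure_rows mf f0).
have c0 : 0 < ctilde (n + m) beta by exact: ctilde_gt0.
rewrite (@ge0_integral_chart_coordinates R n m Ip Iq Ip_iso Iq_iso m_gt0 _ (section_kernel C)).
(* The target integrand without [ctilde m gamma]; that constant appears at the end, when the
   Grassmann mass meets [ctilde (n + m) beta ^+ n.+1 * x0]. *)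
- pose h y := ((\1_(@outside R m) y * (alpha ^+ n.+1 * (edot y y - 1) `^ (- gamma)))%:E *
    simplex_law (ysection C y))%E.
  have mh : measurable_fun setT h.
    apply: emeasurable_funM; last exact: measurable_fun_ysection.
    apply/measurable_EFinP; apply: measurable_funM.
      by apply: measurable_indic; exact: measurable_outside.
    apply: measurable_funM => //; apply: measurable_powRl.
    by apply: measurable_funB => //; exact: measurable_edot.
  have h0 y : (0 <= h y)%E.
    by rewrite mule_ge0 // lee_fin !mulr_ge0 ?powR_ge0 ?exprn_ge0 // indicE.
  have cx0 : (0 <= (ctilde (n + m) beta ^+ n.+1 * x0)%:E)%E.
    by rewrite lee_fin mulr_ge0 ?exprn_ge0 // ltW.
  transitivity (grassmann_mass R n m *
      \int[@lebesgue_mx R 1 m]_y ((ctilde (n + m) beta ^+ n.+1 * x0)%:E * h y))%E.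
    congr (_ * _)%E; apply: eq_integral => y _.
    have [yout|yin] := pselect (outside y); last first.
      rewrite /h indicE memNset // mul0r mul0e mule0; apply: integral0_eq => z _.
      by rewrite /section_kernel [X in _ * (X * _)]indicE memNset // mul0r mulr0 mule0.
    have q0 : 0 < edot y y - 1 by rewrite subr_gt0.
    have mCy := measurable_ysection y mC.
    pose a := (alpha * ctilde (n + m) beta) ^+ n.+1.
    have age0 : 0 <= a by rewrite exprn_ge0 // mulr_ge0 // ltW.
    (* For fixed [y] the indicator of [C] only tests the rescaled simplex; the constants of the
       [n.+1] densities are absorbed into the test function. *)
    pose E (z : 'M[R]_(n.+1, n)) : R := a * \1_(ysection C y) (rows_of_mx z).
    have mind : measurable_fun setT
        (fun z : 'M[R]_(n.+1, n) => \1_(ysection C y) (rows_of_mx z) : R).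
      apply: measurableT_comp; last exact: measurable_rows_of_mx.
      exact: measurable_indic.
    have mE : measurable_fun setT E by exact: measurable_funM.
    have E0 z : 0 <= E z by rewrite mulr_ge0 // indicE.
    transitivity (\int[@lebesgue_mx R n.+1 n]_z ((`|\det (bary z)| ^+ m)%:E *
       (E ((Num.sqrt (edot y y - 1))^-1 *: z) *
        \prod_(i < n.+1) (edot (row i z) (row i z) + (edot y y - 1)) `^ (- beta))%:E))%E.
      apply: eq_integral => z _; congr (_ * _%:E)%E.
      rewrite big_split /= prodr_const card_ord [X in _ * (X * _)]indicE.
      rewrite (mem_set yout) mul1r /E -/a.
      by rewrite mulrA [in RHS](mulrC a); congr (_ * _ * _); rewrite !indicE mem_ysection.
    rewrite [LHS](ge0_integral_simplex_scale m beta q0 mE E0).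
    have mEk : measurable_fun setT (fun z => (\1_(ysection C y) (rows_of_mx z) *
        simplex_kernel m beta z)%:E : \bar R).
      by apply/measurable_EFinP/measurable_funM => //; exact: measurable_simplex_kernel.
    transitivity (((edot y y - 1) `^ (- gamma))%:E * (a%:E *
        (x0%:E * simplex_law (ysection C y))))%E.
      rewrite simplex_lawE // -(ge0_integralZl _ measurableT mEk) //.
      + congr (_ * _)%E; apply: eq_integral => z _; rewrite -EFinM /E; congr EFin.
        by rewrite [RHS]mulrA.
      + by move=> z _; rewrite lee_fin mulr_ge0 ?simplex_kernel_ge0 // indicE.
    rewrite /h indicE mem_set // mul1r !muleA -!EFinM /a exprMn; congr (_%:E * _)%E.
    by ring.
  rewrite (ge0_integralZl _ measurableT mh) // muleA EFinM.
  rewrite -x0E (grassmann_massE Ip_iso Iq_iso m_gt0 beta_gt).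
  have c'0 : (0 <= (ctilde m gamma)%:E :> \bar R)%E.
    by rewrite lee_fin ltW // ctilde_gt0 //; exact: simplex_exponent_gt.
  rewrite -(ge0_integralZl _ measurableT mh) //; apply: eq_integral => y _.
  rewrite /h muleA -EFinM; congr (_%:E * _)%E; rewrite /outer_density.
  by ring.
- by apply: (measurableT_comp mf); exact: measurable_rows_of_mx.
- by move=> X; exact: f0.
- apply/measurable_EFinP; apply: measurable_funM.
    have mind : measurable_fun setT (\1_C : _ -> R) by exact: measurable_indic.
    apply: (measurableT_comp mind (g := fun z : 'M[R]_(n.+1, n) * 'rV[R]_m =>
      (rows_of_mx ((Num.sqrt (edot z.2 z.2 - 1))^-1 *: z.1), z.2))).
    apply: measurable_fun_pair => //.
    apply: (measurableT_comp (@measurable_rows_of_mx R n.+1 n)).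
    apply: measurable_scalemx => //; apply: measurable_invr; apply: measurable_sqrtr.
    by apply: measurable_funB => //; exact: measurable_edot.
  apply: measurable_funM.
    apply: (measurableT_comp _ measurable_snd).
    by apply: measurable_indic; exact: measurable_outside.
  apply: measurable_prod => i _; apply: measurable_funM => //; apply: measurable_powRl.
  apply: measurable_funD; first exact: measurable_row_edot.
  by apply: measurable_funB => //; exact: measurable_edot.
- move=> z y; rewrite lee_fin mulr_ge0 ?indicE // mulr_ge0 // prodr_ge0 // => i _.
  by rewrite mulr_ge0 ?powR_ge0 // mulr_ge0 // ltW.
move=> X cX; rewrite /f patchE /section_kernel.
have YT := tuple_T2_chart Iq (id_orthogonal R n m) cX.
have ZT := tuple_T1_chart Ip Iq_iso (id_orthogonal R n m) cX.
have SE := Skd_chart Iq_iso (id_orthogonal R n m) cX.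
have [Yout|Yin] := pselect (outside (chart_Y Iq (n := n) 1%:M X)); last first.
  rewrite memNset; last by move=> [_ /SE].
  by rewrite [X in _ * (X * _)]indicE memNset // mul0r mulr0.
have -> : (rows_of_mx X \in A) = ((tuple_T1 Ip (rows_of_mx X), tuple_T2 Iq (rows_of_mx X)) \in C).
  by apply/idP/idP; rewrite !inE; [case|move=> CX; split => //; exact/SE].
rewrite -ZT -YT [X in _ = (X * _)%:E]indicE; case: (_ \in C); rewrite ?mul0r // mul1r YT.
rewrite indicE mem_set // mul1r; congr EFin; apply: eq_bigr => i _.
have rE := edot_row_chart Ip_iso Iq_iso (id_orthogonal R n m) cX i.
rewrite tnth_mktuple /outer_density indicE mem_set ?mul1r; first by rewrite rE addrA.
(* Since [|x_i|^2 >= |y|^2 > 1], the points of a flat missing the ball are outside it as well, so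
   the cut-off of each factor is inactive. *)
by rewrite /outside /= rE (lt_le_trans Yout) // lerDr edot_ge0.
Qed.

Lemma measurable_fout : measurable_fun setT fout.
Proof. exact: measurable_outer_density. Qed.

Lemma pushforward_T2 B : measurable B ->
  (pushforward mu (tuple_T2 Iq) B = \int[@lebesgue_mx R 1 m]_y (fout y * \1_B y)%:E)%E.
Proof.
move=> mB; transitivity (pushforward mu T12 (setT `*` B)).
  by rewrite /pushforward; congr mu; apply/seteqP; split => t //= -[].
rewrite pushforward_T12; last exact: measurableX.
apply: eq_integral => y _; rewrite indicE; have [yB|yB] := boolP (y \in B).
  by rewrite in_ysectionX // simplex_law_setT mule1 mulr1.
by rewrite notin_ysectionX // measure0 mule0 mulr0.
Qed.

Lemma pushforward_T2_fdens B : measurable B ->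
  (pushforward mu (tuple_T2 Iq) B =
   \int[lebesgue_rV R m]_(y in B `\` closed_unit_ball R m)
     (fdens (alpha ^+ n.+1) gamma y)%:E)%E.
Proof.
move=> mB; rewrite pushforward_T2 // setDE integral_mkcondr.
have mf : measurable_fun setT (fun y => (fout y * \1_B y)%:E).
  by apply/measurable_EFinP/measurable_funM => //; exact: measurable_fout.
have f0 y : (0 <= (fout y * \1_B y)%:E)%E by rewrite lee_fin mulr_ge0 // indicE.
rewrite -(ge0_integral_lebesgue_rV mf f0) [RHS]integral_mkcond.
apply: eq_integral => y _; rewrite patchE fdens_outside indicE /=.
by case: (_ \in _); rewrite ?mulr1 ?mulr0.
Qed.

(** The product measure unfolds to an integral of the second factor over sections of [C], so its
    values given by [pushforward_T2] suffice; Tonelli then moves [simplex_law] innermost. *)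
Lemma product_decomposition C : measurable C ->
  (pushforward mu T12 C = (simplex_law \x pushforward mu (tuple_T2 Iq)) C)%E.
Proof.
move=> mC; rewrite pushforward_T12 // [RHS]/product_measure1.
pose F t y := (fout y * \1_C (t, y))%:E.
have mF : measurable_fun setT (fun z : n.+1.-tuple 'rV[R]_n * 'rV[R]_m => F z.1 z.2).
  apply/measurable_EFinP; apply: measurable_funM.
    exact: (measurableT_comp measurable_fout).
  have : measurable_fun setT (\1_C : _ -> R) by exact: measurable_indic.
  by apply: eq_measurable_fun => -[].
have F0 t y : (0 <= F t y)%E by rewrite lee_fin mulr_ge0 // indicE.
transitivity (\int[simplex_law]_t \int[@lebesgue_mx R 1 m]_y F t y)%E; last first.
  apply: eq_integral => t _; rewrite [RHS]pushforward_T2; last exact: measurable_xsection.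
  by apply: eq_integral => y _; rewrite /F !indicE mem_xsection.
rewrite [RHS](ge0_integral_swap _ _ mF F0); apply: eq_integral => y _.
have mCy := measurable_ysection y mC.
have mind : measurable_fun setT (fun t => (\1_(ysection C y) t)%:E : \bar R).
  by apply/measurable_EFinP; exact: measurable_indic.
rewrite -(setIT (ysection C y)) -(integral_indic simplex_law) //.
rewrite -(ge0_integralZl _ measurableT mind) // ?lee_fin //.
by apply: eq_integral => t _; rewrite /F -EFinM !indicE mem_ysection.
Qed.

Lemma simplex_lawE_density : exists c : R, forall A, measurable A ->
  simplex_law A = (\int[lebk]_(z in A) (c * (volume (conv_hull z) ^+ m *
    \prod_(i < n.+1) ftilde beta (tnth z i)))%:E)%E.
Proof.
have n_lt : n%:R / 2 < beta.
  by apply: le_lt_trans beta_gt; rewrite ler_pM2r ?invr_gt0 // ler_nat leq_addr.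
have c0 := ctilde_gt0 n_lt; have v0 := (corner_volume_gt0 R n).1.
(* [x0] normalises the kernel written with [|\det (bary z)|] and without the constants of the beta'
   densities; the denominator accounts for the passage to volumes and to [ftilde]. *)
exists (x0^-1 / (corner_volume R n ^+ m * ctilde n beta ^+ n.+1)) => A mA.
apply: eq_integral => t _; congr EFin; rewrite /simplex_weight -mulrA; congr (_ * _).
rewrite -[t in RHS]mx_of_rowsK; set X := mx_of_rows t.
rewrite lebesgue_conv_hull [(_ * `|_|) ^+ m]exprMn /simplex_kernel.
have -> : \prod_(i < n.+1) ftilde beta (tnth (rows_of_mx X) i) =
    ctilde n beta ^+ n.+1 * \prod_(i < n.+1) (1 + edot (row i X) (row i X)) `^ (- beta).
  rewrite -[X in _ ^+ X](card_ord n.+1) -prodr_const -big_split /=.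
  by apply: eq_bigr => i _; rewrite /ftilde tnth_mktuple sqr_enorm.
field.
by rewrite !expf_neq0 ?gt_eqF.
Qed.

End assembly.

(** The isometries are typed over [d], which is not convertible to a sum with [n]. With [d], [n] and
    [m] as variables linked by an equation, [d] can be substituted without casts. *)
Lemma beta_prime_decomposition (R : realType) (d n m : nat) (alpha beta : R)
    (Ip : set 'rV[R]_d -> 'rV[R]_d -> 'rV[R]_n)
    (Iq : set 'rV[R]_d -> 'rV[R]_d -> 'rV[R]_m) :
  d = (n + m)%N -> (0 < m)%N -> 0 < alpha -> d%:R / 2 < beta ->
  isometry_family Ip -> isometry_family Iq ->
  let mu := restrict_measure (power_measure (Phi d alpha beta) n.+1) (Skd R d n.+1) in
  let S1 (x : n.+1.-tuple 'rV[R]_d) :=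
    [tuple (Num.sqrt (dist0 (aff x) ^+ 2 - 1))^-1 *: Ip (aff x) (tnth x i) | i < n.+1] in
  let S2 (x : n.+1.-tuple 'rV[R]_d) := Iq (aff_perp (aff x)) (closest_point (aff x)) in
  (exists phi : probability (n.+1.-tuple 'rV[R]_n) R,
     (exists c : R, forall A, measurable A ->
        phi A = (\int[power_measure (lebesgue_rV R n) n.+1]_(z in A)
          (c * (volume (conv_hull z) ^+ m * \prod_(i < n.+1) ftilde beta (tnth z i)))%:E)%E) /\
     (forall C, measurable C ->
        pushforward mu (fun x => (S1 x, S2 x)) C = (phi \x pushforward mu S2)%E C)) /\
  (forall B, measurable B ->
     pushforward mu S2 B =
     (\int[lebesgue_rV R m]_(y in B `\` closed_unit_ball R m)
        (fdens (alpha ^+ n.+1) (n.+1%:R * beta - (d.+1 * n)%:R / 2) y)%:E)%E).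
Proof.
move=> dE; subst d => m0 a0 db Ip_iso Iq_iso mu S1 S2.
have /andP[X0 Xoo] := simplex_constant_gt0 Ip_iso Iq_iso m0 db.
have XE : simplex_constant n m beta = (fine (simplex_constant n m beta))%:E.
  by rewrite fineK // ge0_fin_numE // ltW.
have x0 : 0 < fine (simplex_constant n m beta) by rewrite -lte_fin -XE.
split; last first.
  move=> B; exact: (pushforward_T2_fdens m0 a0 db x0 XE Ip_iso Iq_iso).
exists (simplex_probability x0 XE).
split; first by move=> *; exact: (simplex_lawE_density db x0).
by move=> C; exact: (product_decomposition m0 a0 db x0 XE Ip_iso Iq_iso).
Qed.

Theorem theorem5p3 (R : realType) (d k : nat) (alpha beta : R)
    (I : forall l, set 'rV[R]_d -> 'rV[R]_d -> 'rV[R]_l)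
    (alpha_gt0 : 0 < alpha) (beta_gt : d%:R / 2 < beta)
    (k_gt0 : (1 <= k)%N) (k_le_d : (k <= d)%N)
    (I_par : isometry_family (I k.-1))
    (I_perp : isometry_family (I (d - k).+1)) :
  let mu := restrict_measure (power_measure (Phi d alpha beta) k)
              (Skd R d k) in
  (exists phi : probability (k.-tuple 'rV[R]_(k.-1)) R,
     (exists c : R, forall A, measurable A ->
        phi A = (\int[power_measure (lebesgue_rV R k.-1) k]_(z in A)
                   (c * simplex_density d beta z)%:E)%E) /\
     (forall C, measurable C ->
        pushforward mu (T12 I) C = (phi \x pushforward mu (T2 I))%E C)) /\
  (forall B, measurable B ->
     pushforward mu (T2 I) B =
     (\int[lebesgue_rV R (d - k).+1]_(y in
             B `\` closed_unit_ball R (d - k).+1)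
        (fdens (alpha ^+ k)
           (k%:R * beta - (d.+1 * k.-1)%:R / 2) y)%:E)%E).
Proof.
case: k k_gt0 k_le_d I_par I_perp => // n _ nd I_par I_perp.
(* For [k = n.+1] the codimension index [(d - k).+1] takes the place of [m]; it is a successor,
   hence positive. *)
have dE : d = (n + (d - n.+1).+1)%N by rewrite addnS -addSn subnKC.
exact: (beta_prime_decomposition dE _ alpha_gt0 beta_gt I_par I_perp).
Qed.
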